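(* Let $0<R<1$, $\Delta_V<\Delta_C$ positive integers with $\Delta_V/\Delta_C=1-R$, $A>2(1+R)$, $B>2(1+R)/(1-R)$, $1\le\alpha<A$, $\frac1{1-R}<\beta<\min\{\frac2{1-R},B\}$, and fix \[ \epsilon=\frac{1-R}{A+1-R},\qquad\vartheta=\frac{1}{B(1-R)+1}. \] Suppose $\Delta_V$ satisfies the degree condition $(\star)$ below and that for each $n$ the graph $\mathcal G=\mathcal G^{(n)}$ is $(\alpha,A,\beta,B,\epsilon,\vartheta)$-good. Let \[ \lambda>\max\Big\{\frac1R,\ \frac1{1-R},\ \frac{2}{A-2(1+R)},\ \frac{2}{B(1-R)-2(1+R)},\ 2\Big(1-\frac{1}{AB-1}-\frac1A\Big)^{-1}\Big\}, \] and let $\Lambda$ be randomly chosen from the $(\mathcal G,\lambda)$ LDA ensemble. Then the probability that $\Lambda$ is good for MSE quantization tends to $1$ as $n\to\infty$.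
   Context: $\mathcal G$ is a $(\Delta_V,\Delta_C)$-regular bipartite graph with $n$ variable nodes and $n(1-R)$ check nodes; $N(S)$ denotes neighbourhood. It is $(\alpha,A,\beta,B,\epsilon,\vartheta)$-good if: (L1) variable-node sets $S$ with $|S|\le\lceil\epsilon n\rceil$ have $|N(S)|\ge A|S|$; (L2) variable-node sets $S$ with $|S|\le\lceil n(1-R)/(2\alpha)\rceil$ have $|N(S)|\ge\alpha|S|$; (R1) check-node sets $T$ with $|T|\le\vartheta n(1-R)$ have $|N(T)|\ge B|T|$; (R2) check-node sets $T$ with $|T|\le n(1-R)/2$ have $|N(T)|\ge\beta|T|$. Degree condition $(\star)$, with $h_2(a)=-a\log_2a-(1-a)\log_2(1-a)$: $\Delta_V>\max\Big\{\frac{h_2(\frac{1-R}{2\alpha})+1-R}{h_2(\frac{1-R}{2\alpha})-\frac12h_2(\frac{1-R}{\alpha})},\ R+2\alpha,\ A+1,\ \frac{h_2(\epsilon)+(1-R)h_2(\frac{A\epsilon}{1-R})}{h_2(\epsilon)-\frac{A\epsilon}{1-R}h_2(\frac{1-R}{A})},\ \frac{1-R+h_2(\frac{\beta(1-R)}{2})}{1-\frac{\beta(1-R)}{2}h_2(\frac{1}{\beta(1-R)})},\ \frac{(2+\beta R)(1-R)}{2-\beta(1-R)},\ (1-R)(B+1),\ \frac{(1-R)h_2(\vartheta)+h_2(B\vartheta(1-R))}{h_2(\vartheta)-B\vartheta(1-R)h_2(\frac{1}{B(1-R)})},\ \frac{(A+1)(1-R)-A\epsilon(2-R)}{1-R-A\epsilon},\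 \frac{B+1-\vartheta B(2-R)}{\frac1{1-R}-\vartheta B}\Big\}$. $(\mathcal G,\lambda)$ LDA ensemble: $p$ is the smallest prime $\ge n^\lambda$; $\widehat H$ is the $n(1-R)\times n$ $0/1$ biadjacency matrix of $\mathcal G$; $H$ has entries $\widehat h_{i,j}h'_{i,j}$ with $h'_{i,j}$ i.i.d. uniform on $\mathbb F_p$; $\Lambda=\{\mathbf x\in\mathbb Z^n:H(\mathbf x\bmod p)=\mathbf 0\text{ over }\mathbb F_p\}$. For a lattice $\Lambda$ with fundamental Voronoi region $\mathcal V(\Lambda)$ of volume $\mathrm{vol}(\Lambda)$, $G(\Lambda)=\frac{1}{n\,\mathrm{vol}(\Lambda)^{1+2/n}}\int_{\mathcal V(\Lambda)}\|\mathbf y\|^2d\mathbf y$; a sequence $\{\Lambda^{(n)}\}$ is good for MSE quantization if $G(\Lambda^{(n)})\to\frac1{2\pi e}$. *)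

(* Defs.v *)
From HB Require Import structures.
From mathcomp Require Import all_boot all_order all_algebra.
From mathcomp Require Import all_classical all_reals all_analysis.
Set Implicit Arguments. Unset Strict Implicit. Unset Printing Implicit Defensive.
Import Order.TTheory GRing.Theory Num.Theory.
Import numFieldNormedType.Exports.
Local Open Scope classical_set_scope.
Local Open Scope ring_scope.

Section Defs.
Variable R : realType.

Definition log2 (x : R) : R := ln x / ln 2.
Definition h2 (a : R) : R := - a * log2 a - (1 - a) * log2 (1 - a).

(* rows = check nodes ('I_m), columns = variable nodes ('I_n); entry true = edge *)

Definition var_deg m n (Hh : 'M[bool]_(m, n)) (j : 'I_n) : nat := #|[set i | Hh i j]|.
Definition chk_deg m n (Hh : 'M[bool]_(m, n)) (i : 'I_m) : nat := #|[set j | Hh i j]|.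

Definition regular_bip m n (Hh : 'M[bool]_(m, n)) (DV DC : nat) : Prop :=
  (forall j, var_deg Hh j = DV) /\ (forall i, chk_deg Hh i = DC).

Definition NV m n (Hh : 'M[bool]_(m, n)) (S : {set 'I_n}) : {set 'I_m} :=
  [set i | [exists j in S, Hh i j]].
Definition NC m n (Hh : 'M[bool]_(m, n)) (T : {set 'I_m}) : {set 'I_n} :=
  [set j | [exists i in T, Hh i j]].

(* (alpha, A, beta, B, eps, theta)-good, for a graph with n variable nodes and
   n(1-Rt) check nodes *)
Definition good_graph m n (Hh : 'M[bool]_(m, n)) (Rt alpha A beta B eps theta : R)
  : Prop :=
  let nR : R := n%:R in
  [/\ (* L1 *) forall S : {set 'I_n},
        (#|S| %:R <= (Num.ceil (eps * nR))%:~R :> R) ->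
        A * #|S|%:R <= #|NV Hh S|%:R,
      (* L2 *) forall S : {set 'I_n},
        (#|S| %:R <= (Num.ceil (nR * (1 - Rt) / (2 * alpha)))%:~R :> R) ->
        alpha * #|S|%:R <= #|NV Hh S|%:R,
      (* R1 *) forall T : {set 'I_m},
        (#|T| %:R <= theta * nR * (1 - Rt) :> R) ->
        B * #|T|%:R <= #|NC Hh T|%:R
    & (* R2 *) forall T : {set 'I_m},
        (#|T| %:R <= nR * (1 - Rt) / 2 :> R) ->
        beta * #|T|%:R <= #|NC Hh T|%:R ].

Definition degree_condition (DV : nat) (Rt alpha A beta B eps theta : R) : Prop :=
  let D : R := DV%:R in
  ((h2 ((1 - Rt) / (2 * alpha)) + 1 - Rt) /
        (h2 ((1 - Rt) / (2 * alpha)) - 2^-1 * h2 ((1 - Rt) / alpha)) < D) /\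
  (      Rt + 2 * alpha < D) /\
  (      A + 1 < D) /\
  (      (h2 eps + (1 - Rt) * h2 (A * eps / (1 - Rt))) /
        (h2 eps - A * eps / (1 - Rt) * h2 ((1 - Rt) / A)) < D) /\
  (      (1 - Rt + h2 (beta * (1 - Rt) / 2)) /
        (1 - beta * (1 - Rt) / 2 * h2 (1 / (beta * (1 - Rt)))) < D) /\
  (      (2 + beta * Rt) * (1 - Rt) / (2 - beta * (1 - Rt)) < D) /\
  (      (1 - Rt) * (B + 1) < D) /\
  (      ((1 - Rt) * h2 theta + h2 (B * theta * (1 - Rt))) /
        (h2 theta - B * theta * (1 - Rt) * h2 (1 / (B * (1 - Rt)))) < D) /\
  (      ((A + 1) * (1 - Rt) - A * eps * (2 - Rt)) / (1 - Rt - A * eps) < D) /\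
  ((B + 1 - theta * B * (2 - Rt)) / ((1 - Rt)^-1 - theta * B) < D).

Definition LDA_member (p m n : nat) (Hh : 'M[bool]_(m, n)) (h' : 'M['F_p]_(m, n))
  (x : 'rV[int]_n) : Prop :=
  forall i : 'I_m,
    \sum_(j < n) ((if Hh i j then h' i j else 0) * (x 0 j)%:~R) = 0 :> 'F_p.

Definition LDA_lattice (p m n : nat) (Hh : 'M[bool]_(m, n)) (h' : 'M['F_p]_(m, n))
  : set 'rV[R]_n :=
  [set y | exists x : 'rV[int]_n, LDA_member Hh h' x /\ y = map_mx (fun z : int => z%:~R) x].

Definition sqnorm n (y : 'rV[R]_n) : R := \sum_(i < n) y 0 i ^+ 2.

Definition voronoi n (L : set 'rV[R]_n) : set 'rV[R]_n :=
  [set y | forall z, L z -> sqnorm y <= sqnorm (y - z)].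

(* Lebesgue integral over R^n of a nonnegative function, as the iterated integral
   of one-dimensional Lebesgue integrals (Tonelli).  Points are encoded by
   sequences s : nat -> R, of which only the first n coordinates matter. *)
Fixpoint iter_int (k : nat) (f : (nat -> R) -> \bar R) : \bar R :=
  match k with
  | 0 => f (fun _ => 0)
  | k'.+1 => (\int[@lebesgue_measure R]_(x in setT)
                iter_int k' (fun s => f (fun i => if i == k' then x else s i)))%E
  end.

Definition int_Rn n (g : 'rV[R]_n -> \bar R) : \bar R :=
  iter_int n (fun s => g (\row_(i < n) s i)).

Definition leb_Rn n (V : set 'rV[R]_n) : \bar R :=
  int_Rn (fun y => (\1_V y)%:E).

Definition vol_lat n (L : set 'rV[R]_n) : R := fine (leb_Rn (voronoi L)).

Definition second_moment n (L : set 'rV[R]_n) : R :=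
  fine (int_Rn (fun y => (\1_(voronoi L) y * sqnorm y)%:E)).

Definition nsm n (L : set 'rV[R]_n) : R :=
  (n%:R * vol_lat L `^ (1 + 2 / n%:R))^-1 * second_moment L.

Definition prob_nsm_close (p m n : nat) (Hh : 'M[bool]_(m, n)) (delta : R) : R :=
  #|[set h' : 'M['F_p]_(m, n) |
      `| nsm (LDA_lattice Hh h') - (2 * pi * expR 1)^-1 | < delta]|%:R /
  #|[set: 'M['F_p]_(m, n)]|%:R.

End Defs.

(* Main.v *)
Require Import Defs.
From HB Require Import structures.
From mathcomp Require Import all_boot all_order all_algebra.
From mathcomp Require Import all_classical all_reals all_analysis.
From mathcomp Require Import measurable_realfun normal_distribution zify ring lra.
Set Implicit Arguments. Unset Strict Implicit. Unset Printing Implicit Defensive.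
Import Order.TTheory GRing.Theory Num.Theory.
Import numFieldNormedType.Exports.

(** Let [q = p^(1-R)] and draw [x] in [F_p^n] from a discrete Gaussian
    of variance slightly above [q^2/(2 pi e)] per coordinate, conditioned on a
    thin spherical shell.  If [Q] is the probability that two independent draws
    have the same syndrome, then by Cauchy-Schwarz at least [1/Q] syndromes are
    hit by points of the shell, and such a syndrome is a coset of the lattice
    with a point within the radius of the shell.  Averaging over the random
    matrix, [p^m E(Q) - 1] is the mean of [p^|T| - 1] over pairs of draws, [T] being
    the set of check nodes not adjacent to the support of their difference.  The
    expansion of [T] (when [|T| <= m/2]) or of the support (otherwise) makes this
    [o(p^(-2R))], which beats the trivial covering radius [sqrt n * p], so Markov's
    inequality bounds the second moment of the Voronoi cell, up to [1 + o(1)], by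
    the squared radius of the shell.  The matching lower bound on the second
    moment holds for every cell: compare [exp (- a |y|^2)] with its tangent line
    and integrate.  Polynomial growth of [p] in [n], needed to compare [p^(2R)]
    with the exponentially small atypical part, is Chebyshev's argument. *)

(** * A prime between a number and its square *)

(** The shell is there because collisions measure the Rényi entropy of order 2. A full Gaussian of
    variance v collides with probability 1 / sqrt (4 pi v) per coordinate, so spreading over q^n
    syndromes would force v above q^2 / (4 pi). On a thin shell the weight is almost constant, the
    order-2 entropy nearly equals the Shannon entropy, and the threshold drops to q^2 / (2 pi e).

    The passage from finite counts to the real Voronoi cell cuts R^n into unit cubes. For almost
    every offset u in the cube, each nonempty syndrome class of Z^n, translated by u, has exactly
    one point in the cell. The volume is thus the number of attained syndromes, and the second
    moment is at most the sum over syndromes of any bound for that point; the offset itself costs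
    only sqrt n in norm.

    Two estimates of the probability that two draws agree on a set of coordinates are needed.
    Forgetting the shell is good enough when few coordinates are fixed; when nearly all are fixed,
    the inner radius must be used. *)

Section CentralBinomial.
Local Open Scope nat_scope.

(** By Legendre's formula the exponent is the sum over k of floor(2M / q^k) - 2 floor(M / q^k). Each
    term is 0 or 1 and vanishes once q^k > 2M, so the exponent is at most the logarithm of 2M to
    base q. *)
Lemma pfactor_central_binomial_le q M : prime q -> (0 < M)%N ->
  (q ^ logn q 'C(2 * M, M) <= 2 * M)%N.
Proof.
move=> q_pr M0; have q1 := prime_gt1 q_pr.
have M2 : (M <= 2 * M)%N by lia.
have H : (logn q (2 * M)`! = logn q 'C(2 * M, M) + 2 * logn q M`!)%N.
  have MM : (2 * M - M = M)%N by lia.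
  rewrite -(bin_fact M2) MM.
  by rewrite !lognM ?muln_gt0 ?fact_gt0 ?bin_gt0// addnn -mul2n.
have HM : (logn q M`! = \sum_(1 <= k < (2 * M).+1) M %/ q ^ k)%N.
  rewrite logn_fact// [RHS](@big_cat_nat _ _ _ M.+1)//=.
  rewrite [X in (_ + X)%N]big_nat_cond [X in (_ + X)%N]big1 ?addn0// => k /andP[/andP[Mk _] _].
  by rewrite divn_small// (leq_trans Mk)// ltnW// ltn_expl.
have tr := trunc_logP q1 (_ : 0 < 2 * M)%N.
apply: leq_trans (tr _); last lia.
rewrite leq_exp2l//.
have -> : logn q 'C(2 * M, M) =
    (\sum_(1 <= k < (2 * M).+1) ((2 * M) %/ q ^ k - 2 * (M %/ q ^ k)))%N.
  have -> : logn q 'C(2 * M, M) = (logn q (2 * M)`! - 2 * logn q M`!)%N by rewrite H addnK.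
  rewrite HM logn_fact// big_distrr/= sumnB// => k _.
  by rewrite mulnC leq_divRL ?expn_gt0 ?(ltnW q1)//; have := leq_divM M (q ^ k); lia.
set e := trunc_log q (2 * M).
have e2 : (e <= 2 * M)%N.
  have := tr (ltac:(lia)); have := ltn_expl e q1; rewrite -/e; lia.
rewrite (@big_cat_nat _ _ _ e.+1)//=.
rewrite [X in (_ + X)%N]big_nat_cond [X in (_ + X)%N]big1 ?addn0.
  apply: (@leq_trans (\sum_(1 <= k < e.+1) 1)); last first.
    by rewrite sum_nat_const_nat muln1 subn1.
  apply: leq_sum => k _.
  have qk : (0 < q ^ k)%N by rewrite expn_gt0 ltnW.
  have := divn_eq M (q ^ k); have := ltn_pmod M qk.
  have := leq_divM (2 * M) (q ^ k).
  set a := (M %/ _)%N; set b := (_ %/ _)%N; nia.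
move=> k /andP[/andP[ek _] _]; rewrite divn_small//.
rewrite (leq_trans (trunc_log_ltn _ q1))// leq_exp2l//.
Qed.

(** Induction with (M+1) C(2M+2, M+1) = 2 (2M+1) C(2M, M); the step reduces to 8M <= 8M + 4. *)
Lemma central_binomial_ge M : (0 < M)%N -> (4 ^ M <= 2 * M * 'C(2 * M, M))%N.
Proof.
elim: M => [//|[|M] IH _]; first by [].
have {}IH := IH isT.
have H : (M.+2 * 'C(2 * M.+2, M.+2) = 2 * (2 * M.+1 + 1) * 'C(2 * M.+1, M.+1))%N.
  have E1 := mul_bin_diag (2 * M.+1).+2 M.+1.
  have E2 := mul_bin_down (2 * M.+1).+1 M.+1.
  have e0 : (2 * M.+2 = (2 * M.+1).+2)%N by lia.
  have e3 : ((2 * M.+1).+1 - M.+1 = M.+2)%N by lia.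
  rewrite e0; move: E1 E2; rewrite e3 /=.
  set x := 'C((2 * M.+1).+2, M.+2); set y := 'C((2 * M.+1).+1, M.+1).
  set z := 'C(2 * M.+1, M.+1); nia.
rewrite expnS -mulnA H.
set z := 'C(2 * M.+1, M.+1) in IH *; set u := (4 ^ _)%N in IH *; nia.
Qed.

(** Otherwise all prime factors of C(2M, M), with M the half of N^2, are below N. There are at most
    N of them, each with prime power at most 2M, so 4^M <= (N^2)^(N+1). Since N^2 < 2^(N-1), this is
    less than 2^((N-1)(N+1)) = 2^(N^2-1), which in turn is at most 4^M. *)
Lemma prime_between_square N : (8 <= N)%N -> exists2 q, prime q & (N <= q <= N ^ 2)%N.
Proof.
move=> N8; have [/hasP[q]|/hasPn nop] := boolP (has prime (iota N (N ^ 2 - N).+1)).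
  rewrite mem_iota => /andP[q1 q2] q_pr; exists q => //; rewrite q1/=.
  have : (N <= N ^ 2)%N by nia.
  lia.
exfalso; pose M := (N ^ 2)./2.
have M0 : (0 < M)%N by rewrite /M; nia.
have M2 : (2 * M <= N ^ 2)%N by rewrite /M; lia.
set C := 'C(2 * M, M).
have C0 : (0 < C)%N by rewrite bin_gt0; lia.
have primesC q : q \in primes C -> (q < N)%N.
  rewrite mem_primes => /and3P[q_pr _ qC]; rewrite ltnNge; apply/negP => Nq.
  have q2M : (q <= 2 * M)%N.
    have qf : (q %| (2 * M)`!)%N.
      by rewrite -(@bin_fact (2 * M) M) ?dvdn_mulr//; lia.
    have : (0 < logn q (2 * M)`!)%N by rewrite logn_gt0 mem_primes q_pr fact_gt0 qf.
    rewrite logn_fact//; apply: contraLR; rewrite -ltnNge => q2M.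
    rewrite lt0n negbK big_nat_cond big1// => k /andP[/andP[k1 _] _].
    by rewrite divn_small// (leq_trans q2M)// -{1}(expn1 q) leq_exp2l ?prime_gt1.
  have := nop q; rewrite mem_iota q_pr => /(_ _)/negP; apply => //.
  by rewrite Nq/=; lia.
have sz : (size (primes C) <= N)%N.
  rewrite -(size_iota 0 N); apply: uniq_leq_size; first exact: primes_uniq.
  by move=> q /primesC; rewrite mem_iota.
have CN : (C <= (2 * M) ^ N)%N.
  rewrite (prod_prime_decomp C0) prime_decompE big_map/=.
  apply: (@leq_trans ((2 * M) ^ size (primes C))); last by rewrite leq_pexp2l//; lia.
  have: {subset primes C <= primes C} by [].
  elim: {1 3 4}(primes C) => [|q s IHs] sC; first by rewrite big_nil.
  rewrite big_cons expnS leq_mul//.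
    apply: pfactor_central_binomial_le => //.
    by have := sC q (mem_head _ _); rewrite mem_primes => /andP[].
  by apply: IHs => x xs; apply: sC; rewrite inE xs orbT.
have big k : (8 <= k)%N -> (k ^ 2 < 2 ^ k.-1)%N.
  elim: k => // k IH; rewrite leq_eqVlt => /orP[/eqP <-//|k8].
  have := IH k8; have -> : (2 ^ k.+1.-1 = 2 * 2 ^ k.-1)%N by rewrite -expnS prednK//; lia.
  set u := (2 ^ _)%N; nia.
have := central_binomial_ge M0; have := big N N8 => H1 H2.
have H3 : (2 ^ (N ^ 2).-1 <= 4 ^ M)%N.
  by rewrite (_ : 4 = 2 ^ 2)%N// -expnM leq_exp2l// /M; lia.
have H4 : (4 ^ M <= (N ^ 2) ^ N.+1)%N.
  apply: (leq_trans H2); rewrite expnS; apply: leq_mul => //.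
  by apply: (leq_trans CN); rewrite leq_exp2r//; lia.
have H5 : ((N ^ 2) ^ N.+1 < (2 ^ N.-1) ^ N.+1)%N by rewrite ltn_exp2r.
have := leq_ltn_trans (leq_trans H3 H4) H5.
rewrite -expnM ltn_exp2l//; nia.
Qed.

End CentralBinomial.

Local Open Scope classical_set_scope.
Local Open Scope ring_scope.

(** * Iterated Lebesgue integrals *)

Section IterInt.
Variable R : realType.
Implicit Types (k : nat) (f g : (nat -> R) -> \bar R).

(** [iter_int] integrates functions of infinite sequences, so its integrands are measured against
    the sigma-algebra generated by the coordinates. *)
Definition cylinders : set_system (nat -> R) :=
  [set A | exists i, exists2 B : set R, measurable B & A = (fun s => s i) @^-1` B].

Definition seqspace : measurableType cylinders.-sigma :=
  g_sigma_algebraType cylinders.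

Lemma measurable_coord i : measurable_fun setT (fun s : seqspace => s i : R).
Proof.
by move=> _ B mB; rewrite setTI; apply: sub_sigma_algebra; exists i, B.
Qed.

Lemma measurable_to_seqspace d (Y : measurableType d) (h : Y -> seqspace) :
  (forall i, measurable_fun setT (fun y => h y i : R)) -> measurable_fun setT h.
Proof.
move=> mh; apply: (@measurability _ _ Y seqspace setT h cylinders) => //.
move=> _ [_ [i [B mB ->]] <-].
exact: mh.
Qed.

Lemma iter_int_ge0 k f : (forall s, (0 <= f s)%E) -> (0 <= iter_int k f)%E.
Proof.
elim: k f => [|k IH] f f0 //=.
by apply: integral_ge0 => x _; apply: IH => s; exact: f0.
Qed.

(** The parameter space is arbitrary because the induction moves the outermost integration variable
    into it: [Y] becomes [Y * R], and Tonelli integrates that variable out again. *)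
Lemma measurable_iter_int_param k : forall d (Y : measurableType d)
    (F : Y * seqspace -> \bar R),
  measurable_fun [set: (Y * seqspace)%type] F -> (forall z, (0 <= F z)%E) ->
  measurable_fun setT (fun y => iter_int k (fun s => F (y, s))).
Proof.
elim: k => [|k IH] d Y F mF F0 /=.
  by apply: (measurableT_comp mF); exact: measurable_fun_pair.
pose F' (w : (Y * R) * seqspace) :=
  F (w.1.1, (fun i => if i == k then w.1.2 else w.2 i) : seqspace).
have mF' : measurable_fun setT F'.
  apply: (measurableT_comp mF); apply: measurable_fun_pair.
    exact: (measurableT_comp measurable_fst).
  apply: measurable_to_seqspace => i; case: (i == k).
    exact: (measurableT_comp measurable_snd).
  exact: (measurableT_comp (measurable_coord i)).
have G0 (w : Y * R) : (0 <= iter_int k (fun s => F' (w, s)))%E.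
  by apply: iter_int_ge0 => s; exact: F0.
have mG := IH _ _ F' mF' (fun z => F0 _).
exact: (@measurable_fun_fubini_tonelli_F _ _ Y _ R (@lebesgue_measure R)
   (fun w : (Y * R)%type => iter_int k (fun s => F' (w, s))) mG G0).
Qed.


Definition upd (s : nat -> R) k x : seqspace := fun i => if i == k then x else s i.

Lemma measurable_upd_pair k :
  measurable_fun setT (fun w : R * seqspace => upd w.2 k w.1).
Proof.
apply: measurable_to_seqspace => i; rewrite /upd; case: (i == k).
  exact: measurable_fst.
exact: (measurableT_comp (measurable_coord i)).
Qed.

Lemma measurable_upd k x : measurable_fun setT (fun s : seqspace => upd s k x).
Proof.
apply: measurable_to_seqspace => i; rewrite /upd; case: (i == k) => //.
exact: measurable_coord.
Qed.

Lemma measurable_slice k (f : seqspace -> \bar R) x :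
  measurable_fun setT f -> measurable_fun setT (fun s : seqspace => f (upd s k x)).
Proof. by move=> mf; apply: (measurableT_comp mf); exact: measurable_upd. Qed.

Lemma measurable_iter_int_slice k (f : seqspace -> \bar R) :
  measurable_fun setT f -> (forall s, (0 <= f s)%E) ->
  measurable_fun setT (fun x : R => iter_int k (fun s => f (upd s k x))).
Proof.
move=> mf f0.
apply: (@measurable_iter_int_param k _ _
  (fun w : R * seqspace => f (upd w.2 k w.1))) => //.
by apply: (measurableT_comp mf); exact: measurable_upd_pair.
Qed.

Lemma iter_intD k (f g : seqspace -> \bar R) :
  measurable_fun setT f -> (forall s, (0 <= f s)%E) ->
  measurable_fun setT g -> (forall s, (0 <= g s)%E) ->
  iter_int k (fun s => f s + g s)%E = (iter_int k f + iter_int k g)%E.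
Proof.
elim: k f g => [|k IH] f g mf f0 mg g0 //=.
rewrite -ge0_integralD//; first last.
- exact: measurable_iter_int_slice.
- by move=> x _; apply: iter_int_ge0.
- exact: measurable_iter_int_slice.
- by move=> x _; apply: iter_int_ge0.
apply: eq_integral => x _.
by apply: (IH (fun s => f (upd s k x)) (fun s => g (upd s k x))) => //;
  exact: measurable_slice.
Qed.

Lemma iter_int0 k : iter_int k (fun=> 0%E) = 0%E :> \bar R.
Proof. by elim: k => [|k IH] //=; rewrite IH integral0. Qed.

Lemma iter_int_sum k (I : Type) (r : seq I) (f : I -> seqspace -> \bar R) :
  (forall i, measurable_fun setT (f i)) -> (forall i s, (0 <= f i s)%E) ->
  iter_int k (fun s => \sum_(i <- r) f i s)%E = (\sum_(i <- r) iter_int k (f i))%E.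
Proof.
move=> mf f0; elim: r => [|i r IH].
  by under eq_fun do rewrite big_nil; rewrite big_nil iter_int0.
under eq_fun do rewrite big_cons; rewrite big_cons.
rewrite iter_intD ?IH//.
  exact: emeasurable_sum.
by move=> s; apply: sume_ge0.
Qed.

Lemma iter_intZ k (c : R) (f : seqspace -> \bar R) :
  0 <= c -> measurable_fun setT f -> (forall s, (0 <= f s)%E) ->
  iter_int k (fun s => c%:E * f s)%E = (c%:E * iter_int k f)%E.
Proof.
move=> c0; elim: k f => [|k IH] f mf f0 //=.
rewrite -ge0_integralZl//; first last.
- by move=> x _; apply: iter_int_ge0.
- exact: measurable_iter_int_slice.
apply: eq_integral => x _.
by apply: (IH (fun s => f (upd s k x))) => //; exact: measurable_slice.
Qed.

Lemma le_iter_int k (f g : seqspace -> \bar R) :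
  measurable_fun setT f -> (forall s, (0 <= f s)%E) -> measurable_fun setT g ->
  (forall s, (f s <= g s)%E) -> (iter_int k f <= iter_int k g)%E.
Proof.
elim: k f g => [|k IH] f g mf f0 mg fg //=.
have g0 s : (0 <= g s)%E by exact: le_trans (fg s).
apply: ge0_le_integral => //.
- by move=> x _; apply: iter_int_ge0.
- exact: measurable_iter_int_slice.
- exact: measurable_iter_int_slice.
- move=> x _; apply: (IH (fun s => f (upd s k x)) (fun s => g (upd s k x))) => //;
  exact: measurable_slice.
Qed.

Lemma lebesgue_measure_shift (a : R) (A : set R) : measurable A ->
  pushforward lebesgue_measure ((fun x => x + a) : _ -> measurableTypeR R) A =
  lebesgue_measure A.
Proof.
have mphi : measurable_fun setT ((fun x => x + a) : measurableTypeR R -> measurableTypeR R).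
  exact: measurable_funD.
pose phi_mixin := isMeasurableFun.Build _ _ _ _ _ mphi.
pose phi : {mfun _ >-> _} := HB.pack ((fun x => x + a) : measurableTypeR R -> measurableTypeR R) phi_mixin.
move=> mA; apply/esym.
apply: (@lebesgue_measure_unique _ (pushforward lebesgue_measure phi)) => //= _ [[b c]] _ <-.
rewrite /pushforward/=.
have -> : (fun x => x + a) @^-1` [set` `]b, c] ] = [set` `](b - a), (c - a)]].
  by apply/seteqP; split=> x /=; rewrite !in_itv/= ltrBlDr lerBrDr.
rewrite !lebesgue_measure_itv/= !lte_fin ltrD2r; case: ifP => // _.
by congr EFin; ring.
Qed.

Lemma ge0_integral_shift (a : R) (f : R -> \bar R) : measurable_fun setT f ->
  (forall x, (0 <= f x)%E) ->
  (\int[lebesgue_measure]_x f (x + a)%R = \int[lebesgue_measure]_x f x)%E.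
Proof.
move=> mf f0.
have mphi : measurable_fun setT ((fun x => x + a) : measurableTypeR R -> measurableTypeR R).
  exact: measurable_funD.
rewrite -[LHS](@ge0_integral_pushforward _ _ _ _ _ _ mphi _ setT f)//.
by apply: eq_measure_integral => A mA _; exact: lebesgue_measure_shift.
Qed.

(** Dependence on the first [k] coordinates only matters at depth 0, where the unintegrated
    coordinates are 0 on one side and [a i] on the other. *)
Lemma iter_int_shift k (a : nat -> R) (f : seqspace -> \bar R) :
  measurable_fun setT f -> (forall s, (0 <= f s)%E) ->
  (forall s t : nat -> R, (forall i, (i < k)%N -> s i = t i) -> f s = f t) ->
  iter_int k (fun s => f (fun i => s i + a i)) = iter_int k f.
Proof.
elim: k f => [|k IH] f mf f0 fk /=; first exact: fk.
rewrite -(ge0_integral_shift (a k) (f := fun x => iter_int k (fun s => f (upd s k x))))//; first last.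
- by move=> x; apply: iter_int_ge0.
- exact: measurable_iter_int_slice.
apply: eq_integral => x _.
rewrite -(IH (fun s => f (upd s k (x + a k))))//.
- congr iter_int; apply/funext => s; congr f; apply/funext => i.
  by rewrite /upd; case: eqP => [->|].
- exact: measurable_slice.
- move=> s t st; apply: fk => i; rewrite ltnS leq_eqVlt /upd.
  by case: eqP => //= _; exact: st.
Qed.

Lemma measurable_lincomb k (a : nat -> R) :
  measurable_fun setT (fun s : seqspace => \sum_(i < k) a i * s i : R).
Proof.
apply: measurable_sum => i; apply: measurable_funM => //.
exact: measurable_coord.
Qed.

(* The value [+oo] lets this null function dominate whatever happens on the
   overlaps of translated Voronoi cells. *)
Definition hyperplane_infty k (a : nat -> R) (b : R) (s : seqspace) : \bar R :=
  if \sum_(i < k) a i * s i == b then +oo%E else 0%E.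

Lemma hyperplane_infty_ge0 k a b s : (0 <= hyperplane_infty k a b s)%E.
Proof. by rewrite /hyperplane_infty; case: ifP. Qed.

Lemma measurable_hyperplane_infty k a b :
  measurable_fun setT (hyperplane_infty k a b).
Proof.
apply: measurable_fun_ifT => //; apply: measurable_fun_eqr => //.
exact: measurable_lincomb.
Qed.

(** Slice along the last coordinate. If another coefficient is nonzero, every slice is null by
    induction; otherwise only the slice at [b / a k] can be nonzero, and a single point is
    negligible even with value [+oo]. *)
Lemma iter_int_hyperplane k (a : nat -> R) (b : R) :
  (exists2 i, (i < k)%N & a i != 0) -> iter_int k (hyperplane_infty k a b) = 0%E.
Proof.
elim: k b => [|k IH] b [i ik ai0] //=.
have sl x : (fun s => hyperplane_infty k.+1 a b (upd s k x)) =
            hyperplane_infty k a (b - a k * x).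
  apply/funext => s; rewrite /hyperplane_infty big_ord_recr /= {2}/upd eqxx.
  under eq_bigr => j _ do rewrite /upd (ltn_eqF (ltn_ord j)).
  by rewrite [in RHS]eq_sym subr_eq eq_sym.
have [[j jk aj0]|nex] := pselect (exists2 j, (j < k)%N & a j != 0).
  rewrite integral0_eq// => x _.
  by rewrite [X in iter_int k X](sl x) IH//; exists j.
have ak0 : a k != 0.
  move: ik; rewrite ltnS leq_eqVlt => /orP[/eqP <-//|ik].
  by exfalso; apply: nex; exists i.
rewrite -(@integral_setD1 _ _ (b / a k)); last 2 first.
- by apply: measurableD.
- apply: measurable_funTS.
  exact: measurable_iter_int_slice (measurable_hyperplane_infty _ _ _) (hyperplane_infty_ge0 _ _ _).
rewrite integral0_eq// => x [_ /eqP xb].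
rewrite [X in iter_int k X](sl x) -[RHS](iter_int0 k); congr iter_int.
apply/funext => s; rewrite /hyperplane_infty big1 => [|j _]; last first.
  have -> : a j = 0 by apply/eqP/negP => /negP aj; apply: nex; exists j.
  by rewrite mul0r.
rewrite ifF//; apply/negbTE; apply: contra xb; rewrite eq_sym subr_eq0 => /eqP ->.
by rewrite mulrAC divff// mul1r.
Qed.

Lemma iter_int_prod k (g : nat -> R -> R) (c : nat -> R) :
  (forall i, measurable_fun setT (g i)) -> (forall i x, 0 <= g i x) ->
  (forall i, (\int[lebesgue_measure]_x (g i x)%:E)%E = (c i)%:E) ->
  iter_int k (fun s => (\prod_(i < k) g i (s i))%:E) = (\prod_(i < k) c i)%:E.
Proof.
move=> mg g0 gc; elim: k => [|k IH] /=; first by rewrite !big_ord0.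
have mprod : measurable_fun setT (fun s : seqspace => \prod_(i < k) g i (s i)).
  apply: measurable_prod => i _.
  exact: (measurableT_comp (mg i) (measurable_coord i)).
have c0 i : 0 <= c i.
  by rewrite -lee_fin -gc; apply: integral_ge0 => x _; rewrite lee_fin.
transitivity (\int[lebesgue_measure]_x ((\prod_(i < k) c i)%:E * (g k x)%:E))%E.
  apply: eq_integral => x _; rewrite muleC -IH -iter_intZ//; first last.
  - by move=> s; rewrite lee_fin prodr_ge0.
  - exact/measurable_EFinP.
  congr iter_int; apply/funext => s; rewrite big_ord_recr /= eqxx.
  under eq_bigr => j _ do rewrite (ltn_eqF (ltn_ord j)).
  by rewrite mulrC EFinM.
rewrite ge0_integralZl//.
- by rewrite gc big_ord_recr.
- by apply/measurable_EFinP; exact: mg.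
- by move=> x _; rewrite lee_fin.
- by rewrite lee_fin prodr_ge0.
Qed.

End IterInt.

(** * Voronoi cells of lattices given by syndromes *)

Section SquaredNorm.
Variables (R : realType) (n : nat).
Implicit Types y z : 'rV[R]_n.

Lemma sqnorm_ge0 y : 0 <= sqnorm y.
Proof. by apply: sumr_ge0 => i _; exact: sqr_ge0. Qed.

Lemma sqnormB y z :
  sqnorm (y - z) = sqnorm y - 2 * (\sum_i y 0 i * z 0 i) + sqnorm z.
Proof.
rewrite /sqnorm mulr_sumr -sumrB -big_split /=; apply: eq_bigr => i _.
by rewrite !mxE; ring.
Qed.

Lemma ler_sqnorm y z :
  (forall i, `|y 0 i| <= `|z 0 i|) -> sqnorm y <= sqnorm z.
Proof.
move=> yz; apply: ler_sum => i _; rewrite -[leLHS]real_normK ?num_real//.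
by rewrite -[leRHS]real_normK ?num_real// lerXn2r ?nnegrE.
Qed.

Definition row_of_seq (s : nat -> R) : 'rV[R]_n := \row_i s i.

Definition seq_of_row y : nat -> R :=
  fun j => if insub j is Some i then y 0 i else 0.

Lemma row_of_seqD s y :
  row_of_seq (fun i => s i + seq_of_row y i) = row_of_seq s + y.
Proof. by apply/rowP => i; rewrite !mxE /seq_of_row valK. Qed.

Lemma row_of_seq_eq s t : (forall i, (i < n)%N -> s i = t i) ->
  row_of_seq s = row_of_seq t.
Proof. by move=> st; apply/rowP => i; rewrite !mxE st. Qed.

Lemma measurable_sqnorm_row y :
  measurable_fun setT (fun s : seqspace R => sqnorm (row_of_seq s - y) : R).
Proof.
rewrite /sqnorm; apply: measurable_sum => i; apply: measurable_funX.
under eq_fun do rewrite !mxE.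
by apply: measurable_funB => //; exact: measurable_coord.
Qed.

End SquaredNorm.

Section IntRn.
Variables (R : realType) (n : nat).
Implicit Types (g h : 'rV[R]_n -> \bar R) (a y : 'rV[R]_n).

Definition row_measurable d (T : measurableType d) (g : 'rV[R]_n -> T) :=
  measurable_fun setT (fun s : seqspace R => g (row_of_seq n s)).

Lemma row_measurable_coord i : row_measurable (fun y => y 0 i : R).
Proof. by rewrite /row_measurable; under eq_fun do rewrite mxE; exact: measurable_coord. Qed.

Lemma row_measurable_add a d (T : measurableType d) (g : 'rV[R]_n -> T) :
  row_measurable g -> row_measurable (fun y => g (y + a)).
Proof.
move=> mg; rewrite /row_measurable.
under eq_fun do rewrite -row_of_seqD.
apply: (measurableT_comp (f := fun s : seqspace R => g (row_of_seq n s)) mg).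
by apply: measurable_to_seqspace => i; apply: measurable_funD => //; exact: measurable_coord.
Qed.

Lemma int_Rn_sum (I : finType) (g : I -> 'rV[R]_n -> \bar R) :
  (forall i, row_measurable (g i)) -> (forall i y, (0 <= g i y)%E) ->
  int_Rn (fun y => \sum_i g i y)%E = (\sum_i int_Rn (g i))%E.
Proof.
move=> mg g0.
by rewrite /int_Rn; exact: (iter_int_sum n _ (f := fun i s => g i (row_of_seq n s))).
Qed.

Lemma int_RnD g h :
  row_measurable g -> (forall y, (0 <= g y)%E) ->
  row_measurable h -> (forall y, (0 <= h y)%E) ->
  int_Rn (fun y => g y + h y)%E = (int_Rn g + int_Rn h)%E.
Proof.
move=> mg g0 mh h0.
exact: (iter_intD n (f := fun s => g (row_of_seq n s)) (g := fun s => h (row_of_seq n s))).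
Qed.

Lemma int_RnZ (c : R) g : 0 <= c ->
  row_measurable g -> (forall y, (0 <= g y)%E) ->
  int_Rn (fun y => c%:E * g y)%E = (c%:E * int_Rn g)%E.
Proof.
move=> c0 mg g0.
exact: (iter_intZ n c0 (f := fun s => g (row_of_seq n s))).
Qed.

Lemma int_Rn_ge0 g : (forall y, (0 <= g y)%E) -> (0 <= int_Rn g)%E.
Proof. by move=> g0; apply: iter_int_ge0. Qed.

Lemma le_int_Rn g h :
  row_measurable g -> (forall y, (0 <= g y)%E) -> row_measurable h ->
  (forall y, (g y <= h y)%E) -> (int_Rn g <= int_Rn h)%E.
Proof.
move=> mg g0 mh gh.
exact: (le_iter_int n (f := fun s => g (row_of_seq n s)) (g := fun s => h (row_of_seq n s))).
Qed.

Lemma int_Rn_shift a g :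
  row_measurable g -> (forall y, (0 <= g y)%E) ->
  int_Rn (fun y => g (y + a)) = int_Rn g.
Proof.
move=> mg g0.
rewrite /int_Rn -[RHS](iter_int_shift (seq_of_row a) mg)//.
  by congr iter_int; apply/funext => s; rewrite row_of_seqD.
by move=> s t st; rewrite (row_of_seq_eq st).
Qed.

(** Half-open, so that the integer translates partition the space exactly. *)
Definition in_unit_cube y := [forall i, 0 <= y 0 i < 1].

Lemma in_unit_cubeE y :
  (in_unit_cube y)%:R = \prod_(i < n) \1_(`[0, 1[%classic : set R) (y 0 i) :> R.
Proof.
have [/forallP H|/forallPn[i Hi]] := boolP (in_unit_cube y).
  by rewrite big1// => i _; rewrite indicE mem_set//= in_itv/= H.
by rewrite (bigD1 i)//= indicE memNset ?mul0r//= in_itv/=; apply/negP.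
Qed.

Lemma row_measurable_cube : row_measurable (fun y => (in_unit_cube y)%:R : R).
Proof.
rewrite /row_measurable; under eq_fun do rewrite in_unit_cubeE.
apply: measurable_prod => i _.
apply: (measurableT_comp (f := (\1_(`[0, 1[%classic : set R) : R -> R))).
  exact: measurable_indic.
exact: row_measurable_coord.
Qed.

Lemma int_Rn_cube : int_Rn (fun y => ((in_unit_cube y)%:R)%:E) = 1%E.
Proof.
rewrite /int_Rn.
have -> : (fun s : nat -> R => ((in_unit_cube (\row_(i < n) s i))%:R : R)%:E) =
  (fun s : nat -> R => (\prod_(i < n) \1_(`[0, 1[%classic : set R) (s i) : R)%:E).
  by apply/funext => s; rewrite in_unit_cubeE; under eq_bigr do rewrite mxE.
rewrite (@iter_int_prod _ _ (fun=> \1_(`[0, 1[%classic : set R)) (fun=> 1))//.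
  by rewrite big1.
move=> i; rewrite integral_indic//= setIT.
by rewrite lebesgue_measure_itv/= lte01 oppr0 adde0.
Qed.

Definition row_hyperplane_infty a (b : R) y : \bar R :=
  if \sum_i a 0 i * y 0 i == b then +oo%E else 0%E.

Lemma row_hyperplane_infty_ge0 a b y : (0 <= row_hyperplane_infty a b y)%E.
Proof. by rewrite /row_hyperplane_infty; case: ifP. Qed.

Lemma row_hyperplane_inftyE a b s :
  row_hyperplane_infty a b (row_of_seq n s) = hyperplane_infty n (seq_of_row a) b s.
Proof.
rewrite /row_hyperplane_infty /hyperplane_infty.
congr (if _ == b then _ else _).
by apply: eq_bigr => i _; rewrite mxE /seq_of_row valK.
Qed.

Lemma row_measurable_hyperplane a b : row_measurable (row_hyperplane_infty a b).
Proof.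
rewrite /row_measurable; under eq_fun do rewrite row_hyperplane_inftyE.
exact: measurable_hyperplane_infty.
Qed.

Lemma int_Rn_hyperplane a b : a != 0 -> int_Rn (row_hyperplane_infty a b) = 0%E.
Proof.
move=> a0.
have -> : int_Rn (row_hyperplane_infty a b) =
    iter_int n (hyperplane_infty n (seq_of_row a) b).
  by congr iter_int; apply/funext => s; exact: row_hyperplane_inftyE.
apply: iter_int_hyperplane.
have [i ai0] : exists i, a 0 i != 0.
  by apply/existsP; apply: contraR a0 => /existsPn H; apply/eqP/rowP => i;
    rewrite mxE; apply/eqP; move: (H i); rewrite negbK.
by exists i => //; rewrite /seq_of_row valK.
Qed.

End IntRn.

Section VoronoiTiling.
Variables (R : realType) (n p : nat) (G : finType).
Variables (syn : 'rV[int]_n -> G) (lat : 'rV[int]_n -> Prop).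
Hypothesis p1 : (1 < p)%N.
Hypothesis syn_lat : forall x y, syn x = syn y <-> lat (x - y).
Hypothesis lat_period : forall x, lat (x *+ p).

Let toR (x : 'rV[int]_n) : 'rV[R]_n := map_mx intr x.
Let L : set 'rV[R]_n := [set y | exists x, lat x /\ y = toR x].
Let V := voronoi L.

Let toRB x y : toR (x - y) = toR x - toR y.
Proof. by rewrite /toR map_mxB. Qed.

Let p0 : (0 : R) < p%:R. Proof. by rewrite ltr0n ltnW. Qed.

(** The lattice contains p times each unit vector; compare [y] with its translates by plus and minus
    that vector. *)
Lemma voronoi_coord_bound y i : V y -> `|y 0 i| <= p%:R / 2.
Proof.
move=> Vy.
have H (c : int) : 2 * (c%:~R * p%:R) * y 0 i <= (c%:~R * p%:R) ^+ 2.
  pose x : 'rV[int]_n := (c *: delta_mx 0 i) *+ p.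
  have xE j : toR x 0 j = c%:~R * p%:R * (j == i)%:R.
    have -> : toR x 0 j = (x 0 j)%:~R by rewrite mxE.
    have -> : x 0 j = c * (j == i)%:R * p%:Z.
      by rewrite /x mulmxnE !mxE eqxx -[_ *+ p]mulr_natr (natz p).
    by rewrite !rmorphM/= rmorph_nat -pmulrn mulrAC.
  have := Vy (toR x) (ex_intro _ x (conj (lat_period _) erefl)).
  rewrite sqnormB (bigD1 i)//= big1 => [|j ji]; last first.
    by rewrite xE (negbTE ji) mulr0 mulr0.
  rewrite {3}/sqnorm (bigD1 i)//= big1 => [|j ji]; last first.
    by rewrite xE (negbTE ji) mulr0 expr0n.
  by rewrite !addr0 xE eqxx mulr1; lra.
have := H 1; have := H (-1); rewrite rmorphN/= rmorph1 => H1 H2.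
rewrite ler_norml; apply/andP; split; rewrite -(ler_pM2r p0).
  by move: H1; nra.
by move: H2; nra.
Qed.

(** Subtracting multiples of p coordinatewise stays in the coset, and bringing a coordinate into
    [-p/2, p/2] never increases its absolute value. *)
Lemma coset_reduce (u : 'rV[R]_n) (v : 'rV[int]_n) : exists v',
  [/\ syn v = syn v', forall i, `|u 0 i + (v' 0 i)%:~R| <= p%:R / 2
    & sqnorm (u + toR v') <= sqnorm (u + toR v)].
Proof.
have H i : exists k : int,
    `|u 0 i + (v 0 i - k * p%:Z)%:~R| <= p%:R / 2 /\
    `|u 0 i + (v 0 i - k * p%:Z)%:~R| <= `|u 0 i + (v 0 i)%:~R|.
  set r := u 0 i + _.
  have [rp|rp] := leP `|r| (p%:R / 2); first by exists 0; rewrite mul0r subr0.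
  pose k := Num.floor (r / p%:R + 2^-1); exists k.
  have E : u 0 i + (v 0 i - k * p%:Z)%:~R = r - k%:~R * p%:R.
    by rewrite rmorphB/= rmorphM/= /r -pmulrn; ring.
  rewrite E; suff S : `|r - k%:~R * p%:R| <= p%:R / 2.
    by split=> //; rewrite (le_trans S)// ltW.
  have /andP[k1 k2] := floor_itv (r / p%:R + 2^-1).
  have pE : (r / p%:R + 2^-1) * p%:R = r + p%:R / 2.
    by rewrite mulrDl divfK ?gt_eqF// mulrC.
  have k3 : k%:~R * p%:R <= r + p%:R / 2 by rewrite -pE ler_pM2r.
  have k4 : r + p%:R / 2 < (k%:~R + 1) * p%:R.
    by rewrite -pE ltr_pM2r// (lt_le_trans k2)// rmorphD.
  by rewrite ler_norml; apply/andP; split; lra.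
have [k Hk] := choice H.
have vE i : (v - (\row_i k i) *+ p) 0 i = v 0 i - k i * p%:Z.
  by rewrite !mxE mulmxnE mxE -mulr_natr (natz p).
exists (v - (\row_i k i) *+ p); split.
- by apply/syn_lat; rewrite opprB addrC subrK; exact: lat_period.
- by move=> i; rewrite vE; have [] := Hk i.
- apply: ler_sqnorm => i; have [] := Hk i.
  have uE w : (u + toR w) 0 i = u 0 i + (w 0 i)%:~R by rewrite !mxE.
  by rewrite !uE vE.
Qed.

(** A finite box holding every integer vector v for which u + v, with u in the unit cube, has all
    coordinates at most p/2 in absolute value. It turns minima over cosets and sums over translates
    into finite ones. *)
Definition box_vec (b : {ffun 'I_n -> 'I_(2 * p).+1}) : 'rV[int]_n :=
  \row_i ((b i : nat)%:Z - p%:Z).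

Lemma box_vec_inj : injective box_vec.
Proof.
move=> b c /rowP bc; apply/ffunP => i; apply: val_inj => /=.
by have := bc i; rewrite !mxE => /addIr/eqP; rewrite eqz_nat => /eqP.
Qed.

Lemma box_vecP (v : 'rV[int]_n) :
  (forall i, - p%:Z <= v 0 i <= p%:Z) -> exists b, box_vec b = v.
Proof.
move=> vp; exists [ffun i : 'I_n => inord (absz (v 0 i + p%:Z))].
apply/rowP => i; rewrite !mxE ffunE; have /andP[v1 v2] := vp i.
have vp0 : 0 <= v 0 i + p%:Z by rewrite -lerBlDr sub0r.
rewrite inordK; first by rewrite gez0_abs// addrK.
rewrite ltnS -lez_nat gez0_abs// mulSn mul1n PoszD lerD2r//.
Qed.

Lemma box_of_bounded (u : 'rV[R]_n) (v : 'rV[int]_n) :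
  (forall i, 0 <= u 0 i < 1) -> (forall i, `|u 0 i + (v 0 i)%:~R| <= p%:R / 2) ->
  exists b, box_vec b = v.
Proof.
move=> u01 uv; apply: box_vecP => i; have /andP[u0 u1] := u01 i.
have := uv i; rewrite ler_norml => /andP[h1 h2].
have p2 : (2 : R) <= p%:R by rewrite ler_nat.
have E : (p%:Z)%:~R = p%:R :> R by [].
apply/andP; split; rewrite -(ler_int R) ?rmorphN/= E; lra.
Qed.

(** The shortest vector of the translated coset lies in the cell. It exists because [coset_reduce]
    brings every competitor into the finite box without lengthening it. *)
Lemma coset_meets_voronoi (u : 'rV[R]_n) (w : 'rV[int]_n) :
  (forall i, 0 <= u 0 i < 1) ->
  exists2 b, syn (box_vec b) = syn w & V (u + toR (box_vec b)).
Proof.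
move=> u01.
have [v0 [s0 /(box_of_bounded u01)[b0 b0E] _]] := coset_reduce u w.
have b0P : syn (box_vec b0) == syn w by rewrite b0E s0.
have := @Order.TotalTheory.arg_minP _ _ _ b0 (fun b => syn (box_vec b) == syn w)
  (fun b => sqnorm (u + toR (box_vec b))) b0P.
case=> b /eqP bw bmin; exists b => // z [x [lx ->]].
have [v [sv /(box_of_bounded u01)[c cE] vle]] := coset_reduce u (box_vec b - x).
rewrite -addrA -toRB (le_trans _ vle)// -cE; apply: bmin.
rewrite cE -sv -bw eq_sym; apply/eqP/syn_lat.
by rewrite opprB addrC subrK.
Qed.

Lemma voronoi_min (u : 'rV[R]_n) v w : syn v = syn w -> V (u + toR v) ->
  sqnorm (u + toR v) <= sqnorm (u + toR w).
Proof.
move=> /syn_lat lvw Vv; have := Vv (toR (v - w)) (ex_intro _ _ (conj lvw erefl)).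
by rewrite toRB -addrA opprB [toR v + _]addrC subrK.
Qed.

(** The cell is an intersection of half-spaces indexed by integer vectors, hence countable; codes
    that name no lattice vector contribute the whole space. *)
Lemma row_measurable_voronoi : row_measurable (fun y => \1_V y : R).
Proof.
pose F k : set (seqspace R) := if unpickle k is Some z then
  (if `[<lat z>] then [set s | sqnorm (row_of_seq n s) <=
     sqnorm (row_of_seq n s - toR z)] else setT) else setT.
rewrite /row_measurable.
have -> : (fun s : seqspace R => \1_V (row_of_seq n s) : R) = \1_(\bigcap_k F k).
  apply/funext => s; rewrite !indicE; congr ((_ : bool)%:R).
  apply/idP/idP => /set_mem H; apply/mem_set.
    move=> k _; rewrite /F; case: unpickle => // z; case: asboolP => // lz.
    by apply: H; exists z.
  move=> _ [z [lz ->]]; have := H (pickle z) I.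
  by rewrite /F pickleK; case: asboolP.
apply: measurable_indic; apply: bigcapT_measurable => k; rewrite /F.
case: unpickle => // z; case: asboolP => // _.
pose g (s : seqspace R) := sqnorm (row_of_seq n s) <= sqnorm (row_of_seq n s - toR z).
have mg : measurable_fun setT g.
  apply: measurable_fun_ler; last exact: measurable_sqnorm_row.
  by under eq_fun do rewrite -[row_of_seq n _]subr0; exact: measurable_sqnorm_row.
by have := mg measurableT [set true] I; rewrite setTI.
Qed.

Section Integrals.
Variable Q : 'rV[R]_n -> R.
Hypothesis Q0 : forall y, 0 <= Q y.
Hypothesis mQ : row_measurable Q.

Let T b : 'rV[R]_n := toR (box_vec b).

Let VQ y : R := \1_V y * Q y.

Let VQ0 y : 0 <= VQ y.
Proof. by rewrite mulr_ge0. Qed.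

Let mVQ : row_measurable VQ.
Proof. by apply: measurable_funM => //; exact: row_measurable_voronoi. Qed.

(** A point of the cell lies in exactly one integer translate of the half-open cube, the one at its
    floor vector, which the coordinate bound places in the box. *)
Lemma voronoi_unfold y :
  (VQ y)%:E = (\sum_b ((in_unit_cube (y - T b))%:R * VQ y)%:E)%E.
Proof.
rewrite sumEFin; congr EFin; rewrite -mulr_suml.
have [Vy|Vy] := pselect (V y); last first.
  by rewrite /VQ indicE memNset// mul0r mulr0.
suff -> : \sum_b (in_unit_cube (y - T b))%:R = 1 :> R by rewrite mul1r.
have [b bE] : exists b, box_vec b = \row_i Num.floor (y 0 i).
  apply: box_vecP => i; rewrite mxE.
  have := voronoi_coord_bound i Vy; rewrite ler_norml => /andP[h1 h2].
  have /andP[f1 f2] := floor_itv (y 0 i).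
  have p2 : (2 : R) <= p%:R by rewrite ler_nat.
  have E : (p%:Z)%:~R = p%:R :> R by [].
  rewrite rmorphD/= in f2.
  by apply/andP; split; rewrite -(ler_int R) ?rmorphN/= E; lra.
have TE c i : (y - T c) 0 i = y 0 i - (box_vec c 0 i)%:~R.
  by rewrite /T /toR !mxE.
rewrite (bigD1 b)//= big1 => [|c cb].
  rewrite (_ : in_unit_cube _) ?addr0//; apply/forallP => i.
  have /andP[f1 f2] := floor_itv (y 0 i); rewrite rmorphD/= in f2.
  by rewrite TE bE mxE; lra.
rewrite (_ : in_unit_cube _ = false)//; apply/negbTE; apply: contra cb.
move=> /forallP H; apply/eqP/box_vec_inj; rewrite bE; apply/rowP => i.
rewrite [RHS]mxE; apply/esym/floor_def; have := H i; rewrite TE rmorphD/=.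
by rewrite subr_ge0 ltrBlDr addrC.
Qed.

Lemma int_Rn_voronoi_unfold :
  int_Rn (fun y => (VQ y)%:E) =
  (\sum_b int_Rn (fun y => ((in_unit_cube y)%:R * VQ (y + T b))%:E))%E.
Proof.
have mG b : row_measurable (fun y => ((in_unit_cube (y - T b))%:R * VQ y)%:E).
  apply/measurable_EFinP; apply: measurable_funM; last exact: mVQ.
  exact: (row_measurable_add (g := fun y => (in_unit_cube y)%:R : R) (- T b)
    (row_measurable_cube n)).
under [in LHS]eq_fun do rewrite voronoi_unfold.
rewrite int_Rn_sum; last 2 first.
- exact: mG.
- by move=> b y; rewrite lee_fin mulr_ge0.
apply: eq_bigr => b _; rewrite -[LHS](int_Rn_shift (T b)); first last.
- by move=> y; rewrite lee_fin mulr_ge0.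
- exact: mG.
by congr int_Rn; apply/funext => y; rewrite addrK.
Qed.

Let mterm b :
  row_measurable (fun y => ((in_unit_cube y)%:R * VQ (y + T b))%:E).
Proof.
apply/measurable_EFinP; apply: measurable_funM; first exact: row_measurable_cube.
exact: (row_measurable_add (g := VQ) (T b) mVQ).
Qed.

(** For a fixed offset, two points of the cell with the same syndrome have the same, minimal, norm,
    so the offset lies on a bisecting hyperplane. Outside these finitely many hyperplanes each
    syndrome is counted at most once. *)
Lemma int_Rn_voronoi_le (c : G -> R) : (forall g, 0 <= c g) ->
  (forall u v, in_unit_cube u -> V (u + toR v) -> Q (u + toR v) <= c (syn v)) ->
  (int_Rn (fun y => (VQ y)%:E) <= (\sum_g c g)%:E)%E.
Proof.
move=> c0 Qc; rewrite int_Rn_voronoi_unfold -int_Rn_sum//; last first.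
  by move=> b y; rewrite lee_fin mulr_ge0.
(* This is |y + T b1|^2 = |y + T b2|^2 after cancelling |y|^2: a linear equation whose normal vector
   is nonzero because [T] is injective. *)
pose hyp (bb : _ * _) y : \bar R := if bb.1 != bb.2 then
  row_hyperplane_infty (T bb.1 - T bb.2)
    ((sqnorm (T bb.2) - sqnorm (T bb.1)) / 2) y else 0%E.
have hyp0 bb y : (0 <= hyp bb y)%E.
  by rewrite /hyp; case: ifP => // _; exact: row_hyperplane_infty_ge0.
have mhyp bb : row_measurable (hyp bb).
  rewrite /hyp; case: (bb.1 != bb.2) => /=; first exact: row_measurable_hyperplane.
  exact: measurable_cst.
have Tinj : injective T.
  move=> b b' /rowP bb; apply: box_vec_inj; apply/rowP => i.
  by have := bb i; rewrite !mxE => /intr_inj.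
have sqD y b : sqnorm (y + T b) = sqnorm y + 2 * (\sum_i T b 0 i * y 0 i) + sqnorm (T b).
  rewrite -[T b in LHS]opprK sqnormB; congr (_ + _); last first.
    by apply: eq_bigr => i _; rewrite mxE sqrrN.
  rewrite -mulrN -sumrN; congr (_ + 2 * _); apply: eq_bigr => i _.
  by rewrite mxE mulrN opprK mulrC.
have key y : (\sum_b ((in_unit_cube y)%:R * VQ (y + T b))%:E <=
    (\sum_g c g)%:E * ((in_unit_cube y)%:R)%:E + \sum_bb hyp bb y)%E.
  have [yc|yc] := boolP (in_unit_cube y); last first.
    rewrite mule0 add0e big1 ?sume_ge0// => [b _]; by rewrite mul0r.
  rewrite mule1; have [[bb hbb]|nh] := pselect (exists bb, hyp bb y = +oo%E).
    rewrite [X in (_ + X)%E](bigD1 bb)//= hbb addye ?addey ?leey//.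
    by rewrite gt_eqF// (lt_le_trans (ltNyr 0))// sume_ge0.
  apply: (@le_trans _ _ (\sum_g c g)%:E); last by rewrite leeDl// sume_ge0.
  rewrite sumEFin lee_fin; under eq_bigr do rewrite mul1r.
  rewrite (partition_big (fun b => syn (box_vec b)) xpredT)//=.
  apply: ler_sum => g _.
  have [[b /andP[/eqP bg Vb]]|nb] :=
      pselect (exists b, (syn (box_vec b) == g) && `[< V (y + T b) >]).
    move/asboolP in Vb.
    rewrite (bigD1 b) ?bg//= big1 => [|b' /andP[/eqP b'g b'b]].
      rewrite addr0 /VQ indicE mem_set// mul1r -bg; exact: Qc.
    rewrite /VQ indicE memNset ?mul0r// => Vb'; apply: nh; exists (b', b).
    rewrite /hyp/= b'b /row_hyperplane_infty ifT//.
    have sE : sqnorm (y + T b') = sqnorm (y + T b).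
      by apply/eqP; rewrite eq_le !voronoi_min// bg b'g.
    have -> : \sum_i (T b' - T b) 0 i * y 0 i =
        \sum_i T b' 0 i * y 0 i - \sum_i T b 0 i * y 0 i.
      by rewrite -sumrB; apply: eq_bigr => i _; rewrite !mxE mulrBl.
    by move: sE; rewrite !sqD => sE; apply/eqP; lra.
  rewrite big1// => b /eqP bg; rewrite /VQ indicE memNset ?mul0r// => Vb.
  by apply: nb; exists b; rewrite bg eqxx; apply/asboolP.
have mcube : row_measurable (fun y : 'rV[R]_n => ((in_unit_cube y)%:R)%:E : \bar R).
  by apply/measurable_EFinP; exact: row_measurable_cube.
have csum0 : 0 <= \sum_g c g by exact: sumr_ge0.
have mcc : row_measurable (fun y : 'rV[R]_n => (\sum_g c g)%:E * ((in_unit_cube y)%:R)%:E)%E.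
  by apply: emeasurable_funM => //; exact: measurable_cst.
have mhs : row_measurable (fun y => \sum_bb hyp bb y)%E.
  by apply: emeasurable_sum => bb; exact: mhyp.
apply: (le_trans (le_int_Rn _ _ _ key)).
- by apply: emeasurable_sum => b; exact: mterm.
- by move=> y; apply: sume_ge0 => b _; rewrite lee_fin mulr_ge0.
- exact: emeasurable_funD.
rewrite int_RnD//; first last.
- by move=> y; apply: sume_ge0.
- by move=> y; apply: mule_ge0; rewrite lee_fin.
rewrite int_RnZ//.
rewrite int_Rn_cube mule1 int_Rn_sum// [X in (_ + X)%E]big1 ?adde0// => bb _.
rewrite /hyp; have [bb12|bb12] := eqVneq bb.1 bb.2; first exact: iter_int0.
by apply: int_Rn_hyperplane; rewrite subr_eq0; apply: contra bb12 => /eqP/Tinj ->.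
Qed.

End Integrals.

(** Every attained syndrome puts at least one point of the cell above each offset, so the fibre
    count is at least #|S| everywhere on a cube of volume 1. *)
Lemma leb_Rn_voronoi_ge (S : {set G}) :
  (forall g, g \in S -> exists w, syn w = g) ->
  ((#|S|%:R)%:E <= leb_Rn V)%E.
Proof.
move=> Sw; have m1 : row_measurable (fun _ : 'rV[R]_n => 1 : R) by exact: measurable_cst.
have -> : leb_Rn V = int_Rn (fun y => (\1_V y * 1)%:E).
  by congr int_Rn; apply/funext => y; rewrite mulr1.
rewrite int_Rn_voronoi_unfold// -int_Rn_sum; first last.
- by move=> b y; rewrite lee_fin !mulr_ge0.
- move=> b; apply/measurable_EFinP; apply: measurable_funM.
    exact: row_measurable_cube.
  apply: measurable_funM => //.
  exact: (row_measurable_add (g := fun y => \1_V y : R) (toR (box_vec b)) row_measurable_voronoi).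
have mcube : row_measurable (fun y : 'rV[R]_n => ((in_unit_cube y)%:R)%:E : \bar R).
  by apply/measurable_EFinP; exact: row_measurable_cube.
rewrite -[leLHS]mule1 -(int_Rn_cube R n) -int_RnZ//.
apply: le_int_Rn.
- by apply: emeasurable_funM => //; exact: measurable_cst.
- by move=> y; rewrite mule_ge0// lee_fin.
- apply: emeasurable_sum => b; apply/measurable_EFinP; apply: measurable_funM.
    exact: row_measurable_cube.
  apply: measurable_funM => //.
  exact: (row_measurable_add (g := fun y => \1_V y : R) (toR (box_vec b)) row_measurable_voronoi).
move=> y; have [/forallP yc|yc] := boolP (in_unit_cube y); last first.
  by rewrite mule0 sume_ge0// => b _; rewrite mul0r.
rewrite mule1 sumEFin lee_fin (partition_big (fun b => syn (box_vec b)) xpredT)//=.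
rewrite -sum1_card natr_sum [leRHS](bigID [pred g | g \in S])/=.
rewrite -[leLHS]addr0 lerD//; last first.
  by apply: sumr_ge0 => g _; apply: sumr_ge0 => b _; rewrite !mulr_ge0.
apply: ler_sum => g gS; have [w wg] := Sw g gS.
have [b bw Vb] := coset_meets_voronoi w yc.
rewrite (bigD1 b) ?bw ?wg//= indicE mem_set// !mulr1 lerDl.
by apply: sumr_ge0 => b' _; rewrite !mulr_ge0.
Qed.


End VoronoiTiling.

(** * Gaussian integrals and the lower bound on the second moment *)

Section Gaussian.
Variable R : realType.

Lemma integral_gaussian (a : R) : 0 < a ->
  (\int[lebesgue_measure]_x (expR (- (a * x ^+ 2)))%:E)%E = (Num.sqrt (pi / a))%:E.
Proof.
move=> a0; pose s : R := Num.sqrt (2 * a)^-1.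
have a20 : 0 < (2 * a)^-1 by rewrite invr_gt0 mulr_gt0.
have s0 : 0 < s by rewrite sqrtr_gt0.
have s2 : s ^+ 2 = (2 * a)^-1 by rewrite sqr_sqrtr// ltW.
have r0 : 0 < Num.sqrt (pi / a) by rewrite sqrtr_gt0 divr_gt0// pi_gt0.
have E x : expR (- (a * x ^+ 2)) = Num.sqrt (pi / a) * normal_pdf 0 s x.
  rewrite normal_pdfE ?gt_eqF// /normal_peak /normal_fun subr0 s2.
  have -> : (2 * a)^-1 * pi *+ 2 = pi / a by rewrite -mulr_natr; field; rewrite gt_eqF.
  rewrite mulVKf ?gt_eqF//; congr expR.
  by rewrite -mulr_natr; field; rewrite gt_eqF.
under eq_integral do rewrite E EFinM.
rewrite ge0_integralZl//; last 2 first.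
- by apply/measurable_EFinP; exact: measurable_normal_pdf.
- by move=> x _; rewrite lee_fin normal_pdf_ge0.
by rewrite integral_normal_pdf mule1.
Qed.

Lemma int_Rn_gaussian n (a : R) : 0 < a ->
  int_Rn (fun y : 'rV[R]_n => (expR (- (a * sqnorm y)))%:E) =
  (Num.sqrt (pi / a) ^+ n)%:E.
Proof.
move=> a0; rewrite /int_Rn.
have -> : (fun s : nat -> R => (expR (- (a * sqnorm (\row_(i < n) s i))))%:E) =
   (fun s => (\prod_(i < n) expR (- (a * s i ^+ 2)))%:E).
  apply/funext => s; congr EFin; rewrite -expR_sum; congr expR.
  by rewrite /sqnorm mulr_sumr -sumrN; apply: eq_bigr => i _; rewrite mxE.
rewrite (@iter_int_prod _ _ (fun _ x => expR (- (a * x ^+ 2))) (fun=> Num.sqrt (pi / a))).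
- by rewrite prodr_const card_ord.
- move=> _; apply: measurableT_comp; first exact: measurable_expR.
  apply: measurableT_comp; first exact: oppr_measurable.
  by apply: measurable_funM => //; exact: exprn_measurable.
- by move=> _ x; exact: expR_ge0.
- by move=> _; exact: integral_gaussian.
Qed.

Lemma row_measurable_sqnorm n : row_measurable (@sqnorm R n).
Proof.
rewrite /row_measurable.
by under eq_fun do rewrite -[row_of_seq n _]subr0; exact: measurable_sqnorm_row.
Qed.

Section SecondMomentLowerBound.
Variables (n : nat) (V : set 'rV[R]_n) (v M : R).
Hypothesis mV : row_measurable (fun y => \1_V y : R).
Hypothesis vE : leb_Rn V = v%:E.
Hypothesis ME : int_Rn (fun y => (\1_V y * sqnorm y)%:E) = M%:E.
Hypothesis v0 : 0 < v.

(* Jensen's inequality through the tangent line of [exp] at [- a M / v]. *)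
Lemma gaussian_mass_bound (a : R) : 0 < a ->
  expR (- (a * M / v)) * v <= Num.sqrt (pi / a) ^+ n.
Proof.
move=> a0; set t := a * M / v.
have M0 : 0 <= M.
  by rewrite -lee_fin -ME int_Rn_ge0// => y; rewrite lee_fin mulr_ge0// sqnorm_ge0.
have t0 : 0 <= t by rewrite divr_ge0 ?mulr_ge0// ltW.
have mVs : row_measurable (fun y => (\1_V y * sqnorm y)%:E).
  by apply/measurable_EFinP; apply: measurable_funM => //; exact: row_measurable_sqnorm.
have mVe : row_measurable (fun y => (\1_V y : R)%:E) by apply/measurable_EFinP.
have mG : row_measurable (fun y : 'rV[R]_n => (expR (- (a * sqnorm y)))%:E).
  apply/measurable_EFinP; apply: measurableT_comp; first exact: measurable_expR.
  apply: measurableT_comp; first exact: oppr_measurable.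
  by apply: measurable_funM => //; exact: row_measurable_sqnorm.
have ea0 : 0 <= expR (- t) * a by rewrite mulr_ge0 ?expR_ge0// ltW.
have et0 : 0 <= expR (- t) * (1 + t) by rewrite mulr_ge0 ?expR_ge0// addr_ge0.
have : (int_Rn (fun y => (expR (- t) * (1 + t))%:E * (\1_V y : R)%:E) <=
  int_Rn (fun y : 'rV[R]_n => (expR (- (a * sqnorm y)))%:E +
     (expR (- t) * a)%:E * (\1_V y * sqnorm y)%:E))%E.
  apply: le_int_Rn.
  - by apply: emeasurable_funM => //; exact: measurable_cst.
  - by move=> y; rewrite mule_ge0// lee_fin.
  - apply: emeasurable_funD => //.
    by apply: emeasurable_funM => //; exact: measurable_cst.
  move=> y; rewrite -!EFinM -EFinD lee_fin indicE.
  case: (y \in V); last by rewrite mulr0 mul0r mulr0 addr0 expR_ge0.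
  rewrite mulr1 mul1r.
  have -> : expR (- (a * sqnorm y)) = expR (- t) * expR (t - a * sqnorm y).
    by rewrite -expRD; congr expR; ring.
  have := expR_ge1Dx (t - a * sqnorm y); have := expR_gt0 (- t).
  by nra.
have V0 y : (0 <= (\1_V y : R)%:E)%E by rewrite lee_fin.
have Vs0 y : (0 <= (\1_V y * sqnorm y)%:E)%E by rewrite lee_fin mulr_ge0// sqnorm_ge0.
have G0 (y : 'rV[R]_n) : (0 <= (expR (- (a * sqnorm y)))%:E)%E by rewrite lee_fin expR_ge0.
have cVs0 y : (0 <= (expR (- t) * a)%:E * (\1_V y * sqnorm y)%:E)%E by rewrite mule_ge0.
have mcVs : row_measurable (fun y => (expR (- t) * a)%:E * (\1_V y * sqnorm y)%:E)%E.
  by apply: emeasurable_funM => //; exact: measurable_cst.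
rewrite (int_RnZ et0 mVe V0) (int_RnD mG G0 mcVs cVs0) (int_RnZ ea0 mVs Vs0).
rewrite ME int_Rn_gaussian// -/(leb_Rn V) vE -!EFinM -EFinD lee_fin.
have -> : expR (- t) * a * M = expR (- t) * (t * v).
  by rewrite /t divfK ?gt_eqF// mulrA.
by rewrite mulrDr mulr1 mulrDl -mulrA; lra.
Qed.

(** If M were 0, [gaussian_mass_bound] at a = pi / x^2 would read v <= x^n; the chosen x satisfies x
    <= 1 and x < v, which contradicts this. *)
Lemma second_moment_gt0 : (0 < n)%N -> 0 < M.
Proof.
move=> n0; have M0 : 0 <= M.
  by rewrite -lee_fin -ME int_Rn_ge0// => y; rewrite lee_fin mulr_ge0// sqnorm_ge0.
rewrite lt_neqAle M0 andbT; apply/eqP => M00.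
pose x := Num.min 1 v / 2.
have x0 : 0 < x by rewrite divr_gt0// lt_min ltr01.
have x1 : x <= 1 by rewrite ler_pdivrMr// mul1r ge_min ler1n.
have xv : x < v.
  by rewrite ltr_pdivrMr// gt_min; apply/orP; right; rewrite mulr_natr mulr2n ltrDl.
have := @gaussian_mass_bound (pi / x ^+ 2).
rewrite divr_gt0 ?pi_gt0 ?exprn_gt0// => /(_ isT).
rewrite -M00 mulr0 mul0r oppr0 expR0 mul1r invf_div mulrCA divff ?gt_eqF ?pi_gt0//.
rewrite mulr1 sqrtr_sqr gtr0_norm// leNgt => /negP; apply.
by apply: le_lt_trans xv; case: n n0 => // k _; rewrite exprS ler_piMr ?exprn_ile1// ltW.
Qed.

Lemma normalized_second_moment_ge : (0 < n)%N ->
  (2 * pi * expR 1)^-1 <= (n%:R * v `^ (1 + 2 / n%:R))^-1 * M.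
Proof.
move=> n0; have M0 := second_moment_gt0 n0.
have nR : 0 < n%:R :> R by rewrite ltr0n.
(* This value maximises exp(- a M / v) a^(n/2), hence gives the sharpest instance; it makes the
   exponent n/2 and, after taking the power 2/n, produces the factor e. *)
have := @gaussian_mass_bound (n%:R * v / (2 * M)).
rewrite divr_gt0 ?mulr_gt0// => /(_ isT).
have -> : n%:R * v / (2 * M) * M / v = n%:R / 2.
  by field; rewrite !gt_eqF.
set q := pi / _.
have qE : q = 2 * pi * M / (n%:R * v) by rewrite /q; field; rewrite !gt_eqF.
have q0 : 0 < q by rewrite qE divr_gt0 ?mulr_gt0 ?pi_gt0.
move=> H.
set x := v `^ (2 / n%:R).
have x0 : 0 < x by rewrite powR_gt0.
have xn : x ^+ n = v ^+ 2.
  rewrite -powR_mulrn ?powR_ge0// -powRrM divfK ?gt_eqF//.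
  by rewrite -[2]/(2%:R) powR_mulrn// ltW.
have xq : x * expR (- 1) <= q.
  rewrite -(@ler_pXn2r _ n)// ?nnegrE ?(ltW q0) ?mulr_ge0 ?expR_ge0 ?(ltW x0)//.
  rewrite exprMn xn -expRM_natl -[q in leRHS](sqr_sqrtr (ltW q0)) exprAC.
  have -> : v ^+ 2 * expR (n%:R * -1) = (expR (- (n%:R / 2)) * v) ^+ 2.
    rewrite exprMn mulrC; congr (_ * _); rewrite -expRM_natl; congr expR.
    by field.
  by rewrite lerXn2r// nnegrE ?mulr_ge0 ?expR_ge0 ?exprn_ge0 ?sqrtr_ge0// ltW.
have vpow : v `^ (1 + 2 / n%:R) = v * x.
  by rewrite powRD ?powRr1 ?(ltW v0)//; apply/implyP => _; rewrite gt_eqF.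
rewrite vpow invf_ple ?posrE ?mulr_gt0 ?invr_gt0 ?mulr_gt0 ?pi_gt0 ?expR_gt0//.
rewrite invfM invrK ler_pdivrMr//.
move: xq; rewrite expRN ler_pdivrMr ?expR_gt0// qE mulrAC ler_pdivlMr ?mulr_gt0//.
by lra.
Qed.

End SecondMomentLowerBound.
End Gaussian.

(** * Collisions of random syndromes *)

Section Collision.
Variables (R : realType) (X Y : finType) (mu : X -> R) (f : X -> Y).
Hypothesis mu0 : forall x, 0 <= mu x.
Hypothesis mu1 : \sum_x mu x = 1.

Definition collision := \sum_x \sum_x' mu x * mu x' * (f x == f x')%:R.

Definition charged : {set Y} := [set y | [exists x, (mu x != 0) && (f x == y)]].

Lemma card_charged_ge : 1 <= #|charged|%:R * collision.
Proof.
pose N y := \sum_(x | f x == y) mu x.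
have Nout y : y \notin charged -> N y = 0.
  rewrite inE => /existsPn H; rewrite /N big1// => x fx.
  by have := H x; rewrite fx andbT negbK => /eqP.
have N1 : \sum_(y in charged) N y = 1.
  rewrite -mu1 (partition_big f xpredT)//= [RHS](bigID (mem charged))/=.
  by rewrite [X in _ = _ + X]big1 ?addr0.
have N2 : collision = \sum_(y in charged) N y ^+ 2.
  transitivity (\sum_y N y ^+ 2); last first.
    rewrite [LHS](bigID (mem charged))/= [X in _ + X]big1 ?addr0// => y /Nout ->.
    by rewrite expr0n.
  rewrite /collision (partition_big f xpredT)//=; apply: eq_bigr => y _.
  rewrite expr2 mulr_suml; apply: eq_bigr => x /eqP <-.
  rewrite mulr_sumr [LHS](bigID (fun x' => f x' == f x))/= [X in _ + X]big1 ?addr0.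
    by apply: eq_bigr => x' /eqP ->; rewrite eqxx mulr1.
  by move=> x' /negbTE; rewrite eq_sym => ->; rewrite mulr0.
set g : R := #|charged|%:R; rewrite N2.
(* With the [N y] summing to 1 over g terms, the expansion is g^2 Q - 2g + g >= 0, that is g Q >=
   1. *)
have : 0 <= \sum_(y in charged) (g * N y - 1) ^+ 2.
  by apply: sumr_ge0 => y _; exact: sqr_ge0.
have -> : \sum_(y in charged) (g * N y - 1) ^+ 2 =
    \sum_(y in charged) (g ^+ 2 * N y ^+ 2 - 2 * g * N y + 1).
  by apply: eq_bigr => y _; ring.
rewrite big_split/= sumrB sumr_const -/g -!mulr_sumr N1 mulr1.
have g0 : 0 < g.
  rewrite ltr0n lt0n; apply/negP => /eqP g0.
  move: N1; rewrite big1 ?(eqxx, oner_eq0)//.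
    by move/eqP; rewrite eq_sym oner_eq0.
  by move=> y; rewrite (cards0_eq g0) inE.
set s := \sum_(y in _) _ => H.
rewrite -(ler_pM2l g0) mulr1 mulrA -expr2; lra.
Qed.

End Collision.

(** * Mean collision excess over the random parity-check matrix *)

Section LDA.
Variables (R : realType) (p m n : nat) (Hh : 'M[bool]_(m, n)).
Hypothesis p_pr : prime p.
Local Notation F := 'F_p.

Let pR : (0 : R) < p%:R. Proof. by rewrite ltr0n prime_gt0. Qed.

Definition syndrome (h : 'M[F]_(m, n)) (x : 'rV[F]_n) : 'cV[F]_m :=
  \col_i \sum_j (if Hh i j then h i j else 0) * x 0 j.

Lemma syndromeB h x y : syndrome h (x - y) = syndrome h x - syndrome h y.
Proof.
apply/colP => i; rewrite !mxE -sumrB; apply: eq_bigr => j _.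
by rewrite !mxE mulrBr.
Qed.

Definition support (x : 'rV[F]_n) : {set 'I_n} := [set j | x 0 j != 0].

(** Translating [r] along a coordinate where [y] is nonzero shifts the value of the form by any
    prescribed amount, so all p values are equally frequent. The boolean exponent is 0 for the zero
    form. *)
Lemma card_linear_form_zero (y : {ffun 'I_n -> F}) :
  \sum_(r : {ffun 'I_n -> F}) (\sum_j r j * y j == 0)%:R =
  (p%:R)^-1 ^+ [exists j, y j != 0] * p%:R ^+ n :> R.
Proof.
have cardF : #|{ffun 'I_n -> F}| = (p ^ n)%N by rewrite card_ffun card_Fp// card_ord.
have [/existsP[j0 yj0]|/existsPn y0] := boolP [exists j, y j != 0]; last first.
  rewrite expr0 mul1r (eq_bigr (fun=> 1)) ?sumr_const ?cardF ?natrX// => r _.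
  rewrite big1 ?eqxx// => j _; have := y0 j; rewrite negbK => /eqP ->.
  by rewrite mulr0.
pose cnt a : R := \sum_(r : {ffun 'I_n -> F}) (\sum_j r j * y j == a)%:R.
have cntE a : cnt a = cnt 0.
  pose e : {ffun 'I_n -> F} := [ffun j => if j == j0 then a / y j0 else 0].
  have sumE (r : {ffun 'I_n -> F}) : \sum_j (r + e) j * y j = \sum_j r j * y j + a.
    under eq_bigr do rewrite ffunE mulrDl.
    rewrite big_split/= [X in _ + X](bigD1 j0)//= [X in _ + (_ + X)]big1 => [|j jj0].
      by rewrite ffunE eqxx addr0 divfK.
    by rewrite ffunE (negbTE jj0) mul0r.
  rewrite /cnt (reindex_inj (addIr e))/=; apply: eq_bigr => r _.
  by rewrite sumE -subr_eq0 addrK.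
have : \sum_a cnt a = p%:R ^+ n.
  rewrite /cnt exchange_big/= -natrX -cardF -sum1_card natr_sum.
  apply: eq_bigr => r _; rewrite (bigD1 (\sum_j r j * y j))//= eqxx big1 ?addr0//.
  by move=> a; rewrite eq_sym => /negbTE ->.
under eq_bigr do rewrite cntE.
rewrite sumr_const card_Fp// => <-.
by rewrite expr1 -[cnt 0 *+ p]mulr_natl mulKf// gt_eqF.
Qed.

(** The rows are independent: a check node adjacent to the support sees a nonzero linear form and
    vanishes with probability 1/p, any other check vanishes always. *)
Lemma sum_syndrome_zero x :
  \sum_(h : 'M[F]_(m, n)) (syndrome h x == 0)%:R =
  #|{: 'M[F]_(m, n)}|%:R * (p%:R)^-1 ^+ #|NV Hh (support x)| :> R.
Proof.
pose toM (f : {ffun 'I_m -> {ffun 'I_n -> F}}) : 'M[F]_(m, n) := \matrix_(i, j) f i j.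
pose y i : {ffun 'I_n -> F} := [ffun j => if Hh i j then x 0 j else 0].
have toM_bij : bijective toM.
  exists (fun h : 'M[F]_(m, n) => [ffun i => [ffun j => h i j]]) => [f|h].
    by apply/ffunP => i; apply/ffunP => j; rewrite !ffunE mxE.
  by apply/matrixP => i j; rewrite mxE !ffunE.
have yE i : [exists j, y i j != 0] = (i \in NV Hh (support x)).
  rewrite inE; apply/existsP/existsP => -[j].
    rewrite ffunE; case: ifP => [Hij xj|]; last by rewrite eqxx.
    by exists j; rewrite inE xj Hij.
  by rewrite inE => /andP[xj Hij]; exists j; rewrite ffunE Hij.
rewrite (reindex toM) /=; last exact: onW_bij.
transitivity (\sum_(f : {ffun 'I_m -> {ffun 'I_n -> F}})
    \prod_i ((\sum_j f i j * y i j == 0)%:R : R)).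
  apply: eq_bigr => f _.
  have E i : syndrome (toM f) x i 0 = \sum_j f i j * y i j.
    rewrite mxE; apply: eq_bigr => j _; rewrite mxE ffunE.
    by case: ifP; rewrite ?mul0r ?mulr0.
  have [/eqP s0|s0] := boolP (syndrome (toM f) x == 0).
    rewrite big1// => i _; rewrite -E s0 mxE eqxx//.
  have [i si] : exists i, syndrome (toM f) x i 0 != 0.
    apply/existsP; apply: contraR s0 => /existsPn s0.
    by apply/eqP/colP => i; rewrite [RHS]mxE; apply/eqP; have := s0 i; rewrite negbK.
  by rewrite (bigD1 i)//= -E (negbTE si) mul0r.
rewrite -(bigA_distr_bigA (fun i (r : {ffun 'I_n -> F}) => (\sum_j r j * y i j == 0)%:R : R)) /=.
under eq_bigr do rewrite card_linear_form_zero yE.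
rewrite big_split/= prodr_const card_ord -exprM mulrC; congr (_ * _).
  by rewrite card_mx card_Fp// natrX mulnC.
rewrite prodrXr; congr (_ ^+ _); rewrite -sum1_card [RHS]big_mkcond/=.
by apply: eq_bigr => i _; case: (i \in _).
Qed.

Lemma mem_setC_NC (x x' : 'rV[F]_n) (j : 'I_n) :
  j \in NC Hh (~: NV Hh (support (x - x'))) -> x' 0 j = x 0 j.
Proof.
rewrite inE => /existsP[i]; rewrite inE => /andP[iN Hij].
apply/eqP; apply: contraR iN => xj; rewrite inE; apply/existsP; exists j.
by rewrite Hij andbT inE !mxE subr_eq0 eq_sym.
Qed.

Section Excess.
Variable mu : 'rV[F]_n -> R.
Hypothesis mu0 : forall x, 0 <= mu x.
Hypothesis mu1 : \sum_x mu x = 1.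

(** Relative excess of the collision probability over p^(-m), the value for uniform syndromes and
    the least possible one. *)
Definition excess (h : 'M[F]_(m, n)) : R :=
  p%:R ^+ m * collision mu (syndrome h) - 1.

Lemma excess_ge0 h : 0 <= excess h.
Proof.
rewrite subr_ge0 (le_trans (card_charged_ge (syndrome h) mu1))//.
rewrite ler_wpM2r//.
  by do 2![apply: sumr_ge0 => ? _]; rewrite !mulr_ge0.
rewrite -natrX ler_nat (leq_trans (max_card _))//.
by rewrite card_mx card_Fp// muln1.
Qed.

Lemma mean_excess :
  (\sum_h excess h) / #|{: 'M[F]_(m, n)}|%:R =
  \sum_x \sum_x' mu x * mu x' *
    (p%:R ^+ m * (p%:R)^-1 ^+ #|NV Hh (support (x - x'))| - 1).
Proof.
have M0 : (#|{: 'M[F]_(m, n)}|%:R : R) != 0.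
  by rewrite pnatr_eq0 -lt0n; apply/card_gt0P; exists 0.
have Emu : \sum_x \sum_x' mu x * mu x' = 1.
  by under eq_bigr do rewrite -mulr_sumr mu1 mulr1.
apply: (canLR (mulfK M0)); rewrite sumrB sumr_const -mulr_sumr.
have -> : \sum_h collision mu (syndrome h) = #|{: 'M[F]_(m, n)}|%:R *
    \sum_x \sum_x' mu x * mu x' * (p%:R)^-1 ^+ #|NV Hh (support (x - x'))|.
  rewrite exchange_big/= mulr_sumr; apply: eq_bigr => x _.
  rewrite exchange_big/= mulr_sumr; apply: eq_bigr => x' _.
  rewrite -mulr_sumr mulrCA -sum_syndrome_zero; congr (_ * _).
  by apply: eq_bigr => h _; rewrite syndromeB subr_eq0.
under [in RHS]eq_bigr do under eq_bigr do rewrite mulrBr mulr1 mulrCA.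
under [in RHS]eq_bigr do rewrite sumrB -mulr_sumr.
by rewrite sumrB Emu -mulr_sumr mulrBl mul1r mulrAC mulrA.
Qed.

Hypothesis expand : forall S : {set 'I_n},
  (2 * #|NV Hh S| < m)%N -> (#|S| <= #|NV Hh S|)%N.
Variable a : {set 'I_n} -> R.
Hypothesis agree : forall (x : 'rV[F]_n) (U : {set 'I_n}),
  \sum_(x' : 'rV[F]_n | [forall j in U, x' 0 j == x 0 j]) mu x' <= a U.

Definition check_side_bound : R :=
  \sum_(T : {set 'I_m} | (0 < #|T|)%N && (2 * #|T| <= m)%N)
     p%:R ^+ #|T| * a (NC Hh T).

Definition variable_side_bound : R :=
  \sum_(S : {set 'I_n}) p%:R ^+ m * (p%:R)^-1 ^+ #|S| * a (~: S).

(* The unreached check nodes [T] of the difference of two points decide: if at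
   most half of the check nodes are unreached, sum over [T]; otherwise the
   support of the difference is small, and sum over the support. *)
Lemma mean_excess_le :
  (\sum_h excess h) / #|{: 'M[F]_(m, n)}|%:R <=
  check_side_bound + variable_side_bound.
Proof.
have p1 : (1 : R) <= p%:R by rewrite ler1n prime_gt0.
pose agr (U : {set 'I_n}) (x x' : 'rV[F]_n) : bool := [forall j in U, x' 0 j == x 0 j].
have key x x' : p%:R ^+ m * (p%:R)^-1 ^+ #|NV Hh (support (x - x'))| - 1 <= (0 : R) +
    \sum_(T : {set 'I_m} | (0 < #|T|)%N && (2 * #|T| <= m)%N)
      p%:R ^+ #|T| * (agr (NC Hh T) x x')%:R +
    \sum_(S : {set 'I_n}) p%:R ^+ m * (p%:R)^-1 ^+ #|S| * (agr (~: S) x x')%:R.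
  rewrite add0r; set S := support (x - x'); set T := ~: NV Hh S.
  have cT : (#|NV Hh S| + #|T| = m)%N by rewrite cardsC card_ord.
  have pT : p%:R ^+ m * (p%:R)^-1 ^+ #|NV Hh S| = p%:R ^+ #|T| :> R.
    by rewrite -[in p%:R ^+ m]cT exprD exprVn mulrAC mulfV ?mul1r// expf_neq0 ?gt_eqF.
  have E1 : 0 <= \sum_(T : {set 'I_m} | (0 < #|T|)%N && (2 * #|T| <= m)%N)
      p%:R ^+ #|T| * (agr (NC Hh T) x x')%:R :> R.
    by apply: sumr_ge0 => U _; rewrite mulr_ge0 ?exprn_ge0// ltW.
  have E2 : 0 <= \sum_(S : {set 'I_n})
      p%:R ^+ m * (p%:R)^-1 ^+ #|S| * (agr (~: S) x x')%:R :> R.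
    by apply: sumr_ge0 => U _; rewrite !mulr_ge0 ?exprn_ge0 ?invr_ge0// ltW.
  (* If every check is reached, the pair contributes p^0 - 1 = 0; this is why the empty [T] may be
     left out of [check_side_bound]. *)
  have [T0|T0] := posnP #|T|.
    by rewrite pT T0 expr0 subrr addr_ge0.
  have [T2|T2] := leqP (2 * #|T|) m.
    rewrite (bigD1 T) ?T0//= (_ : agr _ _ _); last first.
      by apply/forall_inP => j jT; apply/eqP/mem_setC_NC.
    rewrite mulr1 pT -addrA lerD2l (@le_trans _ _ 0)// ?oppr_le0//.
    apply: addr_ge0 => //; apply: sumr_ge0 => U _.
    by rewrite mulr_ge0 ?exprn_ge0// ltW.
  (* More than half of the checks are unreached, so the support reaches fewer than m/2, and p^(m -
     |N(S)|) can be replaced by p^(m - |S|). *)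
  have SN : (#|S| <= #|NV Hh S|)%N by apply: expand; lia.
  rewrite [X in _ <= _ + X](bigD1 S)//= (_ : agr _ _ _); last first.
    apply/forall_inP => j; rewrite !inE negbK !mxE subr_eq0 => /eqP ->.
    exact: eqxx.
  rewrite mulr1.
  have H1 : p%:R ^+ m * (p%:R)^-1 ^+ #|NV Hh S| <= p%:R ^+ m * (p%:R)^-1 ^+ #|S| :> R.
    by rewrite ler_wpM2l ?exprn_ge0 ?(ltW pR)// ler_wiXn2l// ?invr_ge0 ?invf_le1 ?(ltW pR).
  have H2 : 0 <= \sum_(U : {set 'I_n} | U != S)
      p%:R ^+ m * (p%:R)^-1 ^+ #|U| * (agr (~: U) x x')%:R :> R.
    by apply: sumr_ge0 => U _; rewrite !mulr_ge0 ?exprn_ge0 ?invr_ge0// ltW.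
  apply: (@le_trans _ _ (p%:R ^+ m * (p%:R)^-1 ^+ #|S|)).
    by apply: le_trans H1; rewrite gerBl.
  by apply: ler_wpDl => //; rewrite lerDl.
have hagr U : \sum_x \sum_x' mu x * mu x' * (agr U x x')%:R <= a U.
  rewrite -[a U]mul1r -[X in _ <= X * _]mu1 mulr_suml; apply: ler_sum => x _.
  under eq_bigr do rewrite -mulrA; rewrite -mulr_sumr ler_wpM2l//.
  apply: le_trans (agree x U); rewrite [leRHS]big_mkcond/=.
  apply: ler_sum => x' _; rewrite -/(agr U x x'); case: (agr U x x') => /=.
    by rewrite mulr1.
  by rewrite mulr0.
rewrite mean_excess.
apply: (@le_trans _ _ (\sum_x \sum_x' mu x * mu x' *
    (\sum_(T : {set 'I_m} | (0 < #|T|)%N && (2 * #|T| <= m)%N)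
      p%:R ^+ #|T| * (agr (NC Hh T) x x')%:R +
    \sum_(S : {set 'I_n}) p%:R ^+ m * (p%:R)^-1 ^+ #|S| * (agr (~: S) x x')%:R))).
  apply: ler_sum => x _; apply: ler_sum => x' _; apply: ler_wpM2l.
    by rewrite mulr_ge0.
  by have := key x x'; rewrite add0r.
under eq_bigr do under eq_bigr do rewrite mulrDr !mulr_sumr.
under eq_bigr do rewrite big_split/= exchange_big/= [X in _ + X]exchange_big/=.
rewrite big_split/= exchange_big/= [X in _ + X]exchange_big/=.
apply: lerD; apply: ler_sum => U _.
  under eq_bigr do under eq_bigr do rewrite mulrCA.
  under eq_bigr do rewrite -mulr_sumr.
  by rewrite -mulr_sumr ler_wpM2l ?exprn_ge0// ltW.
under eq_bigr do under eq_bigr do rewrite mulrCA.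
under eq_bigr do rewrite -mulr_sumr.
by rewrite -mulr_sumr ler_wpM2l ?mulr_ge0 ?exprn_ge0 ?invr_ge0// ltW.
Qed.

Lemma excess_markov (e : R) : 0 < e ->
  1 - (check_side_bound + variable_side_bound) / e <=
  #|[set h : 'M[F]_(m, n) | excess h <= e]%SET|%:R / #|[set: 'M[F]_(m, n)]%SET|%:R.
Proof.
move=> e0; have M0 : (0 : R) < #|{: 'M[F]_(m, n)}|%:R.
  by rewrite ltr0n; apply/card_gt0P; exists 0.
rewrite cardsT ler_pdivlMr//.
have := mean_excess_le; rewrite ler_pdivrMr// => H.
set b := check_side_bound + _ in H *.
have cS : #|[set h : 'M[F]_(m, n) | excess h <= e]%SET|%:R +
  #|~: [set h : 'M[F]_(m, n) | excess h <= e]%SET|%:R = #|{: 'M[F]_(m, n)}|%:R :> R.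
  by rewrite -natrD cardsC.
have : #|~: [set h : 'M[F]_(m, n) | excess h <= e]%SET|%:R * e <= \sum_h excess h.
  rewrite (bigID (mem (~: [set h : 'M[F]_(m, n) | excess h <= e]%SET)))/=.
  rewrite -[leLHS]addr0 lerD//; last by apply: sumr_ge0 => h _; exact: excess_ge0.
  rewrite mulr_natl -sumr_const; apply: ler_sum => h.
  by rewrite !inE -ltNge => /ltW.
rewrite mulrBl mul1r mulrAC => H1.
have : b * #|{: 'M[F]_(m, n)}|%:R / e >= #|~: [set h : 'M[F]_(m, n) | excess h <= e]%SET|%:R.
  by rewrite ler_pdivlMr// (le_trans H1).
lra.
Qed.

End Excess.

End LDA.

(** * Riemann sums of Gaussians *)

Section GaussSum.
Variable R : realType.

(** Treating both signs at once gives pieces of measure 2, on which a Gaussian lies between its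
    values at the outer and the inner radius. *)
Definition annulus (k : nat) : set R := [set x | k%:R <= `|x| < k.+1%:R].

Lemma annulusE k : annulus k =
  `](- k.+1%:R), k.+1%:R[%classic `\` `](- k%:R), k%:R[%classic.
Proof.
apply/seteqP; split=> x /=; rewrite /annulus/= !in_itv/= -!ltr_norml.
  by move=> /andP[kx ->]; split=> //; apply/negP; rewrite -leNgt.
by move=> [-> /negP]; rewrite -leNgt => ->.
Qed.

Lemma measurable_annulus k : measurable (annulus k).
Proof. by rewrite annulusE; exact: measurableD. Qed.

Lemma lebesgue_measure_annulus k : lebesgue_measure (annulus k) = 2%:E.
Proof.
rewrite annulusE measureD//=; last first.
  by rewrite lebesgue_measure_itv/=; case: ifP => _; rewrite ?ltry// -EFinD ltry.
rewrite setIidr; last first.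
  move=> x /=; rewrite !in_itv/= -!ltr_norml => /lt_trans; apply.
  by rewrite ltr_nat.
rewrite !lebesgue_measure_itv/= !lte_fin.
have E (j : nat) : (if (- j%:R < j%:R :> R)%R then j%:R%:E - (- j%:R)%:E else 0)%E = (2 * j%:R : R)%:E.
  case: ltP => jj; first by rewrite -EFinB; congr EFin; ring.
  have : (j%:R : R) = 0 by apply/eqP; rewrite eq_le ler0n andbT; lra.
  by move=> ->; rewrite mulr0.
by rewrite !E -EFinB; congr EFin; rewrite -natr1; ring.
Qed.

Lemma integral_steps (c : nat -> R) N : (forall k, 0 <= c k) ->
  (\int[lebesgue_measure]_x (\sum_(k < N) c k * \1_(annulus k) x)%:E)%E =
  (2 * \sum_(k < N) c k)%:E.
Proof.
move=> c0; under eq_integral do rewrite -sumEFin.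
rewrite ge0_integral_sum//; first last.
- by move=> k x _; rewrite lee_fin mulr_ge0.
- move=> k; apply/measurable_EFinP; apply: measurable_funM => //.
  by apply: measurable_indic; exact: measurable_annulus.
rewrite mulr_sumr -sumEFin; apply: eq_bigr => k _.
under eq_integral do rewrite EFinM.
rewrite ge0_integralZl//=; first last.
- exact: c0.
- by apply/measurable_EFinP; apply: measurable_indic; exact: measurable_annulus.
rewrite integral_indic//=; last exact: measurable_annulus.
by rewrite setIT lebesgue_measure_annulus -EFinM mulrC.
Qed.

Lemma sum_annulus_le (c : nat -> R) N x y : 0 <= y ->
  (forall k, annulus k x -> c k <= y) ->
  \sum_(k < N) c k * \1_(annulus k) x <= y.
Proof.
move=> y0 cy; have [[k kx]|nk] := pselect (exists k : 'I_N, annulus k x).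
  rewrite (bigD1 k)//= big1 => [|j jk].
    by rewrite addr0 indicE mem_set// mulr1 cy.
  rewrite indicE memNset ?mulr0// => jx; move: jk kx jx => /negP jk.
  move=> /andP[k1 k2] /andP[j1 j2]; apply: jk; apply/eqP/val_inj/eqP => /=.
  have := le_lt_trans j1 k2; have := le_lt_trans k1 j2.
  by rewrite !ltr_nat !ltnS eqn_leq => -> ->.
rewrite big1// => k _; rewrite indicE memNset ?mulr0// => kx.
by apply: nk; exists k.
Qed.

Lemma measurable_gaussian (s : R) : measurable_fun setT (fun x : R => (expR (- (s * x ^+ 2)))%:E).
Proof.
apply/measurable_EFinP; apply: measurableT_comp; first exact: measurable_expR.
apply: measurableT_comp; first exact: oppr_measurable.
by apply: measurable_funM => //; exact: exprn_measurable.
Qed.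

Let mstep (c : nat -> R) N :
  measurable_fun setT (fun x : R => (\sum_(k < N) c k * \1_(annulus k) x)%:E).
Proof.
apply/measurable_EFinP; apply: measurable_sum => k; apply: measurable_funM => //.
by apply: measurable_indic; exact: measurable_annulus.
Qed.

Lemma gauss_sum_le (s : R) N : 0 < s ->
  2 * \sum_(k < N) expR (- (s * k.+1%:R ^+ 2)) <= Num.sqrt (pi / s).
Proof.
move=> s0; rewrite -lee_fin -integral_gaussian//.
rewrite -(integral_steps (c := fun k => expR (- (s * k.+1%:R ^+ 2))))//.
apply: ge0_le_integral => //.
- by move=> x _; rewrite lee_fin sumr_ge0// => k _; rewrite mulr_ge0 ?expR_ge0.
- exact: (mstep (fun k => expR (- (s * k.+1%:R ^+ 2))) N).
- exact: measurable_gaussian.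
move=> x _; rewrite lee_fin; apply: (sum_annulus_le (c := fun k => expR (- (s * k.+1%:R ^+ 2)))).
  exact: expR_ge0.
move=> k /andP[k1 k2]; rewrite ler_expR lerN2 ler_pM2l//.
by rewrite -[leLHS]real_normK ?num_real// lerXn2r ?nnegrE// ltW.
Qed.

(** Below radius N the step function of inner values dominates. Beyond it, half of the exponent is
    at least s N^2 / 2 and the other half is integrated over the whole line. *)
Lemma gauss_sum_ge (s : R) N : 0 < s ->
  Num.sqrt (pi / s) <= 2 * \sum_(k < N) expR (- (s * k%:R ^+ 2)) +
    expR (- (s * N%:R ^+ 2 / 2)) * Num.sqrt (pi / (s / 2)).
Proof.
move=> s0; have s20 : 0 < s / 2 by rewrite divr_gt0.
rewrite -lee_fin EFinD [X in (_ + X)%E]EFinM -!integral_gaussian//.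
rewrite -(integral_steps (c := fun k => expR (- (s * k%:R ^+ 2))))//.
rewrite -ge0_integralZl//=; last exact: measurable_gaussian.
rewrite -ge0_integralD//=; first last.
- by apply: emeasurable_funM; [exact: measurable_cst|exact: measurable_gaussian].
- exact: (mstep (fun k => expR (- (s * k%:R ^+ 2))) N).
- by move=> x _; rewrite lee_fin sumr_ge0// => k _; rewrite mulr_ge0 ?expR_ge0.
apply: ge0_le_integral => //.
- exact: measurable_gaussian.
- apply: emeasurable_funD; first exact: (mstep (fun k => expR (- (s * k%:R ^+ 2))) N).
  by apply: emeasurable_funM; [exact: measurable_cst|exact: measurable_gaussian].
move=> x _; rewrite -EFinM -EFinD lee_fin.
have xx : `|x| ^+ 2 = x ^+ 2 by rewrite real_normK ?num_real.
have S0 : 0 <= \sum_(k < N) expR (- (s * k%:R ^+ 2)) * \1_(annulus k) x.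
  by rewrite sumr_ge0// => k _; rewrite mulr_ge0 ?expR_ge0.
have [xN|xN] := leP N%:R `|x|.
  apply: ler_wpDl => //; rewrite -expRD ler_expR -xx.
  have : N%:R ^+ 2 <= `|x| ^+ 2 by rewrite lerXn2r ?nnegrE.
  by rewrite -(ler_pM2l s20); lra.
rewrite -[leLHS]addr0 lerD ?mulr_ge0 ?expR_ge0//.
have /andP[t1 t2] := truncn_itv (normr_ge0 x).
have tN : (Num.truncn `|x| < N)%N by rewrite -(ltr_nat R) (le_lt_trans t1).
rewrite (bigD1 (Ordinal tN))//= indicE mem_set ?mulr1; last by apply/andP.
rewrite -[leLHS]addr0 lerD//; last first.
  by rewrite sumr_ge0// => k _; rewrite mulr_ge0 ?expR_ge0.
by rewrite ler_expR lerN2 ler_pM2l// -xx lerXn2r ?nnegrE.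
Qed.

End GaussSum.

(** * Discrete Gaussian weights on a shell *)

Section Theta.
Variables (R : realType) (p : nat).
Hypothesis p_pr : prime p.
Local Notation F := 'F_p.

(* absolute value of the representative of [a] in [-p/2, p/2] *)
Definition fp_abs (a : F) : nat := minn a (p - a).

Definition theta (s : R) : R := \sum_(a : F) expR (- (s * (fp_abs a)%:R ^+ 2)).

Lemma thetaE s : theta s = \sum_(k < p) expR (- (s * (minn k (p - k))%:R ^+ 2)).
Proof. by rewrite /theta /fp_abs; move: (Fp_cast p_pr) => /= ->. Qed.

Lemma theta_gt0 s : 0 < theta s.
Proof.
rewrite /theta (bigD1 0)//= ltr_pwDl ?expR_gt0//.
by apply: sumr_ge0 => a _; exact: expR_ge0.
Qed.

(** The minimum of k and p - k is one of the two, so its weight is at most the sum of both weights;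
    each of the two resulting one-sided sums is half of [gauss_sum_le]. Residue 0 gives the 1. *)
Lemma theta_le s : 0 < s -> theta s <= 1 + Num.sqrt (pi / s).
Proof.
move=> s0; rewrite thetaE; have p0 := prime_gt0 p_pr.
pose g (k : nat) : R := expR (- (s * k%:R ^+ 2)).
rewrite -(big_mkord xpredT (fun k => g (minn k (p - k)))) big_ltn// big_add1 big_mkord.
rewrite min0n {1}/g expr0n mulr0 oppr0 expR0 lerD2l.
apply: (@le_trans _ _ (\sum_(k < p.-1) g k.+1 + \sum_(k < p.-1) g k.+1)).
  rewrite [X in _ <= _ + X](reindex_inj rev_ord_inj)/= -big_split/=.
  apply: ler_sum => k _; have kp := ltn_ord k.
  rewrite (_ : (p.-1 - k.+1).+1 = (p - k.+1)%N); last lia.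
  have [kk|kk] := leqP k.+1 (p - k.+1).
    by rewrite lerDl expR_ge0.
  by rewrite lerDr expR_ge0.
have := gauss_sum_le p.-1 s0; rewrite -/(g _); lra.
Qed.

Lemma theta_ge s : 0 < s -> Num.sqrt (pi / s) - 1 -
  expR (- (s * (p./2)%:R ^+ 2 / 2)) * Num.sqrt (pi / (s / 2)) <= theta s.
Proof.
move=> s0; rewrite thetaE; have p1 := prime_gt1 p_pr.
pose g (k : nat) : R := expR (- (s * k%:R ^+ 2)).
have g0 k : 0 <= g k by exact: expR_ge0.
have h1 : (0 < p./2)%N by lia.
have pE : p = (p./2 + (p - p./2))%N by lia.
have S1 : \sum_(k < p) g (minn k (p - k)) >=
   \sum_(k < p./2) g k + \sum_(k < (p - p./2)) g k.+1.
  rewrite -(big_mkord xpredT (fun k => g (minn k (p - k)))) (@big_cat_nat _ _ _ p./2)//=; last by lia.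
  rewrite lerD//.
    rewrite big_mkord; apply: ler_sum => k _; have := ltn_ord k => kp.
    by rewrite (_ : minn k (p - k) = k); last lia.
  have -> : \sum_(p./2 <= k < p) g (minn k (p - k)) =
      \sum_(0 <= k < p - p./2) g (minn (k + p./2) (p - (k + p./2))).
    by rewrite -{1}[p./2]add0n big_addn.
  rewrite [leRHS]big_mkord [leRHS](reindex_inj rev_ord_inj)/=.
  apply: ler_sum => k _; have := ltn_ord k => kp.
  rewrite ler_expR lerN2 ler_pM2l// lerXn2r ?nnegrE// ler_nat; lia.
(* Residue 0 is counted only in the lower half, so the upper half starts at 1 and misses g 0 = 1:
   the origin of the [- 1] in the statement. *)
have S2 : \sum_(k < (p - p./2)) g k.+1 >= \sum_(k < p./2) g k - 1.
  rewrite -(big_mkord xpredT g) big_ltn// big_add1 {1}/g expr0n mulr0 oppr0 expR0.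
  rewrite addrC addKr -(big_mkord xpredT (fun k => g k.+1)).
  rewrite [leRHS](@big_cat_nat _ _ _ p./2.-1)//=; last lia.
  by rewrite lerDl sumr_ge0.
have := gauss_sum_ge p./2 s0; rewrite -/(g _); move: S1 S2.
set a := \sum_(k < p) _; set b := \sum_(k < p./2) _; set c := \sum_(k < p - p./2) _.
set d := _ * Num.sqrt (pi / (s / 2)).
by lra.
Qed.

End Theta.

Section ShellWeight.
Variables (R : realType) (p n : nat).
Hypothesis p_pr : prime p.
Local Notation F := 'F_p.

Definition fp_sqnorm (x : 'rV[F]_n) : R := \sum_j (fp_abs (x 0 j))%:R ^+ 2.

Definition gauss_weight (s : R) (x : 'rV[F]_n) : R := expR (- (s * fp_sqnorm x)).

Lemma gauss_weightE s x :
  gauss_weight s x = \prod_j expR (- (s * (fp_abs (x 0 j))%:R ^+ 2)).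
Proof. by rewrite /gauss_weight /fp_sqnorm mulr_sumr -sumrN expR_sum. Qed.

Lemma sum_row_prod (g : 'I_n -> F -> R) :
  \sum_(x : 'rV[F]_n) \prod_j g j (x 0 j) = \prod_j \sum_a g j a.
Proof.
rewrite bigA_distr_bigA/=.
rewrite (reindex (fun f : {ffun 'I_n -> F} => \row_j f j))/=.
  by apply: eq_bigr => f _; apply: eq_bigr => j _; rewrite mxE.
exists (fun x : 'rV[F]_n => [ffun j => x 0 j]) => x _.
  by apply/ffunP => j; rewrite ffunE mxE.
by apply/rowP => j; rewrite mxE ffunE.
Qed.

Lemma sum_gauss_weight s : \sum_x gauss_weight s x = theta p s ^+ n.
Proof.
under eq_bigr do rewrite gauss_weightE.
by rewrite (sum_row_prod (fun _ a => expR (- (s * (fp_abs a)%:R ^+ 2)))) prodr_const card_ord.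
Qed.

Lemma sum_gauss_weight_agree s (x : 'rV[F]_n) (U : {set 'I_n}) : 0 <= s ->
  \sum_(x' : 'rV[F]_n | [forall j in U, x' 0 j == x 0 j]) gauss_weight s x' <=
  theta p s ^+ #|~: U|.
Proof.
move=> s0.
pose g j (a : F) := ((j \in U) ==> (a == x 0 j))%:R * expR (- (s * (fp_abs a)%:R ^+ 2)) : R.
have -> : \sum_(x' : 'rV[F]_n | [forall j in U, x' 0 j == x 0 j]) gauss_weight s x' =
    \sum_(x' : 'rV[F]_n) \prod_j g j (x' 0 j).
  rewrite big_mkcond/=; apply: eq_bigr => x' _.
  rewrite /g big_split/= -gauss_weightE; case: ifPn => [/forallP H|/forallPn[j Hj]].
    by rewrite big1 ?mul1r// => j _; rewrite H.
  by rewrite (bigD1 j)//= (negbTE Hj) !mul0r.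
rewrite sum_row_prod (bigID (mem U))/= -[leRHS]mul1r.
have g0 j a : 0 <= g j a by rewrite mulr_ge0 ?expR_ge0.
apply: ler_pM.
- by apply: prodr_ge0 => j _; exact: sumr_ge0.
- by apply: prodr_ge0 => j _; exact: sumr_ge0.
- apply: prodr_ile1 => j jU; apply/andP; split; first exact: sumr_ge0.
  rewrite (bigD1 (x 0 j))//= big1 ?addr0 => [|a ax].
    rewrite /g jU eqxx mul1r -[leRHS]expR0 ler_expR oppr_le0.
    by rewrite mulr_ge0// sqr_ge0.
  by rewrite /g jU (negbTE ax) mul0r.
- rewrite -prodr_const [leRHS](eq_bigl (fun j => j \notin U)); last first.
    by move=> j; rewrite inE.
  apply: ler_prod => j jU; rewrite sumr_ge0//=.
  by apply: ler_sum => a _; rewrite /g (negbTE jU) mul1r.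
Qed.

Variables (s0 Tlo Thi : R).
Hypothesis s00 : 0 < s0.

Definition in_shell (x : 'rV[F]_n) := Tlo <= fp_sqnorm x <= Thi.

(** Chernoff's bound: on the tail, trading the part [s0 - s] of the Gaussian parameter for the
    threshold leaves a full product sum. *)
Lemma upper_tail_le (s : R) : s <= s0 ->
  \sum_(x | Thi < fp_sqnorm x) gauss_weight s0 x <=
  expR (- ((s0 - s) * Thi)) * theta p s ^+ n.
Proof.
move=> ss; rewrite -sum_gauss_weight mulr_sumr big_mkcond/=.
apply: ler_sum => x _; case: ifP => [xT|_]; last by rewrite mulr_ge0 ?expR_ge0.
rewrite /gauss_weight -expRD ler_expR.
have : 0 <= (s0 - s) * (fp_sqnorm x - Thi) by rewrite mulr_ge0 ?subr_ge0// ltW.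
by lra.
Qed.

Lemma lower_tail_le (s : R) : s0 <= s ->
  \sum_(x | fp_sqnorm x < Tlo) gauss_weight s0 x <=
  expR ((s - s0) * Tlo) * theta p s ^+ n.
Proof.
move=> ss; rewrite -sum_gauss_weight mulr_sumr big_mkcond/=.
apply: ler_sum => x _; case: ifP => [xT|_]; last by rewrite mulr_ge0 ?expR_ge0.
rewrite /gauss_weight -expRD ler_expR.
have : 0 <= (s - s0) * (Tlo - fp_sqnorm x) by rewrite mulr_ge0 ?subr_ge0// ltW.
by lra.
Qed.

Definition shell_mass : R := \sum_(x | in_shell x) gauss_weight s0 x.

Definition shell_weight (x : 'rV[F]_n) : R :=
  if in_shell x then gauss_weight s0 x / shell_mass else 0.

Lemma shell_mass_ge :
  theta p s0 ^+ n - \sum_(x | Thi < fp_sqnorm x) gauss_weight s0 x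
    - \sum_(x | fp_sqnorm x < Tlo) gauss_weight s0 x <= shell_mass.
Proof.
rewrite -sum_gauss_weight !lerBlDr /shell_mass (big_mkcond in_shell)/=.
rewrite [X in _ + X + _]big_mkcond [X in _ + X]big_mkcond/= -!big_split/=.
apply: ler_sum => x _; rewrite /in_shell.
have w0 : 0 <= gauss_weight s0 x by exact: expR_ge0.
by do 2!case: ltP => _ /=; lra.
Qed.

Hypothesis mass : theta p s0 ^+ n / 2 <= shell_mass.

Let mass0 : 0 < shell_mass.
Proof. by apply: lt_le_trans mass; rewrite divr_gt0// exprn_gt0// theta_gt0. Qed.

Lemma shell_weight_ge0 x : 0 <= shell_weight x.
Proof. by rewrite /shell_weight; case: ifP => // _; rewrite divr_ge0 ?expR_ge0 ?ltW. Qed.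

Lemma sum_shell_weight : \sum_x shell_weight x = 1.
Proof.
rewrite /shell_weight -big_mkcond/= -mulr_suml divff// gt_eqF//.
Qed.

(** The part [s1] of the parameter is traded for the inner radius of the shell, and the rest is
    summed as a product: a factor at most 1 for each fixed coordinate, a theta for each free one.
    The 2 pays for conditioning on the shell. The choice of [s1] decides which regime the bound is
    good for. *)
Lemma shell_weight_agree (s1 : R) (x : 'rV[F]_n) (U : {set 'I_n}) : 0 <= s1 <= s0 ->
  \sum_(x' : 'rV[F]_n | [forall j in U, x' 0 j == x 0 j]) shell_weight x' <=
  2 * (theta p s0)^-1 ^+ n * expR (- (s1 * Tlo)) * theta p (s0 - s1) ^+ #|~: U|.
Proof.
move=> /andP[s10 s1s0].
have ss : 0 <= s0 - s1 by rewrite subr_ge0.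
have tn : 0 < theta p s0 ^+ n by rewrite exprn_gt0// theta_gt0.
have cT : shell_mass^-1 <= 2 * (theta p s0)^-1 ^+ n.
  by rewrite exprVn -[2]invrK -invfM mulrC ler_pV2 ?inE ?unitf_gt0 ?mulr_gt0 ?invr_gt0// mulrC.
apply: (@le_trans _ _ (2 * (theta p s0)^-1 ^+ n * expR (- (s1 * Tlo)) *
  \sum_(x' : 'rV[F]_n | [forall j in U, x' 0 j == x 0 j]) gauss_weight (s0 - s1) x')).
  rewrite mulr_sumr; apply: ler_sum => x' _; rewrite /shell_weight.
  case: ifP => [/andP[xT _]|_]; last first.
    by rewrite !mulr_ge0 ?exprn_ge0 ?invr_ge0 ?expR_ge0// ltW// theta_gt0.
  rewrite mulrC -!mulrA mulrA; apply: ler_pM => //.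
  - by rewrite invr_ge0 ltW.
  - exact: expR_ge0.
  rewrite /gauss_weight -expRD ler_expR.
  have : 0 <= s1 * (fp_sqnorm x' - Tlo) by rewrite mulr_ge0 ?subr_ge0.
  by lra.
rewrite ler_wpM2l// ?sum_gauss_weight_agree//.
by rewrite !mulr_ge0 ?exprn_ge0 ?invr_ge0 ?expR_ge0// ltW// theta_gt0.
Qed.

End ShellWeight.

(** * The normalized second moment of an LDA lattice *)

(** The triangle inequality, squared, obtained coordinatewise from the weighted inequality (x + y)^2
    <= (1 + b/a) x^2 + (1 + a/b) y^2. *)
Lemma sqnorm_add_le (R : realType) n (u w : 'rV[R]_n) (S T : R) : 0 < S -> 0 < T ->
  sqnorm u <= S -> sqnorm w <= T -> sqnorm (u + w) <= (Num.sqrt S + Num.sqrt T) ^+ 2.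
Proof.
move=> S0 T0 uS wT; set a := Num.sqrt S; set b := Num.sqrt T.
have a0 : 0 < a by rewrite sqrtr_gt0.
have b0 : 0 < b by rewrite sqrtr_gt0.
have aS : S = a ^+ 2 by rewrite sqr_sqrtr// ltW.
have bT : T = b ^+ 2 by rewrite sqr_sqrtr// ltW.
have H : sqnorm (u + w) <= (1 + b / a) * sqnorm u + (1 + a / b) * sqnorm w.
  rewrite /sqnorm !mulr_sumr -big_split/=; apply: ler_sum => i _; rewrite !mxE.
  set x := u 0 i; set y := w 0 i.
  have : 0 <= (b * x - a * y) ^+ 2 / (a * b) by rewrite divr_ge0 ?sqr_ge0 ?mulr_ge0// ltW.
  have -> : (b * x - a * y) ^+ 2 / (a * b) = b / a * x ^+ 2 + a / b * y ^+ 2 - 2 * x * y.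
    by field; rewrite !gt_eqF.
  by lra.
apply: (le_trans H).
have -> : (a + b) ^+ 2 = (1 + b / a) * S + (1 + a / b) * T.
  by rewrite aS bT; field; rewrite !gt_eqF.
by apply: lerD; rewrite ler_wpM2l// addr_ge0// divr_ge0// ltW.
Qed.

Section LDALattice.
Variables (R : realType) (p m n : nat) (Hh : 'M[bool]_(m, n)) (h : 'M['F_p]_(m, n)).
Hypothesis p_pr : prime p.
Local Notation F := 'F_p.

Definition int_syndrome (x : 'rV[int]_n) : 'cV[F]_m := syndrome Hh h (map_mx intr x).

Lemma LDA_memberE x : LDA_member Hh h x <-> int_syndrome x = 0.
Proof.
split=> [H|/colP H].
  by apply/colP => i; rewrite !mxE -[RHS](H i); apply: eq_bigr => j _; rewrite mxE.
move=> i; have := H i; rewrite !mxE => H'; rewrite -[RHS]H'.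
by apply: eq_bigr => j _; rewrite mxE.
Qed.

Lemma int_syndromeP x y :
  int_syndrome x = int_syndrome y <-> LDA_member Hh h (x - y).
Proof.
rewrite LDA_memberE /int_syndrome map_mxB syndromeB.
by split => [->|/eqP]; rewrite ?subrr// subr_eq0 => /eqP.
Qed.

Lemma LDA_member_period x : LDA_member Hh h (x *+ p).
Proof.
move=> i; apply: big1 => j _; rewrite mulmxnE -mulrzr -[_ *+ p]mulr_natr.
by rewrite !rmorphM/= rmorph_nat (pcharf0 (pchar_Fp p_pr)) !mulr0.
Qed.

Definition centered_lift (x : 'rV[F]_n) : 'rV[int]_n :=
  \row_(j < n) (let a : nat := x 0 j in if (a <= p - a)%N then a%:Z else a%:Z - p%:Z).

Lemma centered_liftK x : map_mx intr (centered_lift x) = x.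
Proof.
apply/rowP => j; rewrite !mxE /=; case: leqP => _.
  by rewrite -pmulrn natr_Zp.
by rewrite rmorphB/= -!pmulrn natr_Zp (pcharf0 (pchar_Fp p_pr)) subr0.
Qed.

Lemma sqnorm_centered_lift x :
  sqnorm (map_mx intr (centered_lift x)) = fp_sqnorm R x.
Proof.
apply: eq_bigr => j _; rewrite !mxE /= /fp_abs.
have xp : (nat_of_ord (x 0%R j) < p)%N.
  by apply: leq_trans (ltn_ord (x 0%R j)) _; rewrite Fp_cast.
case: leqP => xj; first by rewrite -pmulrn.
by rewrite rmorphB/= -!pmulrn natrB ?(ltnW xp)// -sqrrN opprB.
Qed.

Variables (mu : 'rV[F]_n -> R) (T e : R).
Hypothesis mu1 : \sum_x mu x = 1.
Hypothesis muT : forall x, mu x != 0 -> fp_sqnorm R x <= T.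
Hypothesis T0 : 0 < T.
Hypothesis n0 : (0 < n)%N.
Hypothesis e01 : 0 <= e < 1.
Hypothesis exc : excess Hh mu h <= e.

Let L : set 'rV[R]_n := LDA_lattice Hh h.
Let V := voronoi L.
(** [b1] bounds the squared norm of a cell point whose syndrome is hit by the shell, sqrt n being
    the diameter of the unit cube; [b2] is the bound available for all other syndromes, from the
    vectors p times the unit vectors. *)
Let b1 : R := (Num.sqrt n%:R + Num.sqrt T) ^+ 2.
Let b2 : R := n%:R * p%:R ^+ 2.

Let pm0 : 0 < p%:R ^+ m :> R. Proof. by rewrite exprn_gt0// ltr0n prime_gt0. Qed.

Let card_syn : #|{: 'cV[F]_m}|%:R = p%:R ^+ m :> R.
Proof. by rewrite card_mx card_Fp// muln1 natrX. Qed.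

Let S := charged mu (syndrome Hh h).

(** Cauchy-Schwarz gives the fraction 1 / (1 + e), which is at least 1 - e. *)
Lemma charged_fraction : p%:R ^+ m * (1 - e) <= #|S|%:R.
Proof.
have /andP[e0 e1] := e01; move: exc; rewrite /excess lerBlDr => H.
have := card_charged_ge (syndrome Hh h) mu1; rewrite -/S.
set Q := collision _ _ in H *; set c : R := #|S|%:R => cQ.
have c0 : 0 <= c by rewrite ler0n.
have H1 : p%:R ^+ m <= c * (e + 1).
  have : p%:R ^+ m * 1 <= p%:R ^+ m * (c * Q) by rewrite ler_pM2l.
  rewrite mulr1 mulrCA => /le_trans; apply; exact: ler_wpM2l.
apply: (@le_trans _ _ (c * (e + 1) * (1 - e))).
  by rewrite ler_wpM2r// subr_ge0 ltW.
have : 0 <= c * e ^+ 2 by rewrite mulr_ge0// sqr_ge0.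
by lra.
Qed.

Let synP := int_syndromeP.
Let latP := LDA_member_period.

Let mV : row_measurable (fun y => \1_V y : R).
Proof. exact: (@row_measurable_voronoi R n (LDA_member Hh h)). Qed.

Let p1 := prime_gt1 p_pr.

Lemma leb_Rn_LDA_le : (leb_Rn V <= (p%:R ^+ m)%:E)%E.
Proof.
have -> : leb_Rn V = int_Rn (fun y => (\1_V y * 1)%:E).
  by congr int_Rn; apply/funext => y; rewrite mulr1.
have m1 : row_measurable (fun _ : 'rV[R]_n => 1 : R) by exact: measurable_cst.
have := @int_Rn_voronoi_le R n p _ int_syndrome (LDA_member Hh h) p1 synP latP
  (fun=> 1) (fun=> ler01) m1 (fun=> 1) (fun=> ler01).
move=> /(_ (fun _ _ _ _ => lexx _)); congr (_ <= _)%E.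
by rewrite sumr_const card_syn.
Qed.

Lemma leb_Rn_LDA_ge : ((p%:R ^+ m * (1 - e))%:E <= leb_Rn V)%E.
Proof.
apply: (@le_trans _ _ (#|S|%:R)%:E); first by rewrite lee_fin charged_fraction.
apply: (@leb_Rn_voronoi_ge R n p _ int_syndrome (LDA_member Hh h) p1 synP latP S) => g.
rewrite inE.
move=> /existsP[x /andP[_ /eqP <-]]; exists (centered_lift x).
by rewrite /int_syndrome centered_liftK.
Qed.

Let b10 : 0 <= b1. Proof. exact: sqr_ge0. Qed.
Let b20 : 0 <= b2. Proof. by rewrite mulr_ge0// sqr_ge0. Qed.

Lemma second_moment_LDA_le :
  (int_Rn (fun y => (\1_V y * sqnorm y)%:E) <= (p%:R ^+ m * (b1 + e * b2))%:E)%E.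
Proof.
pose c (g : 'cV[F]_m) : R := if g \in S then b1 else b2.
have c0 g : 0 <= c g by rewrite /c; case: ifP.
have Hc u v : in_unit_cube u -> V (u + map_mx intr v) ->
    sqnorm (u + map_mx intr v) <= c (int_syndrome v).
  move=> /forallP uc Vuv; rewrite /c; case: ifP => [|_].
    rewrite inE => /existsP[x /andP[mux /eqP xv]].
    have vx : int_syndrome v = int_syndrome (centered_lift x).
      by rewrite -xv /int_syndrome centered_liftK.
    apply: le_trans (voronoi_min synP vx Vuv) _.
    apply: sqnorm_add_le => //; first by rewrite ltr0n.
      rewrite /sqnorm -[leRHS]mulr1 mulr_natl -[n in leRHS]card_ord -sumr_const.
      apply: ler_sum => i _; have /andP[u0 u1] := uc i.
      by rewrite exprn_ile1// ltW.
    by rewrite sqnorm_centered_lift muT.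
  rewrite /sqnorm /b2 mulr_natl -[n in leRHS]card_ord -sumr_const.
  apply: ler_sum => i _; have := voronoi_coord_bound p1 latP i Vuv.
  move=> H; rewrite -[leLHS]real_normK ?num_real// lerXn2r ?nnegrE//.
  apply: (le_trans H); rewrite ler_pdivrMr// ler_peMr//.
  by rewrite ler1n.
have := @int_Rn_voronoi_le R n p _ int_syndrome (LDA_member Hh h) p1 synP latP
  (@sqnorm R n) (@sqnorm_ge0 R n) (@row_measurable_sqnorm R n) c c0 Hc.
move=> /le_trans; apply; rewrite lee_fin.
rewrite (bigID (mem S))/= (eq_bigr (fun=> b1)); last by move=> g gS; rewrite /c gS.
rewrite sumr_const [X in _ + X](eq_bigr (fun=> b2)); last first.
  by move=> g /negbTE gS; rewrite /c gS.
have -> : \sum_(i | i \notin S) b2 = \sum_(i in ~: S) b2.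
  by apply: eq_bigl => i; rewrite finset.in_setC.
rewrite sumr_const -[b1 *+ _]mulr_natr -[b2 *+ _]mulr_natr.
have cS : #|S|%:R + #|~: S|%:R = p%:R ^+ m :> R.
  by rewrite -natrD cardsC card_syn.
have := charged_fraction; move: cS.
set x : R := #|S|%:R; set y : R := #|~: S|%:R; set q := p%:R ^+ m => xy xq.
have x0 : 0 <= y by rewrite ler0n.
have : 0 <= b1 * y by rewrite mulr_ge0.
have : b2 * y <= b2 * (e * q) by rewrite ler_wpM2l//; lra.
by rewrite -xy; lra.
Qed.

Lemma LDA_nsm_bounds :
  (2 * pi * expR 1)^-1 <= nsm L <=
  p%:R ^+ m * (b1 + e * b2) / (n%:R * (p%:R ^+ m * (1 - e)) `^ (1 + 2 / n%:R)).
Proof.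
have /andP[e0 e1] := e01.
have v00 : 0 < p%:R ^+ m * (1 - e) by rewrite mulr_gt0// subr_gt0.
have := leb_Rn_LDA_le; have := leb_Rn_LDA_ge; rewrite /nsm /vol_lat -/V.
have mom0 : (0 <= int_Rn (fun y => (\1_V y * sqnorm y)%:E))%E.
  by apply: int_Rn_ge0 => y; rewrite lee_fin mulr_ge0// sqnorm_ge0.
have := second_moment_LDA_le; rewrite /second_moment -/V.
case mE : (int_Rn (fun y => (\1_V y * sqnorm y)%:E)) mom0 => [M| |]//.
case vE : (leb_Rn V) => [v| |]//.
rewrite !lee_fin => M0 HM v1 v2 /=.
have v0 : 0 < v by exact: lt_le_trans v1.
apply/andP; split; first exact: (normalized_second_moment_ge mV vE mE v0 n0).
rewrite mulrC; apply: ler_pM => //.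
  by rewrite invr_ge0 mulr_ge0// powR_ge0.
have nR : 0 < n%:R :> R by rewrite ltr0n.
rewrite lef_pV2 ?posrE ?mulr_gt0 ?powR_gt0// ler_pM2l//.
by rewrite ge0_ler_powR ?nnegrE ?addr_ge0 ?divr_ge0// ltW.
Qed.

End LDALattice.

(** * Bounds on the expected excess *)

Section SideBounds.
Variables (R : realType) (p m n : nat) (Hh : 'M[bool]_(m, n)).

Lemma sum_expr_card (T : finType) (x : R) : \sum_(A : {set T}) x ^+ #|A| = (1 + x) ^+ #|T|.
Proof.
have -> : (1 + x) ^+ #|T| = \prod_(i : T) (x + 1) by rewrite prodr_const addrC.
rewrite bigA_distr; apply: eq_bigr => A _; rewrite -prodr_const [RHS](bigID (mem A))/=.
rewrite [X in _ = _ * X]big1 ?mulr1; last by move=> i /negbTE ->.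
by apply: eq_bigr => i ->.
Qed.

(** For sets within the range of (L2) this is alpha >= 1. A larger set contains one of exactly the
    threshold size, whose neighbourhood already has at least alpha n (1 - R) / (2 alpha) = m/2
    elements. *)
Lemma expansion_small_support (Rt alpha A beta B eps theta : R) :
  Rt < 1 -> 1 <= alpha -> m%:R = n%:R * (1 - Rt) :> R ->
  good_graph Hh Rt alpha A beta B eps theta ->
  forall S : {set 'I_n}, (2 * #|NV Hh S| < m)%N -> (#|S| <= #|NV Hh S|)%N.
Proof.
move=> Rt1 al1 mE [_ L2 _ _] S Sm.
have al0 : 0 < alpha by exact: lt_le_trans al1.
set c : R := n%:R * (1 - Rt) / (2 * alpha) in L2.
have c0 : 0 <= c by rewrite /c -mE divr_ge0// mulr_ge0// ltW.
have [Sc|Sc] := leP (#|S|%:R : R) (Num.ceil c)%:~R.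
  rewrite -(ler_nat R); apply: le_trans (L2 S Sc).
  by rewrite ler_peMl.
have [k kE] : exists k : nat, Num.ceil c = k%:Z.
  by exists `|Num.ceil c|%N; rewrite gez0_abs// ceil_ge0// (lt_le_trans _ c0)// ltrN10.
rewrite kE -pmulrn ltr_nat in Sc.
have [S' [S'S S'k]] : exists S' : {set 'I_n}, S' \subset S /\ #|S'| = k.
  by have /card_geqP[s [us sk sS]] := ltnW Sc; exists [set x in s]%SET; split;
   [apply/fintype.subsetP => x; rewrite inE => /sS | rewrite cardsE (card_uniqP us)].
have := L2 S'; rewrite kE S'k -pmulrn lexx => /(_ isT) H.
have sub : (#|NV Hh S'| <= #|NV Hh S|)%N.
  apply/subset_leq_card/fintype.subsetP => i; rewrite !inE => /existsP[j /andP[jS Hij]].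
  by apply/existsP; exists j; rewrite Hij andbT (fintype.subsetP S'S).
have ck : c <= k%:R by have := ceil_ge c; rewrite kE -pmulrn.
exfalso; move: Sm; apply/negP; rewrite -leqNgt -(ler_nat R) natrM.
apply: (@le_trans _ _ (2 * #|NV Hh S'|%:R)); last by rewrite ler_pM2l// ler_nat.
apply: (@le_trans _ _ (2 * (alpha * k%:R))); last by rewrite ler_pM2l.
apply: (@le_trans _ _ (2 * (alpha * c))); last by rewrite !ler_pM2l.
by rewrite /c -mE le_eqVlt; apply/orP; left; apply/eqP; field; rewrite gt_eqF.
Qed.

Variable a : {set 'I_n} -> R.

(** Small [T] expand by [B] and are summed by the binomial theorem, minus the empty set. Large [T]
    expand by [beta]; as the base is at most 1, each term is bounded at |T| = theta m, and the crude
    count of 2^m sets suffices. *)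
Lemma check_side_bound_le (t B beta theta : R) :
  (0 < p)%N -> 0 < t <= 1 -> (forall U, a U <= 2 * t ^+ #|U|) ->
  (forall T : {set 'I_m}, #|T|%:R <= theta * m%:R -> B * #|T|%:R <= #|NC Hh T|%:R) ->
  (forall T : {set 'I_m}, #|T|%:R <= m%:R / 2 :> R -> beta * #|T|%:R <= #|NC Hh T|%:R) ->
  p%:R * t `^ beta <= 1 ->
  check_side_bound p Hh a <= 2 * ((1 + p%:R * t `^ B) ^+ m - 1) +
    2 * (2 ^+ m * (p%:R * t `^ beta) `^ (theta * m%:R)).
Proof.
move=> p0 /andP[t0 t1] aU R1 R2 y1.
set x := p%:R * t `^ B; set y := p%:R * t `^ beta.
have pR : (0 : R) < p%:R by rewrite ltr0n.
have x0 : 0 < x by rewrite mulr_gt0// powR_gt0.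
have y0 : 0 < y by rewrite mulr_gt0// powR_gt0.
have tpow (c : R) (T : {set 'I_m}) : c * #|T|%:R <= #|NC Hh T|%:R ->
    p%:R ^+ #|T| * a (NC Hh T) <= 2 * (p%:R * t `^ c) ^+ #|T|.
  move=> cT; rewrite exprMn mulrCA ler_pM2l ?exprn_gt0//.
  apply: (le_trans (aU _)); rewrite ler_pM2l// -powR_mulrn ?(ltW t0)//.
  rewrite -[leRHS]powR_mulrn ?powR_ge0// -powRrM.
  by apply: ger_powR => //; rewrite t0.
have yT : 0 <= y `^ (theta * m%:R) by exact: powR_ge0.
apply: (@le_trans _ _ (\sum_(T : {set 'I_m} | (0 < #|T|)%N && (2 * #|T| <= m)%N)
    (2 * x ^+ #|T| + 2 * y `^ (theta * m%:R)))).
  apply: ler_sum => T /andP[T0 Tm].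
  have [Tt|Tt] := leP #|T|%:R (theta * m%:R).
    apply: (le_trans (tpow B T (R1 T Tt))); rewrite lerDl mulr_ge0//.
  have Tm2 : #|T|%:R <= m%:R / 2 :> R by rewrite ler_pdivlMr// mulrC -natrM ler_nat.
  apply: (le_trans (tpow beta T (R2 T Tm2))).
  apply: ler_wpDl; first by rewrite mulr_ge0// exprn_ge0// ltW.
  rewrite ler_pM2l// -[leLHS]powR_mulrn ?(ltW y0)//.
  have y01 : 0 < y <= 1 by rewrite y0.
  exact: (ger_powR y01 (ltW Tt)).
rewrite big_split/= lerD//.
  rewrite -mulr_sumr ler_pM2l// lerBrDr -[m in leRHS]card_ord -sum_expr_card.
  rewrite [leRHS](bigID (fun T : {set 'I_m} => (0 < #|T|)%N && (2 * #|T| <= m)%N))/=.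
  rewrite lerD2l (bigD1 finset.set0)/=; last by rewrite cards0.
  by rewrite cards0 expr0 lerDl sumr_ge0// => T _; rewrite exprn_ge0// ltW.
rewrite -mulr_sumr ler_pM2l//.
apply: (@le_trans _ _ (\sum_(T : {set 'I_m}) y `^ (theta * m%:R))).
  rewrite [leRHS](bigID (fun T : {set 'I_m} => (0 < #|T|)%N && (2 * #|T| <= m)%N))/=.
  by rewrite lerDl sumr_ge0.
have cT : #|{: {set 'I_m}}| = (2 ^ m)%N.
  by rewrite -cardsT -powersetT card_powerset cardsT card_ord.
by rewrite sumr_const cT -[leLHS]mulr_natl natrX.
Qed.

Lemma variable_side_bound_le (g t : R) : (0 < p)%N ->
  (forall S, a (~: S) <= 2 * g * t ^+ #|S|) ->
  variable_side_bound p m a <= 2 * g * p%:R ^+ m * (1 + t / p%:R) ^+ n.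
Proof.
move=> p0 aS; rewrite -[n in leRHS]card_ord -sum_expr_card mulr_sumr.
apply: ler_sum => S _.
have pR : (0 : R) < p%:R by rewrite ltr0n.
have c0 : 0 <= p%:R ^+ m * (p%:R)^-1 ^+ #|S| :> R.
  by rewrite mulr_ge0 ?exprn_ge0 ?invr_ge0 ?ltW.
apply: le_trans (ler_wpM2l c0 (aS S)) _.
by rewrite exprMn le_eqVlt; apply/orP; left; apply/eqP; ring.
Qed.

End SideBounds.

(** * Constants independent of the block length *)

Section Constants.
Variable R : realType.

(** A restatement of 1 + x < e^x. At x = eta and x = - eta these are the decay rates of the upper
    and lower tails of the shell. *)
Lemma expR_sqrt_lt1 (x : R) : x != 0 -> -1 < x -> expR (- (x / 2)) * Num.sqrt (1 + x) < 1.
Proof.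
move=> x0 x1.
have e2 : expR x = expR (x / 2) ^+ 2 by rewrite -expRM_natl; congr expR; field.
rewrite expRN mulrC ltr_pdivrMr ?expR_gt0// mul1r.
have -> : expR (x / 2) = Num.sqrt (expR x) by rewrite e2 sqrtr_sqr gtr0_norm// expR_gt0.
by rewrite ltr_sqrt ?expR_gt0// expR_gt1Dx.
Qed.

(** The three rates belong to the two tails and to the sum over supports. All are below 1, so a
    common [g] < 1 survives the loss (1 + k) / (1 - k) caused by replacing theta sums by
    integrals. *)
Lemma slack_constants (eta : R) : 0 < eta < 1 -> exists k g : R,
  [/\ 0 < k <= 10^-1, 0 < g < 1,
    expR (- (eta / 2)) * Num.sqrt (1 + eta) * (1 + k) <= g * (1 - k),
    expR (eta / 2) * Num.sqrt (1 - eta) * (1 + k) <= g * (1 - k)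
  & expR (- (eta ^+ 2 / 2)) * (1 + k) <= g * (1 - k)].
Proof.
move=> /andP[eta0 eta1].
set r1 := _ * Num.sqrt (1 + eta); set r2 := _ * Num.sqrt (1 - eta); set r3 := expR (- (eta ^+ 2 / 2)).
have r11 : r1 < 1 by apply: expR_sqrt_lt1; [rewrite gt_eqF|lra].
have r21 : r2 < 1.
  have := @expR_sqrt_lt1 (- eta); rewrite mulNr opprK; apply; [rewrite oppr_eq0 gt_eqF//|lra].
have r31 : r3 < 1 by rewrite expR_lt1 oppr_lt0 divr_gt0// exprn_gt0.
have r30 : 0 < r3 by exact: expR_gt0.
pose r := Num.max (Num.max r1 r2) r3.
have r_lt1 : r < 1 by rewrite !gt_max r11 r21.
have r0 : 0 < r by rewrite lt_max r30 orbT.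
(* Any k <= (1 - r) / (1 + 3 r) gives r (1 + k) <= (1 + r) / 2 * (1 - k), and r < 1. *)
pose k := Num.min 10^-1 ((1 - r) / 6).
have k0 : 0 < k by rewrite lt_min invr_gt0 ltr0n/= divr_gt0// subr_gt0.
have k1 : k <= 10^-1 by rewrite ge_min lexx.
have k2 : k <= (1 - r) / 6 by rewrite ge_min lexx orbT.
have H (s : R) : s <= r -> s * (1 + k) <= (1 + r) / 2 * (1 - k).
  move=> sr; apply: (@le_trans _ _ (r * (1 + k))); first by rewrite ler_wpM2r// addr_ge0// ltW.
  nra.
exists k, ((1 + r) / 2); split; rewrite ?k0//.
- by apply/andP; split; lra.
- by apply: H; rewrite !le_max lexx.
- by apply: H; rewrite !le_max lexx orbT.
- by apply: H; rewrite !le_max lexx orbT.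
Qed.

(** The left side is the upper bound obtained below for the normalized second moment; it is
    continuous in [eta], with value 1 / (2 pi e) at 0. *)
Lemma eta_constant (delta : R) : 0 < delta -> exists eta : R, 0 < eta <= 2^-1 /\
  ((Num.sqrt ((1 + eta) * expR (2 * eta) / (2 * pi * expR 1)) + eta) ^+ 2 + eta) /
    (1 - eta) ^+ 3 < (2 * pi * expR 1)^-1 + delta.
Proof.
move=> d0; pose f (e : R) : R :=
  ((Num.sqrt ((1 + e) * expR (2 * e) / (2 * pi * expR 1)) + e) ^+ 2 + e) / (1 - e) ^+ 3.
have c0 : 0 < 2 * pi * expR 1 :> R by rewrite !mulr_gt0 ?pi_gt0 ?expR_gt0.
have f0 : f 0 = (2 * pi * expR 1)^-1.
  rewrite /f !addr0 subr0 expr1n divr1 mulr0 expR0 !mul1r sqr_sqrtr//.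
  by rewrite invr_ge0 ltW.
have cid : (e : R) @[e --> (0 : R)] --> (0 : R) by exact: cvg_id.
have cexp : expR (2 * e) @[e --> (0 : R)] --> expR (2 * 0 : R).
  apply: (cvg_comp (fun e => 2 * e) expR); last exact: continuous_expR.
  by apply: cvgM => //; exact: cvg_cst.
have csqrt : Num.sqrt ((1 + e) * expR (2 * e) / (2 * pi * expR 1)) @[e --> (0 : R)] -->
    Num.sqrt ((1 + 0) * expR (2 * 0) / (2 * pi * expR 1) : R).
  apply: (cvg_comp (fun e => (1 + e) * expR (2 * e) / (2 * pi * expR 1)) Num.sqrt);
    last exact: sqrt_continuous.
  apply: cvgM; last exact: cvg_cst.
  by apply: cvgM => //; apply: cvgD => //; exact: cvg_cst.
have cf : f e @[e --> (0 : R)] --> f 0.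
  apply: cvgM.
    apply: cvgD => //.
    apply: (cvg_comp (fun e => Num.sqrt ((1 + e) * expR (2 * e) / (2 * pi * expR 1)) + e)
      (fun x => x ^+ 2)); last exact: exprn_continuous.
    exact: cvgD.
  apply: cvgV; first by rewrite subr0 expr1n oner_eq0.
  apply: (cvg_comp (fun e => 1 - e) (fun x => x ^+ 3)); last exact: exprn_continuous.
  by apply: cvgB => //; exact: cvg_cst.
have : \forall e \near (0 : R), f e < (2 * pi * expR 1)^-1 + delta.
  have : f 0 < (2 * pi * expR 1)^-1 + delta by rewrite f0 ltrDl.
  by move=> H; exact: (cvgr_lt _ cf _ H).
move=> /nbhs_ballP[r /= r0 H].
exists (Num.min 2^-1 (r / 2)); split.
  by rewrite lt_min invr_gt0 ltr0n/= divr_gt0// ge_min lexx.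
apply: H; rewrite /ball/= sub0r normrN gtr0_norm ?lt_min ?invr_gt0 ?ltr0n ?divr_gt0//.
by rewrite gt_min; apply/orP; right; rewrite ltr_pdivrMr// ltr_pMr// ltr1n.
Qed.

End Constants.

Lemma leq_three_half (b : nat) : (1 < b)%N -> (b <= 3 * b./2)%N.
Proof. by lia. Qed.

(* [eta] is the relative half-width of the shell, [k] the relative error allowed
   for the theta sums, and [g] the resulting rate of exponential decay. *)
Section FixedLength.
Variables (R : realType) (p m n : nat) (Hh : 'M[bool]_(m, n)).
Variables (Rt alpha A beta B eps vartheta eta k g delta : R).
Hypothesis p_pr : prime p.
Hypothesis n0 : (0 < n)%N.
Hypothesis Rt01 : 0 < Rt < 1.
Hypothesis mE : m%:R = n%:R * (1 - Rt) :> R.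
Hypothesis alpha1 : 1 <= alpha.
Hypothesis good : good_graph Hh Rt alpha A beta B eps vartheta.
Hypothesis eta0 : 0 < eta.
Hypothesis eta2 : eta <= 2^-1.
Hypothesis k0 : 0 < k.
Hypothesis k1 : k <= 10^-1.
Hypothesis g0 : 0 < g.
Hypothesis slack1 : expR (- (eta / 2)) * Num.sqrt (1 + eta) * (1 + k) <= g * (1 - k).
Hypothesis slack2 : expR (eta / 2) * Num.sqrt (1 - eta) * (1 + k) <= g * (1 - k).
Hypothesis slack3 : expR (- (eta ^+ 2 / 2)) * (1 + k) <= g * (1 - k).
Hypothesis delta_large :
  ((Num.sqrt ((1 + eta) * expR (2 * eta) / (2 * pi * expR 1)) + eta) ^+ 2 + eta) /
    (1 - eta) ^+ 3 < (2 * pi * expR 1)^-1 + delta.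

Local Notation q := ((p%:R : R) `^ (1 - Rt)).
Local Notation r := ((p%:R : R) `^ Rt).
Hypothesis q_large : 8 / k <= q.
Hypothesis q_large' : eta^-1 <= q.
Hypothesis r_large : 36 / (k * eta) <= r.
Hypothesis n_large : g ^+ n <= 4^-1.

Lemma pR_gt0 : (0 : R) < p%:R. Proof. by rewrite ltr0n prime_gt0. Qed.
Lemma q_gt0 : 0 < q. Proof. by rewrite powR_gt0 ?pR_gt0. Qed.
Lemma r_gt0 : 0 < r. Proof. by rewrite powR_gt0 ?pR_gt0. Qed.
Lemma mul_qr : q * r = p%:R.
Proof.
have P0 := pR_gt0; rewrite -powRD ?subrK ?powRr1 ?(ltW P0)//.
by apply/implyP => _; rewrite gt_eqF.
Qed.
Lemma r_ge1 : 1 <= r.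
Proof.
move: (eta0) (eta2) (k0) (k1) => eta0' eta2' k0' k1'.
apply: le_trans r_large; rewrite ler_pdivlMr ?mulr_gt0// mul1r.
have : k * eta <= 1 * 1 by apply: ler_pM; [exact: ltW|exact: ltW|lra|lra].
lra.
Qed.

(** The integral of the Gaussian exp(- s0 x^2), whose differential entropy is ln J + 1/2 = ln q +
    eta, just above the ln q per coordinate needed for p^m = q^n syndromes. The variance is J^2 / (2
    pi) = e^(2 eta) q^2 / (2 pi e). *)
Definition gauss_scale : R :=
  expR (eta - 2^-1) * q.
Local Notation J := gauss_scale.

Definition gauss_tilt : R := pi / J ^+ 2.
Local Notation s0 := gauss_tilt.

Definition shell_lo : R := n%:R * (1 - eta) / (2 * s0).
Definition shell_hi : R := n%:R * (1 + eta) / (2 * s0).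

Local Notation Tlo := shell_lo.
Local Notation Thi := shell_hi.

Lemma gauss_scale_gt0 : 0 < J. Proof. by rewrite mulr_gt0 ?expR_gt0 ?q_gt0. Qed.
Lemma gauss_scale_le : J <= q.
Proof. by rewrite ler_piMl ?(ltW q_gt0)// -[leRHS]expR0 ler_expR subr_le0. Qed.
Lemma gauss_scale_ge : q / 2 <= J.
Proof.
have eta0' := eta0; have q0 := q_gt0; rewrite mulrC ler_pM2r//; have := expR_ge1Dx (eta - 2^-1); lra.
Qed.
Lemma gauss_tilt_gt0 : 0 < s0. Proof. by rewrite divr_gt0 ?pi_gt0 ?exprn_gt0 ?gauss_scale_gt0. Qed.

(** Both errors of [theta_ge] are at most half of k J / sqrt c: the discretisation error 1 because J
    >= q/2, sqrt c <= 2 and q >= 8/k, the truncation at p/2 because r is large. *)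
Lemma theta_window c : eta <= c <= 2 ->
  (1 - k) * (J / Num.sqrt c) <= theta p (c * s0) <= (1 + k) * (J / Num.sqrt c).
Proof.
move: (eta0) (eta2) (k0) (k1) (g0) (q_large) (r_large) => eta0' eta2' k0' k1' g0' qL rL.
have P0 := pR_gt0; have q0 := q_gt0; have J0 := gauss_scale_gt0.
have s00 := gauss_tilt_gt0; have qJ := gauss_scale_ge; have Jq := gauss_scale_le.
move=> /andP[ec c2]; have c0 : 0 < c by exact: lt_le_trans ec.
have sc0 : 0 < c * s0 by exact: mulr_gt0.
have sqc : 0 < Num.sqrt c by rewrite sqrtr_gt0.
have sqc2 : Num.sqrt c <= 2.
  have -> : (2 : R) = Num.sqrt (2 ^+ 2) by rewrite sqrtr_sqr gtr0_norm.
  by rewrite ler_sqrt//; lra.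
have E : Num.sqrt (pi / (c * s0)) = J / Num.sqrt c.
  have -> : pi / (c * s0) = J ^+ 2 / c.
    have aux (a b : R) : 0 < a -> 0 < b -> a / (c * (a / b)) = b / c.
      by move=> a0 b0; field; rewrite !gt_eqF.
    by rewrite /gauss_tilt aux ?pi_gt0 ?exprn_gt0.
  by rewrite sqrtrM ?sqr_ge0// sqrtr_sqr gtr0_norm// sqrtrV// ltW.
have [w wE] : exists w, w = J / Num.sqrt c by eexists.
rewrite -wE in E *.
have w0 : 0 < w by rewrite wE divr_gt0.
have kw : 2 <= k * w.
  have : 4 / k <= J by apply: le_trans gauss_scale_ge; rewrite ler_pdivlMr//; lra.
  rewrite ler_pdivrMr// => kJ; rewrite wE mulrA ler_pdivlMr//; lra.
apply/andP; split; last first.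
  by apply: le_trans (theta_le p_pr sc0) _; rewrite E; lra.
apply: le_trans (theta_ge p_pr sc0); rewrite E.
have -> : pi / (c * s0 / 2) = 2 * (pi / (c * s0)).
  by rewrite [c * s0 / 2]mulrC invfM invrK mulrCA.
rewrite sqrtrM// E.
have sq2 : Num.sqrt (2 : R) <= 2.
  have -> : (2 : R) = Num.sqrt (2 ^+ 2) by rewrite sqrtr_sqr gtr0_norm.
  by rewrite ler_sqrt// sqrtr_sqr gtr0_norm//; lra.
have [z zE] : exists z, z = c * s0 * (p./2)%:R ^+ 2 / 2 by eexists.
rewrite -zE.
(* z is half the Gaussian exponent at p/2, of order eta r^2 since p = q r and J <= q. Using p <= 3
   floor(p/2) costs 9, whence 36 = 4 * 9 in [r_large]. *)
have zk : 4 / k <= z.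
  have K3 : p%:R <= 3 * (p./2)%:R :> R.
    by rewrite -natrM ler_nat leq_three_half// prime_gt1.
  have [K KE] : exists K : R, K = (p./2)%:R by eexists.
  rewrite -KE in K3 zE; have r0 := r_gt0; have r1 := r_ge1.
  have K0 : 0 < K by move: K3 P0; lra.
  have rJ : r * J <= 3 * K.
    by apply: le_trans K3; rewrite -[leRHS]mul_qr mulrC ler_pM2r.
  have rJ2 : (r * J) ^+ 2 <= (3 * K) ^+ 2.
    by rewrite lerXn2r ?nnegrE ?mulr_ge0// ltW.
  apply: (@le_trans _ _ (eta * r / 9)).
    move: rL; rewrite ler_pdivrMr ?mulr_gt0// ler_pdivrMr// => rL.
    by rewrite mulrAC ler_pdivlMr//; move: rL; lra.
  apply: (@le_trans _ _ (eta * r ^+ 2 / 9)).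
    rewrite ler_pM2r ?invr_gt0// ler_pM2l// expr2; exact: ler_peMl (ltW r0) r1.
  have -> : z = (c * pi * K ^+ 2 / 2) / J ^+ 2.
    by rewrite zE /gauss_tilt; ring.
  rewrite ler_pdivlMr ?exprn_gt0//.
  have -> : eta * r ^+ 2 / 9 * J ^+ 2 = eta / 9 * (r * J) ^+ 2 by ring.
  apply: (@le_trans _ _ (eta / 9 * (3 * K) ^+ 2)).
    by rewrite ler_pM2l// divr_gt0.
  have -> : c * pi * K ^+ 2 / 2 = c * (pi / 2) * K ^+ 2 by ring.
  have -> : eta / 9 * (3 * K) ^+ 2 = eta * 1 * K ^+ 2 by field.
  rewrite ler_pM2r ?exprn_gt0//; apply: ler_pM => //; first exact: ltW.
  by rewrite ler_pdivlMr// mul1r pi_ge2.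
have z0 : 0 < z by apply: lt_le_trans zk; rewrite divr_gt0.
have ez : expR (- z) <= k / 4.
  rewrite expRN -[leRHS]invrK lef_pV2 ?posrE ?expR_gt0 ?invr_gt0 ?divr_gt0//.
  rewrite invf_div (le_trans zk)//; have := expR_ge1Dx z; lra.
have : expR (- z) * (Num.sqrt 2 * w) <= k / 4 * (2 * w).
  apply: ler_pM => //.
    by rewrite mulr_ge0 ?sqrtr_ge0// ltW.
  by rewrite ler_pM2r.
lra.
Qed.

Lemma theta_tilt_gt0 : 0 < theta p s0. Proof. exact: theta_gt0. Qed.

Lemma theta_tilt_ge : (1 - k) * J <= theta p s0.
Proof.
move: (eta0) (eta2) (k0) (k1) (g0) (q_large) (r_large) => eta0' eta2' k0' k1' g0' qL rL.
have P0 := pR_gt0; have q0 := q_gt0; have J0 := gauss_scale_gt0.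
have s00 := gauss_tilt_gt0; have qJ := gauss_scale_ge; have Jq := gauss_scale_le.
have /andP[H _] := @theta_window 1 (ltac:(apply/andP; split; lra)).
by rewrite mul1r sqrtr1 divr1 in H.
Qed.

Lemma theta_tilt_ge_q : q / 4 <= theta p s0.
Proof.
move: (eta0) (eta2) (k0) (k1) (g0) (q_large) (r_large) => eta0' eta2' k0' k1' g0' qL rL.
have P0 := pR_gt0; have q0 := q_gt0; have J0 := gauss_scale_gt0.
have s00 := gauss_tilt_gt0; have qJ := gauss_scale_ge; have Jq := gauss_scale_le.
apply: le_trans theta_tilt_ge; apply: (@le_trans _ _ (2^-1 * J)); first by lra.
by rewrite ler_pM2r//; lra.
Qed.

(** Chernoff with parameters s0 / (1 + eta) and s0 / (1 - eta), for which the mean squared norm sits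
    on the edges of the shell. Each tail is at most (g theta)^n, a quarter of the total. *)
Lemma mass_large : theta p s0 ^+ n / 2 <= shell_mass p n s0 Tlo Thi.
Proof.
move: (eta0) (eta2) (k0) (k1) (g0) (q_large) (r_large) => eta0' eta2' k0' k1' g0' qL rL.
have P0 := pR_gt0; have q0 := q_gt0; have J0 := gauss_scale_gt0.
have s00 := gauss_tilt_gt0; have qJ := gauss_scale_ge; have Jq := gauss_scale_le.
have th0 := theta_tilt_gt0.
have g4 : (g * theta p s0) ^+ n <= theta p s0 ^+ n / 4.
  by rewrite exprMn mulrC ler_pM2l// exprn_gt0.
have up : \sum_(x : 'rV['F_p]_n | Thi < fp_sqnorm R x) gauss_weight s0 x <=
    (g * theta p s0) ^+ n.
  have e1 : 0 < 1 + eta by lra.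
  have ss : (1 + eta)^-1 * s0 <= s0 by rewrite ler_piMl ?(ltW gauss_tilt_gt0)// invf_le1//; lra.
  apply: le_trans (@upper_tail_le R p n s0 Thi _ ss) _.
  have -> : (s0 - (1 + eta)^-1 * s0) * Thi = n%:R * (eta / 2).
    by rewrite /shell_hi; field; rewrite !gt_eqF.
  rewrite -mulrN expRM_natl -exprMn lerXn2r ?nnegrE ?mulr_ge0 ?expR_ge0 ?(ltW g0) ?(ltW th0) ?(ltW (@theta_gt0 _ _ _))//.
  have cw : eta <= (1 + eta)^-1 <= 2.
    have ee : eta * eta <= 2^-1 * 1 by apply: ler_pM; [exact: ltW|exact: ltW|lra|lra].
    rewrite -div1r ler_pdivlMr// ler_pdivrMr//; apply/andP; split; lra.
  have /andP[_ H] := theta_window cw.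
  rewrite sqrtrV ?(ltW e1)// invrK in H.
  apply: (le_trans (ler_wpM2l (expR_ge0 _) H)).
  apply: (@le_trans _ _ (g * ((1 - k) * J))); last by rewrite ler_pM2l// theta_tilt_ge.
  apply: (@le_trans _ _ (expR (- (eta / 2)) * Num.sqrt (1 + eta) * (1 + k) * J)).
    by rewrite le_eqVlt; apply/orP; left; apply/eqP; ring.
  by rewrite [leRHS]mulrA ler_pM2r.
have lo : \sum_(x : 'rV['F_p]_n | fp_sqnorm R x < Tlo) gauss_weight s0 x <=
    (g * theta p s0) ^+ n.
  have e1 : 0 < 1 - eta by lra.
  have ss : s0 <= (1 - eta)^-1 * s0 by rewrite ler_peMl ?(ltW gauss_tilt_gt0)// invf_ge1//; lra.
  apply: le_trans (@lower_tail_le R p n s0 Tlo _ ss) _.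
  have -> : ((1 - eta)^-1 * s0 - s0) * Tlo = n%:R * (eta / 2).
    by rewrite /shell_lo; field; rewrite !gt_eqF.
  rewrite expRM_natl -exprMn lerXn2r ?nnegrE ?mulr_ge0 ?expR_ge0 ?(ltW g0) ?(ltW th0) ?(ltW (@theta_gt0 _ _ _))//.
  have cw : eta <= (1 - eta)^-1 <= 2.
    rewrite -div1r ler_pdivlMr// ler_pdivrMr//; apply/andP; split; last lra.
    have : 0 <= eta * eta by rewrite mulr_ge0 ?ltW.
    lra.
  have /andP[_ H] := theta_window cw.
  rewrite sqrtrV ?(ltW e1)// invrK in H.
  apply: (le_trans (ler_wpM2l (expR_ge0 _) H)).
  apply: (@le_trans _ _ (g * ((1 - k) * J))); last by rewrite ler_pM2l// theta_tilt_ge.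
  apply: (@le_trans _ _ (expR (eta / 2) * Num.sqrt (1 - eta) * (1 + k) * J)).
    by rewrite le_eqVlt; apply/orP; left; apply/eqP; ring.
  by rewrite [leRHS]mulrA ler_pM2r.
have := @shell_mass_ge R p n s0 Tlo Thi; lra.
Qed.

Definition agree_check (U : {set 'I_n}) : R :=
  2 * (theta p s0)^-1 ^+ n * expR (- (0 * Tlo)) * theta p (s0 - 0) ^+ #|~: U|.

(** This tilt nearly exhausts s0, so the bound is close to the largest point mass on the shell; the
    remaining eta s0 keeps the theta factor of order q, well below p. *)
Definition agree_variable (U : {set 'I_n}) : R :=
  2 * (theta p s0)^-1 ^+ n * expR (- (s0 * (1 - eta) * Tlo)) *
    theta p (s0 - s0 * (1 - eta)) ^+ #|~: U|.

(** The mean-excess bound takes one function for both sums; each sum then uses the half of the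
    minimum that suits it. *)
Definition agree_bound (U : {set 'I_n}) : R :=
  Num.min (agree_check U) (agree_variable U).

Lemma agree_boundP (x : 'rV['F_p]_n) (U : {set 'I_n}) :
  \sum_(x' : 'rV['F_p]_n | [forall j in U, x' 0 j == x 0 j]) shell_weight s0 Tlo Thi x' <=
  agree_bound U.
Proof.
have s00 := gauss_tilt_gt0; move: (eta0) (eta2) => eta0' eta2'.
rewrite le_min; apply/andP; split; apply: shell_weight_agree => //.
- exact: mass_large.
- by rewrite lexx ltW.
- exact: mass_large.
- by rewrite mulr_ge0 ?(ltW s00)/= ?ler_piMr ?(ltW s00)//; lra.
Qed.

Lemma agree_check_le (U : {set 'I_n}) : agree_bound U <= 2 * (theta p s0)^-1 ^+ #|U|.
Proof.
have th0 := theta_tilt_gt0; rewrite ge_min; apply/orP; left.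
rewrite /agree_check mul0r oppr0 expR0 mulr1 addr0 -mulrA ler_pM2l//.
have -> : (theta p s0)^-1 ^+ n = (theta p s0)^-1 ^+ #|U| * (theta p s0)^-1 ^+ #|~: U|.
  by rewrite -exprD cardsC card_ord.
by rewrite -mulrA -exprMn mulVf ?gt_eqF// expr1n mulr1.
Qed.

(** The sum over supports is binomial, and its base 1 + theta(eta s0) / p is at most 1 + k because
    theta(eta s0) is O(q) while p = q r. What remains is q^n times the largest point mass, which
    decays since the entropy exceeds ln q. *)
Lemma variable_side_small : variable_side_bound p m agree_bound <= 2 * g ^+ n.
Proof.
move: (eta0) (eta2) (k0) (k1) (g0) (q_large) (r_large) => eta0' eta2' k0' k1' g0' qL rL.
have P0 := pR_gt0; have q0 := q_gt0; have J0 := gauss_scale_gt0; have r0 := r_gt0.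
have s00 := gauss_tilt_gt0; have Jq := gauss_scale_le; have th0 := theta_tilt_gt0.
have [c cE] : exists c, c = (theta p s0)^-1 ^+ n * expR (- (s0 * (1 - eta) * Tlo)) by eexists.
apply: le_trans (@variable_side_bound_le _ p m n agree_bound c
  (theta p (eta * s0)) (prime_gt0 p_pr) _) _.
  move=> S; rewrite ge_min; apply/orP; right; rewrite /agree_variable finset.setCK.
  have -> : s0 - s0 * (1 - eta) = eta * s0 by ring.
  by rewrite cE !mulrA.
rewrite -!mulrA ler_pM2l// cE.
have -> : s0 * (1 - eta) * Tlo = n%:R * ((1 - eta) ^+ 2 / 2).
  by rewrite /shell_lo; field; rewrite gt_eqF.
have -> : p%:R ^+ m = q ^+ n :> R.
  rewrite -powR_mulrn ?(ltW P0)// mE mulrC powRrM powR_mulrn ?powR_ge0//.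
rewrite -mulrN expRM_natl -!exprMn lerXn2r ?nnegrE ?(ltW g0)//.
  by rewrite !mulr_ge0 ?invr_ge0 ?expR_ge0 ?(ltW th0) ?(ltW q0)// addr_ge0//
    divr_ge0 ?(ltW P0)// ltW// theta_gt0.
rewrite -mulrA [leLHS]mulrC ler_pdivrMr//.
have /andP[_ H] := @theta_window eta (ltac:(apply/andP; split; lra)).
have sq_eta : eta <= Num.sqrt eta.
  rewrite -{1}(sqr_sqrtr (ltW eta0')) expr2 ler_piMl ?sqrtr_ge0//.
  by rewrite -[leRHS]sqrtr1 ler_sqrt//; lra.
have tp : theta p (eta * s0) / p%:R <= k.
  rewrite ler_pdivrMr//; apply: (le_trans H).
  have seta0 : 0 < Num.sqrt eta by rewrite sqrtr_gt0.
  rewrite mulrA ler_pdivrMr// -mul_qr.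
  apply: (@le_trans _ _ (2 * q)).
    by apply: ler_pM => //; [lra|exact: ltW|lra].
  apply: (@le_trans _ _ (k * (q * r) * eta)); last first.
    by rewrite ler_wpM2l// !mulr_ge0// ltW.
  move: rL; rewrite ler_pdivrMr ?mulr_gt0// => rL.
  have -> : k * (q * r) * eta = (r * (k * eta)) * q by ring.
  by rewrite ler_pM2r//; lra.
apply: (@le_trans _ _ (expR (- ((1 - eta) ^+ 2 / 2)) * q * (1 + k))).
  rewrite -!mulrA ler_pM2l ?expR_gt0// ler_pM2l//; lra.
(* Expanding the square releases e^(eta - 1/2), which turns q into J and cancels against theta up to
   1 - k; the leftover e^(- eta^2 / 2) is the third rate. *)
have -> : expR (- ((1 - eta) ^+ 2 / 2)) = expR (- (eta ^+ 2 / 2)) * expR (eta - 2^-1).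
  by rewrite -expRD; congr expR; field.
have -> : expR (- (eta ^+ 2 / 2)) * expR (eta - 2^-1) * q * (1 + k) =
  expR (- (eta ^+ 2 / 2)) * (1 + k) * J by rewrite /gauss_scale; ring.
apply: (@le_trans _ _ (g * (1 - k) * J)); first by rewrite ler_pM2r.
by rewrite -mulrA ler_pM2l// theta_tilt_ge.
Qed.

Lemma theta_inv_le : 0 < (theta p s0)^-1 <= 1 /\ (theta p s0)^-1 <= 4 / q.
Proof.
move: (k0) (k1) (q_large) => k0' k1' qL.
have th0 := theta_tilt_gt0; have thq := theta_tilt_ge_q; have q0 := q_gt0.
have H : (theta p s0)^-1 <= 4 / q.
  by rewrite -[leRHS]invrK lef_pV2 ?posrE ?invr_gt0 ?divr_gt0// invf_div.
split=> //; rewrite invr_gt0 th0 (le_trans H)// ler_pdivrMr// mul1r.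
by move: qL; rewrite ler_pdivrMr//; nra.
Qed.

Hypothesis y_le1 : p%:R * (4 / q) `^ beta <= 1.
Hypothesis B0 : 0 <= B.
Hypothesis beta0 : 0 <= beta.
Hypothesis vartheta0 : 0 <= vartheta.

Lemma check_side_small : check_side_bound p Hh agree_bound <=
  2 * ((1 + p%:R * (4 / q) `^ B) ^+ m - 1) +
    2 * (2 ^+ m * (p%:R * (4 / q) `^ beta) `^ (vartheta * m%:R)).
Proof.
have P0 := pR_gt0; have q0 := q_gt0; have [t01 tq] := theta_inv_le.
have /andP[t0 _] := t01; have [_ _ R1 R2] := good.
have q40 : 0 <= 4 / q by rewrite divr_ge0// ltW.
have ty c : 0 <= c -> p%:R * (theta p s0)^-1 `^ c <= p%:R * (4 / q) `^ c.
  by move=> c0; rewrite ler_pM2l// ge0_ler_powR ?nnegrE ?(ltW t0).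
apply: le_trans (@check_side_bound_le R p m n Hh agree_bound (theta p s0)^-1 B beta
  vartheta (prime_gt0 p_pr) t01 agree_check_le _ _ _) _.
- by move=> T TT; apply: R1; rewrite -mulrA -mE.
- by move=> T TT; apply: R2; rewrite -mE.
- exact: le_trans (ty beta beta0) y_le1.
have PB0 c x : 0 <= p%:R * x `^ c by rewrite mulr_ge0 ?powR_ge0 ?(ltW P0).
apply: lerD; (apply: ler_wpM2l; first exact: ler0n).
  rewrite lerD2r; apply: lerXn2r; last by rewrite lerD2l ty.
    by rewrite nnegrE; apply: addr_ge0; [exact: ler01|exact: PB0].
  by rewrite nnegrE; apply: addr_ge0; [exact: ler01|exact: PB0].
apply: ler_wpM2l; first by rewrite exprn_ge0.
apply: ge0_ler_powR; [by rewrite mulr_ge0|exact: PB0|exact: PB0|exact: ty].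
Qed.

(** An exceptional coset costs n p^2 = n q^2 r^2, so the excess eta / r^2 makes all of them cost eta
    n q^2. The unit-cube offset is 1/q <= eta relative to the radius scale. *)
Lemma nsm_of_small_excess (h : 'M['F_p]_(m, n)) :
  excess Hh (shell_weight s0 Tlo Thi) h <= eta / r ^+ 2 ->
  `|nsm (LDA_lattice Hh h) - (2 * pi * expR 1)^-1 : R| < delta.
Proof.
move=> Hexc; move: (eta0) (eta2) (q_large') => eta0' eta2' qL.
have P0 := pR_gt0; have q0 := q_gt0; have J0 := gauss_scale_gt0; have r0 := r_gt0.
have s00 := gauss_tilt_gt0; have r1 := r_ge1.
have nR : 0 < n%:R :> R by rewrite ltr0n.
have T0 : 0 < Thi.
  by apply: divr_gt0; apply: mulr_gt0 => //; lra.
have e_eta : eta / r ^+ 2 <= eta.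
  by rewrite ler_pdivrMr ?exprn_gt0// ler_peMr ?(ltW eta0)// exprn_ege1.
have e01 : 0 <= eta / r ^+ 2 < 1.
  by rewrite divr_ge0 ?exprn_ge0 ?(ltW eta0) ?(ltW r0)//= (le_lt_trans e_eta)//; lra.
have muT (x : 'rV['F_p]_n) : shell_weight s0 Tlo Thi x != 0 -> fp_sqnorm R x <= Thi.
  by rewrite /shell_weight; case: ifP => [/andP[]//|]; rewrite eqxx.
have := LDA_nsm_bounds p_pr (sum_shell_weight mass_large) muT T0 n0 e01 Hexc.
move=> /andP[lo hi].
rewrite ger0_norm ?subr_ge0// ltrBlDl (le_lt_trans hi)//.
apply: le_lt_trans delta_large.
have [G GE] : exists G, G = (1 + eta) * expR (2 * eta) / (2 * pi * expR 1) by eexists.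
rewrite -GE; have G0 : 0 <= G.
  by rewrite GE divr_ge0 ?mulr_ge0 ?expR_ge0 ?pi_ge0//; lra.
have TE : Thi = n%:R * G * q ^+ 2.
  have -> : Thi = n%:R * (1 + eta) * J ^+ 2 / (2 * pi).
    rewrite /shell_hi /gauss_tilt mulrA; rewrite -[(2 * pi / J ^+ 2)^-1]/(_) invf_div.
    by rewrite mulrA.
  rewrite /gauss_scale exprMn -expRM_natl mulrBr mulfV ?pnatr_eq0// expRD expRN.
  by rewrite GE !invfM; ring.
have b1E : (Num.sqrt n%:R + Num.sqrt Thi) ^+ 2 = n%:R * q ^+ 2 * (q^-1 + Num.sqrt G) ^+ 2.
  rewrite TE sqrtrM ?mulr_ge0 ?(ltW nR)// sqrtrM ?(ltW nR)// sqrtr_sqr gtr0_norm//.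
  rewrite -[X in X * q ^+ 2 * _](sqr_sqrtr (ltW nR)) -!exprMn; congr (_ ^+ 2).
  by field; rewrite gt_eqF.
have b2E : eta / r ^+ 2 * (n%:R * p%:R ^+ 2) = n%:R * q ^+ 2 * eta.
  have -> : p%:R ^+ 2 = q ^+ 2 * r ^+ 2 by rewrite -exprMn mul_qr.
  by field; rewrite gt_eqF.
rewrite b1E b2E -mulrDr.
have Pm : p%:R ^+ m = q ^+ n :> R.
  rewrite -powR_mulrn ?(ltW P0)// mE mulrC powRrM powR_mulrn ?powR_ge0//.
have e1 : 0 < 1 - eta / r ^+ 2 by rewrite subr_gt0; case/andP: e01.
(* The exponent 1 + 2/n is at most 3 because n >= 1; this is the cube in [eta_constant]. *)
have den : q ^+ n * q ^+ 2 * (1 - eta) ^+ 3 <=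
    (p%:R ^+ m * (1 - eta / r ^+ 2)) `^ (1 + 2 / n%:R).
  rewrite Pm powRM ?exprn_ge0 ?(ltW q0) ?(ltW e1)//.
  have -> : (q ^+ n) `^ (1 + 2 / n%:R) = q ^+ n * q ^+ 2.
    rewrite powRD; last by apply/implyP => _; rewrite gt_eqF ?exprn_gt0.
    rewrite powRr1 ?exprn_ge0 ?(ltW q0)//; congr (_ * _).
    rewrite -[q ^+ n]powR_mulrn ?(ltW q0)// -powRrM mulrCA mulfV ?gt_eqF// mulr1.
    by rewrite powR_mulrn// ltW.
  have eta1 : 0 <= 1 - eta by lra.
  apply: ler_pM; [|exact: exprn_ge0|exact: lexx|].
    by apply: mulr_ge0; apply: exprn_ge0; exact: ltW.
  apply: (@le_trans _ _ ((1 - eta / r ^+ 2) ^+ 3)).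
    by apply: lerXn2r; rewrite ?nnegrE ?(ltW e1)// lerD2l lerN2.
  rewrite -[leLHS]powR_mulrn ?(ltW e1)//; apply: ger_powR.
    by rewrite e1/= lerBlDr lerDl; case/andP: e01.
  have : 2 / n%:R <= 2 :> R.
    by rewrite ler_pdivrMr// ler_peMr// ler1n.
  by lra.
have num : (q^-1 + Num.sqrt G) ^+ 2 + eta <= (Num.sqrt G + eta) ^+ 2 + eta.
  rewrite lerD2r lerXn2r ?nnegrE ?addr_ge0 ?sqrtr_ge0 ?invr_ge0 ?(ltW q0) ?(ltW eta0)//.
  rewrite addrC lerD2l -[leRHS]invrK lef_pV2 ?posrE ?invr_gt0//.
have eta1 : 0 < 1 - eta by lra.
have d3 : 0 < (1 - eta) ^+ 3 by exact: exprn_gt0.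
rewrite Pm in den *.
rewrite ler_pdivrMr; last first.
  apply: mulr_gt0 => //; apply: lt_le_trans den.
  by apply: mulr_gt0 => //; apply: mulr_gt0; exact: exprn_gt0.
have Num0 : 0 <= (Num.sqrt G + eta) ^+ 2 + eta by rewrite addr_ge0 ?sqr_ge0// ltW.
apply: (@le_trans _ _ (((Num.sqrt G + eta) ^+ 2 + eta) / (1 - eta) ^+ 3 *
   (n%:R * (q ^+ n * q ^+ 2 * (1 - eta) ^+ 3)))); last first.
  by rewrite ler_wpM2l ?divr_ge0 ?(ltW d3)// ler_pM2l.
have -> : ((Num.sqrt G + eta) ^+ 2 + eta) / (1 - eta) ^+ 3 *
   (n%:R * (q ^+ n * q ^+ 2 * (1 - eta) ^+ 3)) =
   q ^+ n * (n%:R * q ^+ 2 * ((Num.sqrt G + eta) ^+ 2 + eta)).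
  by field; rewrite gt_eqF.
by rewrite ler_pM2l ?exprn_gt0// ler_pM2l ?mulr_gt0 ?exprn_gt0.
Qed.

Lemma prob_nsm_close_ge :
  1 - (2 * ((1 + p%:R * (4 / q) `^ B) ^+ m - 1) +
    2 * (2 ^+ m * (p%:R * (4 / q) `^ beta) `^ (vartheta * m%:R)) + 2 * g ^+ n) *
    r ^+ 2 / eta <= prob_nsm_close p Hh delta.
Proof.
have r0 := r_gt0; have eta0' := eta0.
have e0 : 0 < eta / r ^+ 2 by rewrite divr_gt0// exprn_gt0.
have mu1 := sum_shell_weight mass_large.
have mu0 := shell_weight_ge0 mass_large.
have /andP[Rt0 Rt1] := Rt01.
have ex := expansion_small_support Rt1 alpha1 mE good.
have H := excess_markov p_pr mu0 mu1 ex agree_boundP e0.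
apply: (@le_trans _ _ (1 - (check_side_bound p Hh agree_bound +
    variable_side_bound p m agree_bound) / (eta / r ^+ 2))).
  rewrite lerD2l lerN2 invf_div -[leRHS]mulrA; apply: ler_wpM2r.
    by rewrite divr_ge0 ?sqr_ge0 ?(ltW eta0').
  by apply: lerD; [exact: check_side_small|exact: variable_side_small].
apply: (le_trans H); rewrite /prob_nsm_close.
have -> : #|([set: 'M['F_p]_(m, n)] : set _)| = #|[set: 'M['F_p]_(m, n)]%SET|.
  by apply: eq_card => h; rewrite finset.in_setT mem_set.
apply: ler_wpM2r; first by rewrite invr_ge0.
rewrite ler_nat subset_leq_card//; apply/fintype.subsetP => h; rewrite inE => hs.
by apply/mem_set/nsm_of_small_excess.
Qed.

End FixedLength.

(** * Asymptotics *)

Section ErrorTerms.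
Variable R : realType.

(** With this c, g^n is exp(c n) to the power - (D + 1), and c n <= exp(c n). *)
Lemma poly_geometric (D : nat) (g : R) : 0 < g < 1 ->
  exists2 C : R, 0 < C & forall n : nat, (0 < n)%N -> n%:R ^+ D * g ^+ n <= C / n%:R.
Proof.
move=> /andP[g0 g1]; have [c cE] : exists c, c = - ln g / D.+1%:R by eexists.
have c0 : 0 < c by rewrite cE divr_gt0// oppr_gt0 ln_lt0// g0.
exists ((c ^+ D.+1)^-1); first by rewrite invr_gt0 exprn_gt0.
move=> n n0; have nR : 0 < n%:R :> R by rewrite ltr0n.
have gE : g ^+ n = (expR (c * n%:R) ^+ D.+1)^-1.
  rewrite -expRM_natl -expRN cE -[in LHS](lnK (_ : g \is Num.pos)) ?posrE//.
  rewrite -expRM_natl; congr expR.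
  have : D.+1%:R != 0 :> R by rewrite pnatr_eq0.
  by move: (D.+1%:R) => d d0; field.
rewrite ler_pdivlMr// mulrAC -exprSr gE ler_pdivrMr ?exprn_gt0 ?expR_gt0//.
rewrite mulrC ler_pdivlMr ?exprn_gt0// -exprMn.
apply: lerXn2r; rewrite ?nnegrE ?mulr_ge0 ?expR_ge0 ?(ltW nR) ?(ltW c0)//.
by apply: le_trans (expR_ge1Dx _); rewrite mulrC lerDr.
Qed.

Lemma expr1Dx_le (x : R) m : 0 <= x -> m%:R * x <= 2^-1 -> (1 + x) ^+ m - 1 <= 2 * (m%:R * x).
Proof.
move=> x0; have [z zE] : exists z, z = m%:R * x by eexists.
rewrite -zE => z2; have z0 : 0 <= z by rewrite zE mulr_ge0.
have : (1 + x) ^+ m <= expR z.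
  rewrite zE expRM_natl; apply: lerXn2r; rewrite ?nnegrE ?expR_ge0 ?addr_ge0//.
  exact: expR_ge1Dx.
have : expR z <= 1 + 2 * z.
  rewrite -[expR z]invrK -expRN invf_ple ?posrE ?expR_gt0//; last by lra.
  apply: le_trans (expR_ge1Dx (- z)); rewrite -div1r ler_pdivrMr; last by lra.
  have : 0 <= z * (1 - 2 * z) by rewrite mulr_ge0//; lra.
  by lra.
by lra.
Qed.

Variables (P Rt : R).
Hypothesis P1 : 1 <= P.
Hypothesis Rt0 : 0 < Rt.
Hypothesis Rt1 : Rt < 1.
Local Notation q := (P `^ (1 - Rt)).
Local Notation r := (P `^ Rt).

Lemma mul_powR_ratio (c : R) : P * (4 / q) `^ c = 4 `^ c * P `^ (1 - (1 - Rt) * c).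
Proof.
have P0 : 0 < P by exact: lt_le_trans P1.
have PN : P != 0 by rewrite gt_eqF.
rewrite powRM ?invr_ge0 ?powR_ge0// -powRN -powRrM mulrCA; congr (_ * _).
rewrite -{1}(powRr1 (ltW P0)) -powRD; first by rewrite mulNr.
by rewrite PN implybT.
Qed.

Lemma sqr_r : r ^+ 2 = P `^ (2 * Rt).
Proof. by rewrite -powR_mulrn ?powR_ge0// -powRrM mulrC. Qed.

(** Single check nodes dominate: m p q^(-B) r^2 has p-exponent 1 - (1 - R) B + 2R, which the lower
    bound on [B] pushes down to -1. What is left is of order n/p. *)
Lemma check_error_small (B : R) (m n : nat) : 2 * (1 + Rt) <= B * (1 - Rt) ->
  (m <= n)%N -> 4 `^ B * (n%:R / P) <= 2^-1 ->
  2 * ((1 + P * (4 / q) `^ B) ^+ m - 1) * r ^+ 2 <= 4 * (4 `^ B * (n%:R / P)).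
Proof.
move=> Bge mn w2; have P0 : 0 < P by exact: lt_le_trans P1.
have PN : P != 0 by rewrite gt_eqF.
rewrite mul_powR_ratio sqr_r.
have [b bE] : exists b : R, b = 4 `^ B by eexists.
have b0 : 0 < b by rewrite bE powR_gt0.
rewrite -bE in w2 *; set x := b * _.
have x0 : 0 <= x by rewrite mulr_ge0 ?powR_ge0 ?(ltW b0).
have mnR : m%:R <= n%:R :> R by rewrite ler_nat.
have xr : x * P `^ (2 * Rt) <= b / P.
  rewrite /x -mulrA -powRD; last by rewrite PN implybT.
  rewrite ler_pM2l// -powR_inv1 ?(ltW P0)//; apply: ler_powR => //.
  lra.
have r1 : 1 <= P `^ (2 * Rt).
  by rewrite -[leLHS](powRr0 P); apply: ler_powR => //; rewrite mulr_ge0// ltW.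
have xP : x <= b / P by apply: le_trans xr; rewrite ler_peMr.
have mx : m%:R * x <= b * (n%:R / P).
  by rewrite [leRHS]mulrCA; apply: ler_pM.
have H := @expr1Dx_le x m x0 (le_trans mx w2).
apply: (@le_trans _ _ (2 * (2 * (m%:R * x)) * P `^ (2 * Rt))).
  by rewrite ler_wpM2r ?powR_ge0// ler_wpM2l.
have -> : 2 * (2 * (m%:R * x)) * P `^ (2 * Rt) = 4 * (m%:R * (x * P `^ (2 * Rt))) by ring.
rewrite ler_pM2l// [leRHS]mulrCA; apply: ler_pM => //.
by rewrite mulr_ge0 ?powR_ge0.
Qed.

Lemma check_ratio_le1 (beta : R) : 1 <= beta * (1 - Rt) ->
  4 `^ beta <= P `^ (beta * (1 - Rt) - 1) -> P * (4 / q) `^ beta <= 1.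
Proof.
move=> b1 H; have P0 : 0 < P by exact: lt_le_trans P1.
have -> : P * (4 / q) `^ beta = 4 `^ beta / P `^ (beta * (1 - Rt) - 1).
  by rewrite mul_powR_ratio -powRN; congr (_ * _ `^ _); ring.
by rewrite ler_pdivrMr ?powR_gt0// mul1r.
Qed.

(** Half of the negative exponent of p absorbs the factor 2 * 4^(beta theta) per check node. The
    other half, raised to the power m, is at most p^(-3), which beats r^2 <= p^2 with a factor 1/p
    to spare. *)
Lemma check_error_large (beta theta : R) (m : nat) :
  2 * 4 `^ (beta * theta) <= P `^ ((beta * (1 - Rt) - 1) * theta / 2) ->
  3 <= (beta * (1 - Rt) - 1) * theta / 2 * m%:R ->
  2 * (2 ^+ m * (P * (4 / q) `^ beta) `^ (theta * m%:R)) * r ^+ 2 <= 2 / P.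
Proof.
have P0 : 0 < P by exact: lt_le_trans P1.
have PN : P != 0 by rewrite gt_eqF.
have [c cE] : exists c, c = (beta * (1 - Rt) - 1) * theta / 2 by eexists.
rewrite -cE => H m3.
have -> : (P * (4 / q) `^ beta) `^ (theta * m%:R) =
    (4 `^ (beta * theta) * P `^ (- (2 * c))) ^+ m.
  rewrite mul_powR_ratio powRrM powR_mulrn ?powR_ge0//; congr (_ ^+ m).
  rewrite powRM ?powR_ge0// -!powRrM; congr (_ * _ `^ _).
  by rewrite cE; field.
rewrite -!mulrA ler_pM2l// mulrA -exprMn sqr_r.
have H2 : 2 * (4 `^ (beta * theta) * P `^ (- (2 * c))) <= P `^ (- c).
  rewrite mulrA (_ : - (2 * c) = - c + - c); last by ring.
  rewrite powRD ?PN ?implybT// mulrA ler_piMl ?powR_ge0//.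
  by rewrite powRN ler_pdivrMr ?powR_gt0// mul1r.
apply: (@le_trans _ _ ((P `^ (- c)) ^+ m * P `^ (2 * Rt))).
  rewrite ler_wpM2r ?powR_ge0//; apply: lerXn2r; rewrite ?nnegrE ?mulr_ge0 ?powR_ge0//.
rewrite -powR_mulrn ?powR_ge0// -powRrM -powRD ?PN ?implybT//.
rewrite -powR_inv1 ?(ltW P0)//; apply: ler_powR => //.
by move: (Rt1) => Rt1'; rewrite mulNr; lra.
Qed.

End ErrorTerms.

(** Applied to x = n^lambda, this makes p^(2R) polynomial in n, so that g^n dominates it. *)
Lemma prime_le_square (R : realType) (x : R) (p : nat) : 8 <= x ->
  (forall l : nat, prime l -> x <= l%:R -> (p <= l)%N) -> p%:R <= 4 * x ^+ 2.
Proof.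
move=> x8 pmin; pose M := `|Num.ceil x|%N.
have ME : Num.ceil x = M%:Z by rewrite gez0_abs// ceil_ge0//; lra.
have xM : x <= M%:R by have := ceil_ge x; rewrite ME.
have M2 : M%:R <= 2 * x.
  have := ceil_itv x; rewrite ME => /andP[h _].
  have : (M%:Z - 1)%:~R = M%:R - 1 :> R by rewrite rmorphB.
  by move=> h2; rewrite h2 in h; lra.
have M8 : (8 <= M)%N by rewrite -(ler_nat R); lra.
have [l l_pr /andP[Ml l2]] := prime_between_square M8.
have pl : (p <= M ^ 2)%N.
  by apply: leq_trans l2; apply: pmin => //; rewrite (le_trans xM)// ler_nat.
apply: (@le_trans _ _ ((M ^ 2)%:R)); first by rewrite ler_nat.
rewrite natrX; apply: (@le_trans _ _ ((2 * x) ^+ 2)).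
  by apply: lerXn2r; rewrite ?nnegrE//; lra.
by rewrite exprMn le_eqVlt; apply/orP; left; apply/eqP; ring.
Qed.

Lemma prob_nsm_close_le1 (R : realType) p m n (Hh : 'M[bool]_(m, n)) (delta : R) :
  prob_nsm_close p Hh delta <= 1.
Proof.
rewrite /prob_nsm_close ler_pdivrMr; last first.
  by rewrite ltr0n; apply/card_gt0P; exists 0; apply/mem_set.
by rewrite mul1r ler_nat; apply/subset_leq_card/fintype.subsetP => h _; apply/mem_set.
Qed.

(** * Growth of the block length and the prime along the sequence *)

Section Growth.
Variables (R : realType) (lam : R) (nn p : nat -> nat).
Hypothesis nn_oo : forall M : nat, exists K : nat, forall j : nat, (K <= j)%N -> (M <= nn j)%N.
Hypothesis lam1 : 1 < lam.
Hypothesis p_ge : forall j, (nn j)%:R `^ lam <= (p j)%:R :> R.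

Lemma near_length_ge (M : R) : \forall j \near \oo, M <= (nn j)%:R.
Proof.
have [K HK] := nn_oo (Num.bound `|M|).
exists K => // j /= /HK Kj; apply: (le_trans (ler_norm M)).
by rewrite (le_trans (ltW (archi_boundP (normr_ge0 M))))// ler_nat.
Qed.

Lemma near_prime_powR_ge (c M : R) : 0 < c -> \forall j \near \oo, M <= (p j)%:R `^ c.
Proof.
move=> c0; near=> j.
have n1 : 1 <= (nn j)%:R :> R by near: j; exact: near_length_ge.
have nM : (Num.max M 1) `^ c^-1 <= (nn j)%:R by near: j; exact: near_length_ge.
have M1 : 0 <= Num.max M 1 by rewrite le_max ler01 orbT.
have np : (nn j)%:R <= (p j)%:R :> R.
  apply: le_trans (p_ge j); rewrite -[leLHS](powRr1 (le_trans ler01 n1)).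
  by apply: ler_powR => //; exact: ltW.
apply: (@le_trans _ _ (Num.max M 1)); first by rewrite le_max lexx.
have -> : Num.max M 1 = ((Num.max M 1) `^ c^-1) `^ c.
  by rewrite -powRrM mulVf ?lt0r_neq0// powRr1.
by apply: ge0_ler_powR; [exact: ltW|rewrite nnegrE powR_ge0|rewrite nnegrE|exact: le_trans nM np].
Unshelve. all: by end_near. Qed.

Lemma near_length_div_prime_le (w : R) : 0 < w -> \forall j \near \oo, (nn j)%:R / (p j)%:R <= w.
Proof.
move=> w0; have l0 : 0 < lam - 1 by rewrite subr_gt0.
near=> j.
have n1 : 1 <= (nn j)%:R :> R by near: j; exact: near_length_ge.
have n0 : 0 < (nn j)%:R :> R by exact: lt_le_trans n1.
have nw : (w^-1) `^ (lam - 1)^-1 <= (nn j)%:R by near: j; exact: near_length_ge.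
have p0 : 0 < (p j)%:R :> R by apply: lt_le_trans (p_ge j); exact: powR_gt0.
rewrite ler_pdivrMr//; apply: (@le_trans _ _ (w * (nn j)%:R `^ lam)); last by rewrite ler_pM2l.
rewrite -[X in _ `^ X](subrK 1) powRD; last by rewrite (gt_eqF n0) implybT.
rewrite powRr1 ?(ltW n0)// mulrA ler_peMl ?(ltW n0)// -ler_pdivrMl// mulr1.
have wi : 0 <= w^-1 by rewrite invr_ge0 ltW.
have -> : w^-1 = ((w^-1) `^ (lam - 1)^-1) `^ (lam - 1).
  by rewrite -powRrM mulVf ?lt0r_neq0// powRr1.
by apply: ge0_ler_powR; [exact: ltW|rewrite nnegrE powR_ge0|rewrite nnegrE ltW|].
Unshelve. all: by end_near. Qed.

End Growth.

Theorem theorem3 (R : realType) (Rt : R) (DV DC : nat) (A B alpha beta lam : R)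
  (nn mm p : nat -> nat) (Hg : forall k : nat, 'M[bool]_(mm k, nn k)) :
  0 < Rt < 1 ->
  (0 < DV)%N -> (DV < DC)%N ->
  DV%:R / DC%:R = 1 - Rt :> R ->
  2 * (1 + Rt) < A ->
  2 * (1 + Rt) / (1 - Rt) < B ->
  1 <= alpha < A ->
  (1 - Rt)^-1 < beta -> beta < Num.min (2 / (1 - Rt)) B ->
  let eps := (1 - Rt) / (A + 1 - Rt) in
  let theta := (B * (1 - Rt) + 1)^-1 in
  degree_condition DV Rt alpha A beta B eps theta ->
  (* the block lengths tend to infinity *)
  (forall M : nat, exists K : nat, forall k : nat, (K <= k)%N -> (M <= nn k)%N) ->
  (* G^(n): (DV,DC)-regular, n variable nodes, n(1-R) check nodes, good *)
  (forall k, (mm k)%:R = (nn k)%:R * (1 - Rt) :> R) ->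
  (forall k, regular_bip (Hg k) DV DC) ->
  (forall k, good_graph (Hg k) Rt alpha A beta B eps theta) ->
  Num.max (Num.max (Num.max (Num.max (Rt^-1) ((1 - Rt)^-1))
     (2 / (A - 2 * (1 + Rt)))) (2 / (B * (1 - Rt) - 2 * (1 + Rt))))
     (2 * (1 - (A * B - 1)^-1 - A^-1)^-1) < lam ->
  (* p k is the smallest prime >= n^lambda *)
  (forall k, prime (p k) /\ (nn k)%:R `^ lam <= (p k)%:R /\
     forall q : nat, prime q -> (nn k)%:R `^ lam <= q%:R :> R -> (p k <= q)%N) ->
  (* probability that G(Lambda) is within delta of 1/(2 pi e) tends to 1 *)
  forall delta : R, 0 < delta ->
    (fun k => prob_nsm_close (p k) (Hg k) delta) @ \oo --> (1 : R).
Proof.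
move=> /andP[Rt0 Rt1] _ _ _ _ Bgt /andP[al1 _] be1 _ eps theta _ nn_oo mE _ good lam_gt pP delta d0.
have [eta [/andP[eta0 eta2] dl]] := eta_constant d0.
have eta01 : 0 < eta < 1 by rewrite eta0 (le_lt_trans eta2)//; lra.
have [k [g [/andP[k0 k1] g01 s1 s2 s3]]] := slack_constants eta01.
have /andP[g0 _] := g01.
have R1 : 0 < 1 - Rt by rewrite subr_gt0.
have lam1 : 1 < lam.
  apply: lt_trans (_ : Rt^-1 < lam); first by rewrite invf_gt1.
  by move: lam_gt; rewrite !gt_max => /andP[/andP[/andP[/andP[]]]].
have BR : 2 * (1 + Rt) <= B * (1 - Rt) by move: Bgt; rewrite ltr_pdivrMr// => /ltW.
have B0 : 0 <= B.
  by apply: le_trans (ltW Bgt); rewrite divr_ge0 ?(ltW R1)// mulr_ge0//; lra.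
have beR : 1 < beta * (1 - Rt) by move: be1; rewrite -div1r ltr_pdivrMr.
have be0 : 0 <= beta by apply: le_trans (ltW be1); rewrite invr_ge0 ltW.
have th0 : 0 < theta by rewrite invr_gt0 ltr_wpDl// mulr_ge0// ltW.
have p_ge j : (nn j)%:R `^ lam <= (p j)%:R :> R by have [_ []] := pP j.
have bR0 : 0 < beta * (1 - Rt) - 1 by rewrite subr_gt0.
have c0 : 0 < (beta * (1 - Rt) - 1) * theta / 2 by rewrite divr_gt0// mulr_gt0.
(* The exponent comes from r^2 <= p^2 <= (4 n^(2 lambda))^2 = 16 n^(4 lambda), with lambda rounded
   up to an integer. *)
have [C C0 HC] := poly_geometric (4 * Num.bound `|lam|)%N g01.
apply/cvgrPdist_le => e e0; near=> j.
rewrite ger0_norm ?subr_ge0 ?prob_nsm_close_le1// lerBlDr addrC -lerBlDr.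
have [p_pr [_ pmin]] := pP j.
have n1 : 1 <= (nn j)%:R :> R by near: j; exact: near_length_ge.
have nP : (0 < nn j)%N by rewrite -(ler_nat R).
have P1 : 1 <= (p j)%:R :> R by rewrite ler1n prime_gt0.
have P0 : 0 < (p j)%:R :> R by exact: lt_le_trans P1.
have mn : (mm j <= nn j)%N by rewrite -(ler_nat R) mE ler_piMr// gerBl ltW.
have qL : 8 / k <= (p j)%:R `^ (1 - Rt) by near: j; exact: near_prime_powR_ge lam1 p_ge _ _ R1.
have qL' : eta^-1 <= (p j)%:R `^ (1 - Rt) by near: j; exact: near_prime_powR_ge lam1 p_ge _ _ R1.
have rL : 36 / (k * eta) <= (p j)%:R `^ Rt by near: j; exact: near_prime_powR_ge lam1 p_ge _ _ Rt0.
have nD : (nn j)%:R ^+ (4 * Num.bound `|lam|) * g ^+ nn j <= C / (nn j)%:R by exact: HC.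
have CnL : C / 4^-1 <= (nn j)%:R by near: j; exact: near_length_ge.
(* [prob_nsm_close_ge] divides by [eta], so each of the three error terms may use eta e / 3; the 32
   is 2 * 16, from the factor of g^n and the bound on r^2. *)
have Cne : C / (eta * e / 3 / 32) <= (nn j)%:R by near: j; exact: near_length_ge.
have n0 : 0 < (nn j)%:R :> R by exact: lt_le_trans n1.
have nL : g ^+ nn j <= 4^-1.
  apply: (@le_trans _ _ (C / (nn j)%:R)).
    by apply: le_trans nD; rewrite ler_peMl ?exprn_ge0 ?(ltW g0)// exprn_ege1.
  by rewrite ler_pdivrMr// mulrC -ler_pdivrMr.
have be4 : 4 `^ beta <= (p j)%:R `^ (beta * (1 - Rt) - 1).
  by near: j; exact: near_prime_powR_ge lam1 p_ge _ _ bR0.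
have w2 : 4 `^ B * ((nn j)%:R / (p j)%:R) <= 2^-1.
  rewrite -ler_pdivlMl ?powR_gt0//; near: j; apply: near_length_div_prime_le lam1 p_ge _ _ => //.
have we : 4 `^ B * ((nn j)%:R / (p j)%:R) <= eta * e / 3 / 4.
  rewrite -ler_pdivlMl ?powR_gt0//; near: j; apply: near_length_div_prime_le lam1 p_ge _ _ => //.
  by rewrite mulr_gt0// ?invr_gt0 ?powR_gt0// !divr_gt0// mulr_gt0.
have H24 : 2 * 4 `^ (beta * theta) <= (p j)%:R `^ ((beta * (1 - Rt) - 1) * theta / 2).
  by near: j; exact: near_prime_powR_ge lam1 p_ge _ _ c0.
have Pe : 2 / (eta * e / 3) <= (p j)%:R.
  by rewrite -[leRHS](powRr1 (ltW P0)); near: j; exact: near_prime_powR_ge lam1 p_ge _ _ ltr01.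
have m3n : 3 / ((beta * (1 - Rt) - 1) * theta / 2 * (1 - Rt)) <= (nn j)%:R.
  by near: j; exact: near_length_ge.
have m3 : 3 <= (beta * (1 - Rt) - 1) * theta / 2 * (mm j)%:R.
  rewrite mE [leRHS]mulrCA -ler_pdivrMr//; exact: mulr_gt0.
have x8 : 8 <= (nn j)%:R `^ lam.
  apply: (@le_trans _ _ (nn j)%:R); first by near: j; exact: near_length_ge.
  by rewrite -[leLHS](powRr1 (ltW n0)); apply: ler_powR => //; exact: ltW.
have y1 : (p j)%:R * (4 / (p j)%:R `^ (1 - Rt)) `^ beta <= 1.
  by apply: check_ratio_le1 => //; exact: ltW.
have := @prob_nsm_close_ge R (p j) (mm j) (nn j) (Hg j) Rt alpha A beta B eps theta eta k g delta
  p_pr nP (introT andP (conj Rt0 Rt1)) (mE j) al1 (good j) eta0 eta2 k0 k1 g0 s1 s2 s3 dl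
  qL qL' rL nL y1 B0 be0 (ltW th0).
apply: le_trans; rewrite lerD2l lerN2 ler_pdivrMr//.
have E1 := check_error_small P1 Rt0 BR mn w2.
have E2 := @check_error_large R _ Rt P1 Rt1 beta theta (mm j) H24 m3.
have E3 : 2 * g ^+ nn j * ((p j)%:R `^ Rt) ^+ 2 <= 32 * (C / (nn j)%:R).
  have P4 := prime_le_square x8 pmin.
  have nb : (nn j)%:R `^ lam <= (nn j)%:R ^+ Num.bound `|lam|.
    rewrite -powR_mulrn ?(ltW n0)//; apply: ler_powR => //.
    by apply: (le_trans (ler_norm lam)); apply/ltW/archi_boundP.
  have r2 : ((p j)%:R `^ Rt) ^+ 2 <= 16 * (nn j)%:R ^+ (4 * Num.bound `|lam|).
    apply: (@le_trans _ _ ((p j)%:R ^+ 2)).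
      apply: lerXn2r; rewrite ?nnegrE ?powR_ge0 ?(ltW P0)//.
      by rewrite -[leRHS](powRr1 (ltW P0)); apply: ler_powR => //; exact: ltW.
    apply: (@le_trans _ _ ((4 * ((nn j)%:R `^ lam) ^+ 2) ^+ 2)).
      by apply: lerXn2r; rewrite ?nnegrE ?mulr_ge0 ?sqr_ge0 ?(ltW P0).
    rewrite mulnC exprM; move: nb; set y := _ ^+ Num.bound _ => nb.
    have -> : 16 * y ^+ 4 = (4 * y ^+ 2) ^+ 2 by ring.
    have y0 : 0 <= y by exact: le_trans (powR_ge0 _ _) nb.
    apply: lerXn2r; rewrite ?nnegrE ?mulr_ge0 ?sqr_ge0//.
    by rewrite ler_pM2l//; apply: lerXn2r; rewrite ?nnegrE ?powR_ge0.
  apply: (@le_trans _ _ (2 * g ^+ nn j * (16 * (nn j)%:R ^+ (4 * Num.bound `|lam|)))).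
    by rewrite ler_wpM2l// mulr_ge0// exprn_ge0// ltW.
  apply: (@le_trans _ _ (32 * ((nn j)%:R ^+ (4 * Num.bound `|lam|) * g ^+ nn j))).
    by rewrite le_eqVlt; apply/orP; left; apply/eqP; ring.
  by rewrite ler_pM2l.
have F2 : 2 / (p j)%:R <= eta * e / 3.
  by rewrite ler_pdivrMr// mulrC -ler_pdivrMr// divr_gt0// mulr_gt0.
have F3 : 32 * (C / (nn j)%:R) <= eta * e / 3.
  rewrite mulrC -ler_pdivlMr// ler_pdivrMr// mulrC -ler_pdivrMr//.
  by rewrite !divr_gt0// mulr_gt0.
have F1 : 4 * (4 `^ B * ((nn j)%:R / (p j)%:R)) <= eta * e / 3.
  by rewrite mulrC -ler_pdivlMr.
rewrite mulrDl (mulrDl _ _ (_ ^+ 2)) [leRHS](_ : _ = eta * e / 3 + eta * e / 3 + eta * e / 3); last by field.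
by apply: lerD; [apply: lerD|]; [exact: le_trans F1|exact: le_trans F2|exact: le_trans F3].
Unshelve. all: by end_near. Qed.
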